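(* Let $w$ be a strictly positive analytic weight on the unit circle $\mathbb{T}_1$, let $\rho<1$ be the associated constant, fix $r$ with $\rho<r<1$, and let $\Lambda=\max_{|z|=r}|\mathcal F(z)|$. Then for every $n\in\mathbb N$ such that $\Lambda r^n<\frac1r-r$, the monic orthogonal polynomial $\Phi_n$ satisfies $$ \Phi_n(z)=\begin{cases} \tau^{-1}z^nD_{\rm e}(z)\,\mathcal E_n(z), & |z|>1/r,\\[4pt] \tau^{-1}z^nD_{\rm e}(z)\,\mathcal E_n(z)-\dfrac{\tau\,\mathcal I_n(z)}{D_{\rm i}(z)}, & r<|z|<1/r,\\[8pt] -\dfrac{\tau\,\mathcal I_n(z)}{D_{\rm i}(z)}, & |z|<r. \end{cases} $$
   Context: Notation: for $s>0$, $\mathbb D_s=\{z\in\mathbb C:|z|<s\}$ and $\mathbb T_s=\{z\in\mathbb C:|z|=s\}$, oriented counterclockwise. A strictly positive analytic weight on $\mathbb T_1$ is a function $w$ that is strictly positive on $\mathbb T_1$ and extends to a nowhere vanishing holomorphic function on an open set containing $\mathbb T_1$. The orthonormal polynomials $\varphi_n(z)=\kappa_nz^n+\dots$, $\kappa_n>0$, satisfy $\oint_{\mathbb T_1}\varphi_n\overline{\varphi_m}\,w\,|dz|=\delta_{mn}$, and $\Phi_n=\varphi_n/\kappa_n$ is monic. Szegő functions: $D(z)=\exp\left(\frac1{4\pi}\int_0^{2\pi}\log w(e^{i\theta})\frac{e^{i\theta}+z}{e^{i\theta}-z}\,d\theta\right)$ for $|z|\ne1$; $D_{\rm i}$ is its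 restriction to $|z|<1$ and $D_{\rm e}$ its restriction to $|z|>1$. Both extend holomorphically across $\mathbb T_1$ (same notation for the continuations), and $D_{\rm i}(z)/D_{\rm e}(z)=w(z)$, $\overline{D_{\rm i}(1/\overline z)}=1/D_{\rm e}(z)$. Put $\rho=\inf\{0<s<1: D_{\rm e}\text{ is (extends) holomorphic in }|z|>s\}$; one has $\rho<1$, and $1/D_{\rm i}$ extends holomorphically to $|z|<1/\rho$. Put $\tau=1/D_{\rm i}(0)=\exp\left(-\frac1{4\pi}\int_0^{2\pi}\log w(e^{i\theta})\,d\theta\right)>0$ and $\mathcal F(z)=D_{\rm i}(z)D_{\rm e}(z)$, which is holomorphic in $\rho<|z|<1$, while $1/\mathcal F$ is holomorphic in $1<|z|<1/\rho$. Operators (for fixed $r\in(\rho,1)$), acting on functions holomorphic in $\mathbb C\setminus(\mathbb T_r\cup\mathbb T_{1/r})$ with continuous boundary values, where $f_-$ denotes the boundary values of $f$ from the exterior side of the circle of integration: $$\mathcal M_n^{\rm i}(f)(z)=-\frac1{2\pi i\,\tau^2}\oint_{\mathbb T_r}f_-(t)\frac{\mathcal F(t)t^n}{t-z}\,dt,\qquad \mathcal M_n^{\rm e}(f)(z)=\frac{\tau^2}{2\pi i}\oint_{\mathbb T_{1/r}}f_-(t)\frac{1}{\mathcal F(t)\,t^n(t-z)}\,dt .$$ Define $f_n^{(0)}=1$, $f_n^{(2k+1)}=\mathcal M_n^{\rm i}(f_n^{(2k)})$, $f_n^{(2k+2)}=\mathcal M_n^{\rm e}(f_n^{(2k+1)})$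 for $k\ge0$, and $$\mathcal E_n(z)=\sum_{k=0}^\infty f_n^{(2k)}(z)\ (|z|\ne1/r),\qquad \mathcal I_n(z)=\sum_{k=0}^\infty f_n^{(2k+1)}(z)\ (|z|\ne r).$$ These series converge absolutely and locally uniformly when $\Lambda r^n<\frac1r-r$. In each region, $\mathcal E_n$ and $\mathcal I_n$ are given by these series (the integrals being evaluated at the given $z$), not by analytic continuation from another region. *)

(* Defs.v *)
From Stdlib Require Import Reals.
From Coquelicot Require Import Coquelicot.
Local Open Scope R_scope.

(* Coquelicot's [Complex] has no complex exponential. *)
Definition Cexp (z : C) : C := (exp (Re z) * cos (Im z), exp (Re z) * sin (Im z)).

Definition expi (t : R) : C := Cexp (Ci * RtoC t)%C.

Definition holomorphic_on (U : C -> Prop) (f : C -> C) : Prop :=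
  forall z : C, U z -> ex_derive (K := C_AbsRing) (V := C_NormedModule) f z.

Definition CRInt (f : R -> C) (a b : R) : C :=
  RInt (V := C_R_CompleteNormedModule) f a b.

(* Integral of [f t dt] over the circle of radius [s], counterclockwise. *)
Definition circle_int (s : R) (f : C -> C) : C :=
  CRInt (fun t => f (RtoC s * expi t) * (Ci * (RtoC s * expi t)))%C 0 (2 * PI).

Definition CSeries (a : nat -> C) : C :=
  iota (T := C_CompleteNormedModule)
    (is_series (K := C_AbsRing) (V := C_NormedModule) a).

(* Boundary value of [f] at [t], taken from the exterior of the circle
   centered at 0 through [t]. *)
Definition exterior_value (f : C -> C) (t : C) : C :=
  iota (T := C_CompleteNormedModule)
    (fun l : C =>
       filterlim f
         (within (fun z : C => Cmod t < Cmod z) (locally (T := C_UniformSpace) t))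
         (locally (T := C_UniformSpace) l)).

(* Only the values of [w] on the unit circle matter. *)
Definition analytic_weight (w : C -> R) : Prop :=
  (forall z : C, Cmod z = 1 -> 0 < w z) /\
  exists (U : C -> Prop) (W : C -> C),
    open (T := C_UniformSpace) U /\
    (forall z : C, Cmod z = 1 -> U z) /\
    holomorphic_on U W /\
    (forall z : C, U z -> W z <> RtoC 0) /\
    (forall z : C, Cmod z = 1 -> W z = RtoC (w z)).

(* [phi n] is a polynomial function of degree [n] with leading coefficient
   [kappa n]. *)
Definition orthonormal_polynomials
    (w : C -> R) (phi : nat -> C -> C) (kappa : nat -> R) : Prop :=
  (forall n : nat, 0 < kappa n) /\
  (forall n : nat, exists a : nat -> C,
     a n = RtoC (kappa n) /\
     forall z : C,
       phi n z = sum_n (G := C_AbelianMonoid) (fun k => a k * z ^ k)%C n) /\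
  (forall n m : nat,
     CRInt (fun t => phi n (expi t) * Cconj (phi m (expi t))
                       * RtoC (w (expi t)))%C 0 (2 * PI)
     = RtoC (if Nat.eqb n m then 1 else 0)).

(* The Szego integral; it is used for [Cmod z <> 1] only. *)
Definition szego (w : C -> R) (z : C) : C :=
  Cexp (RtoC (/ (4 * PI))
        * CRInt (fun t => RtoC (ln (w (expi t)))
                            * ((expi t + z) / (expi t - z)))%C 0 (2 * PI))%C.

Definition De_extension (w : C -> R) (s : R) (f : C -> C) : Prop :=
  holomorphic_on (fun z => s < Cmod z) f /\
  (forall z : C, 1 < Cmod z -> f z = szego w z).

Definition inv_Di_extension (w : C -> R) (s : R) (f : C -> C) : Prop :=
  holomorphic_on (fun z => Cmod z < s) f /\
  (forall z : C, Cmod z < 1 -> f z = Cinv (szego w z)).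

Definition rho (w : C -> R) : Rbar :=
  Glb_Rbar (fun s => 0 < s < 1 /\ exists f : C -> C, De_extension w s f).

(* The exterior Szego function continued to [Cmod z > rho w]; by the identity
   theorem the value does not depend on the extension. *)
Definition De (w : C -> R) (z : C) : C :=
  iota (T := C_CompleteNormedModule)
    (fun v : C => exists (s : R) (f : C -> C),
       0 < s < 1 /\ s < Cmod z /\ De_extension w s f /\ f z = v).

Definition Di (w : C -> R) (z : C) : C := szego w z.

(* [1 / Di] continued to [Cmod z < 1 / rho w].  It is the reciprocal, not [Di],
   that is continued: it may have zeros in [1 < Cmod z]. *)
Definition inv_Di (w : C -> R) (z : C) : C :=
  iota (T := C_CompleteNormedModule)
    (fun v : C => exists (s : R) (f : C -> C),
       1 < s /\ Cmod z < s /\ inv_Di_extension w s f /\ f z = v).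

Definition tau (w : C -> R) : R :=
  exp (- (/ (4 * PI) * RInt (fun t => ln (w (expi t))) 0 (2 * PI))).

(* [Di * De] in [rho w < Cmod z < 1]. *)
Definition calF (w : C -> R) (z : C) : C := (Di w z * De w z)%C.

(* [1 / (Di * De)] in [1 < Cmod z < 1 / rho w]. *)
Definition inv_calF (w : C -> R) (z : C) : C := (inv_Di w z / De w z)%C.

Definition Mi (w : C -> R) (r : R) (n : nat) (f : C -> C) (z : C) : C :=
  (- (/ (RtoC (2 * PI) * Ci * RtoC (tau w ^ 2)))
   * circle_int r
       (fun t => exterior_value f t * (calF w t * t ^ n / (t - z))))%C.

Definition Me (w : C -> R) (r : R) (n : nat) (f : C -> C) (z : C) : C :=
  (RtoC (tau w ^ 2) / (RtoC (2 * PI) * Ci)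
   * circle_int (/ r)
       (fun t => exterior_value f t * (inv_calF w t / (t ^ n * (t - z)))))%C.

Fixpoint iterate (w : C -> R) (r : R) (n k : nat) : C -> C :=
  match k with
  | O => fun _ => RtoC 1
  | S j => if Nat.even j then Mi w r n (iterate w r n j)
           else Me w r n (iterate w r n j)
  end.

Definition calE (w : C -> R) (r : R) (n : nat) (z : C) : C :=
  CSeries (fun k => iterate w r n (2 * k) z).

Definition calI (w : C -> R) (r : R) (n : nat) (z : C) : C :=
  CSeries (fun k => iterate w r n (2 * k + 1) z).

Definition is_max_on_circle (g : C -> R) (r M : R) : Prop :=
  (forall z : C, Cmod z = r -> g z <= M) /\ (exists z : C, Cmod z = r /\ g z = M).

(* Main.v *)
Require Import Defs.
From Stdlib Require Import Reals Lra Lia Wf_nat ClassicalEpsilon.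
From Coquelicot Require Import Coquelicot.
Local Open Scope R_scope.

(* Put [Et = tau Phi_n / (z^n De)] for [1/r < |z|] and [It = - Phi_n / (tau (1/Di))]
   for [|z| < r].  By orthogonality the Laurent splitting of [Phi_n w / z^n] near
   the unit circle yields a holomorphic [Et] in [|z| < 1/r] and a holomorphic
   [It], vanishing at infinity, in [r < |z|], such that
   [Phi_n = z^n De Et / tau - tau It / Di] where all four are defined.
   Cauchy's formula for the disc and for its exterior turns these properties into
   [It = Mi Et] and [Et = 1 + Me It].  Hence the partial sums of the two series
   differ from [Et] and [It] by iterates of [Me Mi], whose norm on the circle of
   radius [r] is at most [(Lambda r^n / (1/r - r))^2 < 1].  The boundary values
   satisfy [w = Di / De] because of the Poisson integral. *)

(** * Continuity and complex differentiation *)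

(** All contours are circles about the origin, so the only deformation needed is from one concentric
    circle to another; logarithmic coordinates reduce it to Goursat's theorem on rectangles. The
    obstacle is the unit circle: the two Szego functions are integrals off it and continuations
    across it, while [w] is known on it alone. Schwarz reflection z -> 1 / conj z removes it. It
    exchanges the extensions of De with those of 1/Di, so that on |t| = 1 the product De / Di is
    |De|^2 and only the radial limit of a modulus has to be computed. The same reflection transfers
    uniqueness, non-vanishing and the bound Lambda from one side of the circle to the other. De and
    1/Di may have zeros away from the unit circle inside their domains of continuation. The Laurent
    splitting is therefore made in a thin annulus free of zeros, and its two parts are continued
    from there by formulas that divide only by the factor known not to vanish. *)

Notation CC f x := (continuous (U := C_UniformSpace) f x).
Notation Cder f z l := (is_derive (K := C_AbsRing) (V := C_NormedModule) f z l).

Lemma CC_pair {T : UniformSpace} (f : T -> C) (x : T) :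
  continuous (fun y => Re (f y)) x -> continuous (fun y => Im (f y)) x -> CC f x.
Proof.
  intros H1 H2 P [e He].
  assert (A1 := H1 _ (locally_ball (T := R_UniformSpace) (Re (f x)) e)).
  assert (A2 := H2 _ (locally_ball (T := R_UniformSpace) (Im (f x)) e)).
  unfold filtermap in *.
  generalize (filter_and _ _ A1 A2). apply filter_imp.
  intros y [B1 B2]. apply He. split; assumption.
Qed.

Lemma CC_Re {T : UniformSpace} (f : T -> C) (x : T) :
  CC f x -> continuous (fun y => Re (f y)) x.
Proof.
  intros H P [e He].
  assert (A := H _ (locally_ball (T := C_UniformSpace) (f x) e)).
  unfold filtermap in *. revert A. apply filter_imp. intros y [B1 B2]. apply He, B1.
Qed.

Lemma CC_Im {T : UniformSpace} (f : T -> C) (x : T) :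
  CC f x -> continuous (fun y => Im (f y)) x.
Proof.
  intros H P [e He].
  assert (A := H _ (locally_ball (T := C_UniformSpace) (f x) e)).
  unfold filtermap in *. revert A. apply filter_imp. intros y [B1 B2]. apply He, B2.
Qed.

Lemma CC_plus {T : UniformSpace} (f g : T -> C) (x : T) :
  CC f x -> CC g x -> CC (fun y => f y + g y)%C x.
Proof.
  intros Hf Hg. apply CC_pair.
  - apply (continuous_plus (V := R_NormedModule) (fun y => Re (f y)) (fun y => Re (g y)));
    apply CC_Re; assumption.
  - apply (continuous_plus (V := R_NormedModule) (fun y => Im (f y)) (fun y => Im (g y)));
    apply CC_Im; assumption.
Qed.

Lemma CC_opp {T : UniformSpace} (f : T -> C) (x : T) :
  CC f x -> CC (fun y => - f y)%C x.
Proof.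
  intros Hf. apply CC_pair.
  - apply (continuous_opp (V := R_NormedModule) (fun y => Re (f y))), CC_Re; assumption.
  - apply (continuous_opp (V := R_NormedModule) (fun y => Im (f y))), CC_Im; assumption.
Qed.

Lemma CC_minus {T : UniformSpace} (f g : T -> C) (x : T) :
  CC f x -> CC g x -> CC (fun y => f y - g y)%C x.
Proof.
  intros Hf Hg. apply (CC_plus f (fun y => - g y)%C); auto. apply CC_opp; auto.
Qed.

Lemma CC_mult {T : UniformSpace} (f g : T -> C) (x : T) :
  CC f x -> CC g x -> CC (fun y => f y * g y)%C x.
Proof.
  intros Hf Hg.
  assert (A1 := CC_Re f x Hf). assert (A2 := CC_Im f x Hf).
  assert (B1 := CC_Re g x Hg). assert (B2 := CC_Im g x Hg).
  apply CC_pair.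
  - exact (continuous_minus (V := R_NormedModule) _ _ x
      (continuous_mult (K := R_AbsRing) _ _ x A1 B1)
      (continuous_mult (K := R_AbsRing) _ _ x A2 B2)).
  - exact (continuous_plus (V := R_NormedModule) _ _ x
      (continuous_mult (K := R_AbsRing) _ _ x A1 B2)
      (continuous_mult (K := R_AbsRing) _ _ x A2 B1)).
Qed.

Lemma CC_const {T : UniformSpace} (c : C) (x : T) : CC (fun _ : T => c) x.
Proof. apply continuous_const. Qed.

Lemma CC_id (x : C) : CC (fun y : C_UniformSpace => y) x.
Proof. apply continuous_id. Qed.

Lemma CC_RtoC {T : UniformSpace} (f : T -> R) (x : T) :
  continuous f x -> CC (fun y => RtoC (f y)) x.
Proof.
  intros H. apply CC_pair; simpl. exact H. apply continuous_const.
Qed.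

Lemma CC_conj {T : UniformSpace} (f : T -> C) (x : T) :
  CC f x -> CC (fun y => Cconj (f y)) x.
Proof.
  intros Hf. apply CC_pair. apply (CC_Re f); auto.
  apply (continuous_opp (V := R_NormedModule) (fun y => Im (f y))). apply CC_Im; auto.
Qed.

Lemma Cmod_sqr_neq_0 (z : C) : z <> 0 -> Re z * Re z + Im z * Im z <> 0.
Proof.
  intros H E. apply H. destruct z as [a b]; simpl in E.
  assert (a = 0) by nra. assert (b = 0) by nra. subst; reflexivity.
Qed.

Lemma continuous_normsq {T : UniformSpace} (f : T -> C) (x : T) :
  CC f x -> continuous (fun y => Re (f y) ^ 2 + Im (f y) ^ 2) x.
Proof.
  intros Hf. assert (A1 := CC_Re f x Hf). assert (A2 := CC_Im f x Hf).
  apply (continuous_ext (fun y => Re (f y) * Re (f y) + Im (f y) * Im (f y))).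
  { intros y. match goal with |- ?a = ?b => change (@eq R a b) end. ring. }
  exact (continuous_plus (V := R_NormedModule) _ _ x
      (continuous_mult (K := R_AbsRing) _ _ x A1 A1)
      (continuous_mult (K := R_AbsRing) _ _ x A2 A2)).
Qed.

Lemma continuous_Rinv_comp {T : UniformSpace} (f : T -> R) (x : T) :
  continuous f x -> f x <> 0 -> continuous (fun y => / f y) x.
Proof.
  intros H N. apply (continuous_comp f Rinv); auto.
  apply continuity_pt_filterlim. apply continuity_pt_inv; auto.
  apply continuity_pt_id.
Qed.

Lemma CC_inv {T : UniformSpace} (f : T -> C) (x : T) :
  CC f x -> f x <> 0 -> CC (fun y => / f y)%C x.
Proof.
  intros Hf N.
  assert (A1 := CC_Re f x Hf). assert (A2 := CC_Im f x Hf).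
  assert (D : continuous (fun y => / (Re (f y) ^ 2 + Im (f y) ^ 2)) x).
  { apply continuous_Rinv_comp.
    - apply continuous_normsq, Hf.
    - generalize (Cmod_sqr_neq_0 _ N). simpl. rewrite !Rmult_1_r. auto. }
  apply CC_pair.
  - exact (continuous_mult (K := R_AbsRing) _ _ x A1 D).
  - exact (continuous_mult (K := R_AbsRing) _ _ x
      (continuous_opp (V := R_NormedModule) _ x A2) D).
Qed.

Lemma CC_div {T : UniformSpace} (f g : T -> C) (x : T) :
  CC f x -> CC g x -> g x <> 0 -> CC (fun y => f y / g y)%C x.
Proof.
  intros Hf Hg N. apply (CC_mult f (fun y => / g y)%C); auto. apply CC_inv; auto.
Qed.

Lemma CC_pow {T : UniformSpace} (f : T -> C) (n : nat) (x : T) :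
  CC f x -> CC (fun y => f y ^ n)%C x.
Proof.
  intros Hf. induction n; simpl. apply CC_const. apply CC_mult; auto.
Qed.

Lemma CC_Cmod {T : UniformSpace} (f : T -> C) (x : T) :
  CC f x -> continuous (fun y => Cmod (f y)) x.
Proof.
  intros Hf. unfold Cmod.
  apply (continuous_comp (fun y => fst (f y) ^ 2 + snd (f y) ^ 2) sqrt).
  - apply continuous_normsq, Hf.
  - apply continuity_pt_filterlim, continuity_pt_sqrt.
    apply Rplus_le_le_0_compat; apply pow2_ge_0.
Qed.

Lemma CC_Cexp {T : UniformSpace} (f : T -> C) (x : T) :
  CC f x -> CC (fun y => Cexp (f y)) x.
Proof.
  intros Hf.
  assert (E : continuous (fun y => exp (Re (f y))) x).
  { apply (continuous_comp (fun y => Re (f y)) exp). apply CC_Re; auto.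
    apply continuity_pt_filterlim, derivable_continuous_pt, derivable_pt_exp. }
  apply CC_pair.
  - apply (continuous_mult (K := R_AbsRing) (fun y => exp (Re (f y))) (fun y => cos (Im (f y)))); auto.
    apply (continuous_comp (fun y => Im (f y)) cos). apply CC_Im; auto.
    apply continuity_pt_filterlim, continuity_cos.
  - apply (continuous_mult (K := R_AbsRing) (fun y => exp (Re (f y))) (fun y => sin (Im (f y)))); auto.
    apply (continuous_comp (fun y => Im (f y)) sin). apply CC_Im; auto.
    apply continuity_pt_filterlim, continuity_sin.
Qed.

Lemma expi_eq (t : R) : expi t = (cos t, sin t).
Proof.
  unfold expi, Cexp; simpl.
  replace (0 * t - 1 * 0) with 0 by ring. replace (0 * 0 + 1 * t) with t by ring.
  rewrite exp_0, !Rmult_1_l. reflexivity.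
Qed.

Lemma CC_expi (t : R) : CC expi t.
Proof.
  unfold expi. apply CC_Cexp, CC_mult. apply CC_const. apply CC_RtoC, continuous_id.
Qed.

Lemma Cmod_expi (t : R) : Cmod (expi t) = 1.
Proof.
  rewrite expi_eq. unfold Cmod; simpl. rewrite !Rmult_1_r.
  generalize (sin2_cos2 t); unfold Rsqr; intros H.
  replace (cos t * cos t + sin t * sin t) with 1 by lra. apply sqrt_1.
Qed.

Lemma expi_neq_0 (t : R) : expi t <> 0.
Proof. apply Cmod_gt_0. rewrite Cmod_expi. lra. Qed.

Lemma Cmod_circle (s t : R) : 0 <= s -> Cmod (RtoC s * expi t)%C = s.
Proof.
  intros H. rewrite Cmod_mult, Cmod_expi, Cmod_R, Rabs_pos_eq; lra.
Qed.

Lemma Cconj_expi (t : R) : Cconj (expi t) = (/ expi t)%C.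
Proof.
  assert (E : (expi t * Cconj (expi t) = 1)%C).
  { rewrite <- Cmod2_conj, Cmod_expi. f_equal. ring. }
  rewrite <- (Cmult_1_r (/ expi t)), <- E. field. apply expi_neq_0.
Qed.

(** The balls of [C_UniformSpace] are squares; the factor [sqrt 2] compares them with the discs of
    [Cmod]. *)
Lemma locally_Cmod (z : C) (P : C -> Prop) :
  locally (T := C_UniformSpace) z P <->
  exists d : R, 0 < d /\ forall y : C, Cmod (y - z) < d -> P y.
Proof.
  split.
  - intros [e He]. exists e. split. apply cond_pos.
    intros y Hy. apply He. apply C_NormedModule_mixin_compat1, Hy.
  - intros [d [Hd H]].
    assert (Hp : 0 < d / sqrt 2).
    { apply Rdiv_lt_0_compat; auto. apply sqrt_lt_R0; lra. }
    exists (mkposreal _ Hp). intros y Hy. apply H.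
    apply C_NormedModule_mixin_compat2 in Hy. simpl in Hy.
    replace d with (sqrt 2 * (d / sqrt 2)). exact Hy.
    field. apply Rgt_not_eq, sqrt_lt_R0; lra.
Qed.

(** Continuity below uses the product uniform structure on [C], whereas [is_derive] takes its
    neighbourhoods in the one given by the absolute value. Both have the same neighbourhoods, which
    makes the two notions compatible. *)
Lemma locally_C_eq (z : C) (P : C -> Prop) :
  locally (T := C_UniformSpace) z P <-> locally (T := AbsRing_UniformSpace C_AbsRing) z P.
Proof.
  rewrite locally_Cmod. split.
  - intros [d [Hd H]]. exists (mkposreal d Hd). intros y Hy. apply H, Hy.
  - intros [e He]. exists e. split. apply cond_pos. intros y Hy. apply He, Hy.
Qed.

Lemma CC_C_eps (f : C -> C) (z : C) :
  continuous (T := C_UniformSpace) (U := C_UniformSpace) f z <->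
  forall eps, 0 < eps -> exists d, 0 < d /\
    forall y : C, Cmod (y - z) < d -> Cmod (f y - f z) < eps.
Proof.
  split.
  - intros H eps He.
    assert (A : locally (T := C_UniformSpace) (f z) (fun y : C => Cmod (y - f z) < eps)).
    { apply locally_Cmod. exists eps; auto. }
    apply H in A. apply locally_Cmod in A. exact A.
  - intros H P HP. apply locally_Cmod in HP. destruct HP as [d [Hd HP]].
    apply locally_Cmod. destruct (H d Hd) as [d' [Hd' H']]. exists d'. split; auto.
Qed.

Lemma CC_R_eps (f : R -> C) (x : R) :
  CC f x ->
  forall eps, 0 < eps -> exists d, 0 < d /\
    forall y : R, Rabs (y - x) < d -> Cmod (f y - f x) < eps.
Proof.
  intros H eps He.
  assert (A : locally (T := C_UniformSpace) (f x) (fun y : C => Cmod (y - f x) < eps)).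
  { apply locally_Cmod. exists eps; auto. }
  apply H in A. destruct A as [d Hd]. exists d. split. apply cond_pos.
  intros y Hy. apply Hd, Hy.
Qed.

Lemma Cder_eps (f : C -> C) (z l : C) :
  Cder f z l <->
  forall eps, 0 < eps -> exists d, 0 < d /\
    forall y : C, Cmod (y - z) < d ->
      Cmod (f y - f z - (y - z) * l) <= eps * Cmod (y - z).
Proof.
  split.
  - intros [_ H] eps He.
    assert (A := H z (fun P HP => HP) (mkposreal eps He)).
    apply (locally_C_eq z) in A. apply locally_Cmod in A. exact A.
  - intros H. split. apply is_linear_scal_l.
    intros x Hx eps.
    apply (is_filter_lim_locally_unique (K := C_AbsRing) (V := AbsRing_NormedModule C_AbsRing)) in Hx.
    assert (z = x) as <- by exact Hx.
    apply (locally_C_eq z). apply locally_Cmod. apply (H eps). apply cond_pos.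
Qed.

(** The rules for products and compositions refer to [C] as a module over itself; the epsilon form,
    which sees only [Cmod], passes from one module structure to the other. *)
Lemma Cder_AbsRing (f : C -> C) (z l : C) :
  Cder f z l <-> is_derive (K := C_AbsRing) (V := AbsRing_NormedModule C_AbsRing) f z l.
Proof.
  rewrite Cder_eps. split.
  - intros H. split. apply is_linear_scal_l.
    intros x Hx eps.
    apply (is_filter_lim_locally_unique (K := C_AbsRing) (V := AbsRing_NormedModule C_AbsRing)) in Hx.
    assert (z = x) as <- by exact Hx.
    apply (locally_C_eq z). apply locally_Cmod. apply (H eps). apply cond_pos.
  - intros [_ H] eps He.
    assert (A := H z (fun P HP => HP) (mkposreal eps He)).
    apply (locally_C_eq z) in A. apply locally_Cmod in A. exact A.
Qed.

Lemma Cder_CC (f : C -> C) (z l : C) : Cder f z l -> continuous (T := C_UniformSpace) (U := C_UniformSpace) f z.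
Proof.
  intros H. assert (A : ex_derive f z) by (exists l; exact H).
  apply ex_derive_continuous in A. intros P HP. apply locally_C_eq. apply A, HP.
Qed.

Lemma Cder_const (c z : C) : Cder (fun _ => c) z (RtoC 0).
Proof. apply (is_derive_const (K := C_AbsRing) (V := C_NormedModule)). Qed.

Lemma Cder_id (z : C) : Cder (fun y => y) z (RtoC 1).
Proof.
  apply Cder_eps. intros eps He. exists 1. split. lra. intros y _.
  replace (y - z - (y - z) * 1)%C with (RtoC 0) by ring. rewrite Cmod_0.
  apply Rmult_le_pos. lra. apply Cmod_ge_0.
Qed.

Lemma Cder_plus (f g : C -> C) (z l m : C) :
  Cder f z l -> Cder g z m -> Cder (fun y => f y + g y)%C z (l + m)%C.
Proof. apply (is_derive_plus (K := C_AbsRing) (V := C_NormedModule)). Qed.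

Lemma Cder_minus (f g : C -> C) (z l m : C) :
  Cder f z l -> Cder g z m -> Cder (fun y => f y - g y)%C z (l - m)%C.
Proof. apply (is_derive_minus (K := C_AbsRing) (V := C_NormedModule)). Qed.

Lemma Cder_mult (f g : C -> C) (z l m : C) :
  Cder f z l -> Cder g z m -> Cder (fun y => f y * g y)%C z (l * g z + f z * m)%C.
Proof.
  rewrite !Cder_AbsRing. intros Hf Hg.
  apply (is_derive_mult (K := C_AbsRing) f g z l m Hf Hg).
  intros; apply Cmult_comm.
Qed.

Lemma Cder_comp (f g : C -> C) (z l m : C) :
  Cder f (g z) l -> Cder g z m -> Cder (fun y => f (g y)) z (m * l)%C.
Proof.
  rewrite (Cder_AbsRing g). intros Hf Hg.
  apply (is_derive_comp (K := C_AbsRing) (V := C_NormedModule) f g z l m Hf Hg).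
Qed.

Lemma Cder_eq (f : C -> C) (z l m : C) : Cder f z l -> l = m -> Cder f z m.
Proof. intros H <-. exact H. Qed.

Lemma Cder_ext_loc (f g : C -> C) (z l : C) :
  (exists d, 0 < d /\ forall y : C, Cmod (y - z) < d -> f y = g y) ->
  Cder f z l -> Cder g z l.
Proof.
  intros H. apply (is_derive_ext_loc (K := C_AbsRing) (V := C_NormedModule)).
  apply (locally_C_eq z), locally_Cmod, H.
Qed.

Lemma Cder_inv (z : C) : z <> 0 -> Cder (fun y => / y)%C z (- / (z * z))%C.
Proof.
  intros Hz. apply Cder_eps. intros eps He.
  assert (Pz : 0 < Cmod z) by (apply Cmod_gt_0; auto).
  set (m := Cmod z) in *.
  (* The error is (y - z)^2 / (y z^2). The first bound gives |y| >= m / 2, and the second then makes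
     the error at most eps |y - z|. *)
  exists (Rmin (m / 2) (eps * (m * m * m) / 2)). split.
  { apply Rmin_pos. lra. assert (0 < m * m * m) by (repeat apply Rmult_lt_0_compat; auto).
    assert (0 < eps * (m * m * m)) by (apply Rmult_lt_0_compat; auto). lra. }
  intros y Hy.
  assert (H1 := Rlt_le_trans _ _ _ Hy (Rmin_l _ _)).
  assert (H2 := Rlt_le_trans _ _ _ Hy (Rmin_r _ _)).
  assert (Ly : m / 2 <= Cmod y).
  { assert (T := Cmod_triangle (y) (z - y)%C).
    replace (y + (z - y))%C with z in T by ring.
    replace (Cmod (z - y)) with (Cmod (y - z)) in T by (rewrite <- Cmod_opp; f_equal; ring).
    fold m in T. lra. }
  assert (Ny : y <> 0) by (apply Cmod_gt_0; lra).
  replace (/ y - / z - (y - z) * - / (z * z))%C with ((y - z) * ((y - z) / (y * (z * z))))%C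
    by (field; auto).
  rewrite Cmod_mult, Rmult_comm. apply Rmult_le_compat_r. apply Cmod_ge_0.
  rewrite Cmod_div by (repeat apply Cmult_neq_0; auto).
  rewrite !Cmod_mult. fold m.
  assert (0 < Cmod y) by lra.
  apply Rle_div_l. repeat apply Rmult_lt_0_compat; auto.
  assert (eps * (m / 2 * (m * m)) <= eps * (Cmod y * (m * m))).
  { apply Rmult_le_compat_l. lra. apply Rmult_le_compat_r. nra. exact Ly. }
  lra.
Qed.

Lemma Cder_invf (f : C -> C) (z l : C) :
  f z <> 0 -> Cder f z l -> Cder (fun y => / f y)%C z (l * - / (f z * f z))%C.
Proof.
  intros N H. apply (Cder_comp (fun y => / y)%C f); auto. apply Cder_inv; auto.
Qed.

(** The derivative at each point of [U] is taken in the full plane and [U] need not be open. Closed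
    discs, closed annuli and even single points are legitimate domains; the last serve for local
    arguments. *)
Definition hol (U : C -> Prop) (f : C -> C) : Prop :=
  forall z : C, U z -> exists l : C, Cder f z l.

Lemma hol_iff (U : C -> Prop) (f : C -> C) : holomorphic_on U f <-> hol U f.
Proof. split; intros H z Hz; destruct (H z Hz) as [l Hl]; exists l; exact Hl. Qed.

Lemma hol_CC (U : C -> Prop) (f : C -> C) (z : C) :
  hol U f -> U z -> continuous (T := C_UniformSpace) (U := C_UniformSpace) f z.
Proof. intros H Hz. destruct (H z Hz) as [l Hl]. apply (Cder_CC _ _ _ Hl). Qed.

Lemma hol_sub (U V : C -> Prop) (f : C -> C) :
  hol V f -> (forall z, U z -> V z) -> hol U f.
Proof. intros H K z Hz. apply H, K, Hz. Qed.

Lemma hol_const (U : C -> Prop) (c : C) : hol U (fun _ => c).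
Proof. intros z _. eexists. apply Cder_const. Qed.

Lemma hol_id (U : C -> Prop) : hol U (fun z => z).
Proof. intros z _. eexists. apply Cder_id. Qed.

Lemma hol_plus (U : C -> Prop) (f g : C -> C) :
  hol U f -> hol U g -> hol U (fun z => f z + g z)%C.
Proof.
  intros Hf Hg z Hz. destruct (Hf z Hz), (Hg z Hz). eexists. apply Cder_plus; eassumption.
Qed.

Lemma hol_minus (U : C -> Prop) (f g : C -> C) :
  hol U f -> hol U g -> hol U (fun z => f z - g z)%C.
Proof.
  intros Hf Hg z Hz. destruct (Hf z Hz), (Hg z Hz). eexists. apply Cder_minus; eassumption.
Qed.

Lemma hol_mult (U : C -> Prop) (f g : C -> C) :
  hol U f -> hol U g -> hol U (fun z => f z * g z)%C.
Proof.
  intros Hf Hg z Hz. destruct (Hf z Hz), (Hg z Hz). eexists. apply Cder_mult; eassumption.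
Qed.

Lemma hol_inv (U : C -> Prop) (f : C -> C) :
  hol U f -> (forall z, U z -> f z <> 0) -> hol U (fun z => / f z)%C.
Proof.
  intros Hf N z Hz. destruct (Hf z Hz). eexists. apply Cder_invf; eauto.
Qed.

Lemma hol_pow (U : C -> Prop) (f : C -> C) (n : nat) :
  hol U f -> hol U (fun z => f z ^ n)%C.
Proof.
  intros H. induction n; simpl. apply hol_const. apply hol_mult; auto.
Qed.

Lemma hol_ext_open (U : C -> Prop) (f g : C -> C) :
  (forall z, U z -> exists d, 0 < d /\ forall y : C, Cmod (y - z) < d -> f y = g y) ->
  hol U f -> hol U g.
Proof.
  intros E H z Hz. destruct (H z Hz) as [l Hl]. exists l.
  apply (Cder_ext_loc f); auto.
Qed.

Lemma Cmod_minus_sym (a b : C) : Cmod (a - b) = Cmod (b - a).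
Proof. rewrite <- Cmod_opp. f_equal. ring. Qed.

Lemma Cmod_triangle_inv (a b : C) : Cmod a - Cmod b <= Cmod (a - b).
Proof.
  assert (T := Cmod_triangle (a - b) b). replace (a - b + b)%C with a in T by ring. lra.
Qed.

(** * The complex exponential *)

Lemma Cexp_plus (a b : C) : Cexp (a + b) = (Cexp a * Cexp b)%C.
Proof.
  unfold Cexp, Cmult, Re, Im; simpl. rewrite exp_plus, cos_plus, sin_plus.
  apply injective_projections; simpl; ring.
Qed.

Lemma Cexp_0 : Cexp 0 = 1.
Proof. unfold Cexp; simpl. rewrite exp_0, cos_0, sin_0. apply injective_projections; simpl; ring. Qed.

Lemma Cexp_neq_0 (z : C) : Cexp z <> 0.
Proof.
  intros E. assert (H := Cexp_plus z (- z)). rewrite E, Cmult_0_l in H.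
  replace (z + - z)%C with (RtoC 0) in H by ring. rewrite Cexp_0 in H.
  apply C1_nz, H.
Qed.

Lemma Cexp_opp (z : C) : Cexp (- z) = (/ Cexp z)%C.
Proof.
  assert (N := Cexp_neq_0 z). assert (H := Cexp_plus z (- z)).
  replace (z + - z)%C with (RtoC 0) in H by ring. rewrite Cexp_0 in H.
  rewrite <- (Cmult_1_r (/ Cexp z)), H. field. auto.
Qed.

Lemma Cexp_conj (z : C) : Cexp (Cconj z) = Cconj (Cexp z).
Proof.
  unfold Cexp, Cconj, Re, Im; simpl. rewrite cos_neg, sin_neg.
  apply injective_projections; simpl; ring.
Qed.

Lemma Cmod_Cexp (z : C) : Cmod (Cexp z) = exp (Re z).
Proof.
  replace (Cexp z) with (RtoC (exp (Re z)) * expi (Im z))%C.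
  - apply Cmod_circle. left; apply exp_pos.
  - rewrite expi_eq. unfold Cexp, Cmult, Re, Im; simpl.
    apply injective_projections; simpl; ring.
Qed.

Lemma Cexp_RtoC (x : R) : Cexp (RtoC x) = RtoC (exp x).
Proof. unfold Cexp; simpl. rewrite cos_0, sin_0. apply injective_projections; simpl; ring. Qed.

Lemma Cmod_le_abs (z : C) : Cmod z <= Rabs (Re z) + Rabs (Im z).
Proof.
  assert (T := Cmod_triangle (RtoC (Re z)) (Ci * RtoC (Im z))%C).
  rewrite Cmod_mult, Cmod_Ci, !Cmod_R in T.
  replace (RtoC (Re z) + Ci * RtoC (Im z))%C with z in T.
  lra. destruct z; apply injective_projections; simpl; ring.
Qed.

Lemma im_le_Cmod (z : C) : Rabs (Im z) <= Cmod z.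
Proof.
  eapply Rle_trans; [|apply Rmax_Cmod]. apply Rmax_r.
Qed.

Lemma derive_eps (f : R -> R) (x l : R) : derivable_pt_lim f x l ->
  forall eps, 0 < eps -> exists d, 0 < d /\
    forall h, Rabs h < d -> Rabs (f (x + h) - f x - h * l) <= eps * Rabs h.
Proof.
  intros H eps He. destruct (H eps He) as [d Hd]. exists d. split. apply cond_pos.
  intros h Hh. destruct (Req_dec h 0) as [->|N].
  - rewrite Rplus_0_r. replace (f x - f x - 0 * l) with 0 by ring. rewrite Rabs_R0. lra.
  - specialize (Hd h N Hh).
    replace (f (x + h) - f x - h * l) with (((f (x + h) - f x) / h - l) * h) by (field; auto).
    rewrite Rabs_mult. apply Rmult_le_compat_r. apply Rabs_pos. lra.
Qed.

(** With y = a + i b, the error is expressed through the first-order errors of exp at a and of cos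
    and sin at b, and the product a b, which is of second order. The functional equation later moves
    the result to any point. *)
Lemma Cder_Cexp_0 : Cder Cexp (RtoC 0) (RtoC 1).
Proof.
  apply Cder_eps. intros eps He.
  (* The terms below add up to at most seven times [e * m], so [eps / 12] is ample; the cap 1 keeps
     |1 + a| at most 2. *)
  assert (He' : 0 < Rmin (eps / 12) 1) by (apply Rmin_pos; lra).
  assert (E1 := Rmin_l (eps / 12) 1). assert (E2 := Rmin_r (eps / 12) 1).
  set (e := Rmin (eps / 12) 1) in *.
  destruct (derive_eps _ _ _ (derivable_pt_lim_exp 0) e He') as [d1 [P1 H1]].
  destruct (derive_eps _ _ _ (derivable_pt_lim_cos 0) e He') as [d2 [P2 H2]].
  destruct (derive_eps _ _ _ (derivable_pt_lim_sin 0) e He') as [d3 [P3 H3]].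
  rewrite exp_0 in H1. rewrite sin_0, cos_0 in H2. rewrite sin_0, cos_0 in H3.
  exists (Rmin (Rmin d1 d2) (Rmin d3 e)). split.
  { apply Rmin_pos; apply Rmin_pos; auto. }
  intros y Hy. replace (y - 0)%C with y in * by ring.
  assert (Q1 := Rmin_l (Rmin d1 d2) (Rmin d3 e)). assert (Q2 := Rmin_r (Rmin d1 d2) (Rmin d3 e)).
  assert (Q3 := Rmin_l d1 d2). assert (Q4 := Rmin_r d1 d2).
  assert (Q5 := Rmin_l d3 e). assert (Q6 := Rmin_r d3 e).
  assert (Ra := re_le_Cmod y). assert (Ia := im_le_Cmod y).
  specialize (H1 (Re y) ltac:(lra)). specialize (H2 (Im y) ltac:(lra)).
  specialize (H3 (Im y) ltac:(lra)).
  rewrite Rplus_0_l in *.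
  rewrite Cexp_0.
  set (a := Re y) in *. set (b := Im y) in *. set (m := Cmod y) in *.
  assert (Pm : 0 <= m) by apply Cmod_ge_0.
  eapply Rle_trans; [apply Cmod_le_abs|].
  replace (Re (Cexp y - 1 - y * 1)) with ((exp a - 1 - a * 1) * cos b + (1 + a) * (cos b - 1 - b * -0))
    by (unfold a, b; destruct y; simpl; ring).
  replace (Im (Cexp y - 1 - y * 1)) with ((exp a - 1 - a * 1) * sin b + (1 + a) * (sin b - 0 - b * 1)
     + a * b)
    by (unfold a, b; destruct y; simpl; ring).
  assert (C1 : Rabs (cos b) <= 1) by (apply Rabs_le, COS_bound).
  assert (S1 : Rabs (sin b) <= 1) by (apply Rabs_le, SIN_bound).
  assert (A1 : Rabs (1 + a) <= 2).
  { eapply Rle_trans; [apply Rabs_triang|]. rewrite Rabs_R1. lra. }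
  assert (B1 : Rabs (exp a - 1 - a * 1) <= e * m).
  { eapply Rle_trans; [apply H1|]. apply Rmult_le_compat_l; lra. }
  assert (B2 : Rabs (cos b - 1 - b * -0) <= e * m).
  { eapply Rle_trans; [apply H2|]. apply Rmult_le_compat_l; lra. }
  assert (B3 : Rabs (sin b - 0 - b * 1) <= e * m).
  { eapply Rle_trans; [apply H3|]. apply Rmult_le_compat_l; lra. }
  assert (B4 : Rabs (a * b) <= e * m).
  { rewrite Rabs_mult. apply Rmult_le_compat; try apply Rabs_pos; lra. }
  assert (Pem : 0 <= e * m) by (apply Rmult_le_pos; lra).
  assert (M : forall u v k, Rabs u <= e * m -> Rabs v <= k -> Rabs (u * v) <= k * (e * m)).
  { intros u v k Hu Hv. rewrite Rabs_mult, Rmult_comm. apply Rmult_le_compat; auto; apply Rabs_pos. }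
  assert (D1 := M _ _ _ B1 C1). assert (D2 := M _ _ _ B2 A1).
  assert (D3 := M _ _ _ B1 S1). assert (D4 := M _ _ _ B3 A1).
  rewrite (Rmult_comm (1 + a)). rewrite (Rmult_comm (1 + a)).
  assert (T1 := Rabs_triang ((exp a - 1 - a * 1) * cos b) ((cos b - 1 - b * -0) * (1 + a))).
  assert (T2 := Rabs_triang ((exp a - 1 - a * 1) * sin b + (sin b - 0 - b * 1) * (1 + a)) (a * b)).
  assert (T3 := Rabs_triang ((exp a - 1 - a * 1) * sin b) ((sin b - 0 - b * 1) * (1 + a))).
  assert (e * m <= eps / 12 * m) by (apply Rmult_le_compat_r; lra).
  assert (0 <= eps * m) by (apply Rmult_le_pos; lra).
  lra.
Qed.

Lemma Cder_Cexp (z : C) : Cder Cexp z (Cexp z).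
Proof.
  apply (Cder_ext_loc (fun y => Cexp z * Cexp (y - z))%C).
  { exists 1. split. lra. intros y _. rewrite <- Cexp_plus. f_equal. ring. }
  apply (Cder_eq _ _ (0 * Cexp (z - z) + Cexp z * ((1 - 0) * 1))%C).
  - apply (Cder_mult (fun _ => Cexp z) (fun y => Cexp (y - z)))%C. apply Cder_const.
    apply (Cder_comp Cexp (fun y => y - z)%C).
    + replace (z - z)%C with (RtoC 0) by ring. apply Cder_Cexp_0.
    + apply (Cder_minus (fun y => y) (fun _ => z)). apply Cder_id. apply Cder_const.
  - ring.
Qed.

(** * Integrals of complex functions *)

Notation is_CRInt g a b l := (is_RInt (V := C_R_NormedModule) g a b l).
Notation ex_CRInt g a b := (ex_RInt (V := C_R_NormedModule) g a b).

Lemma is_CRInt_pair (g : R -> C) (a b : R) (l : C) :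
  is_CRInt g a b l <->
  is_RInt (fun t => Re (g t)) a b (Re l) /\ is_RInt (fun t => Im (g t)) a b (Im l).
Proof.
  split.
  - intros H. split.
    + apply (is_RInt_fct_extend_fst (U := R_NormedModule) (V := R_NormedModule) g a b l H).
    + apply (is_RInt_fct_extend_snd (U := R_NormedModule) (V := R_NormedModule) g a b l H).
  - intros [H1 H2]. destruct l as [l1 l2].
    apply (is_RInt_fct_extend_pair (U := R_NormedModule) (V := R_NormedModule) g a b l1 l2 H1 H2).
Qed.

Lemma CRInt_correct (g : R -> C) (a b : R) : ex_CRInt g a b -> is_CRInt g a b (CRInt g a b).
Proof. apply (RInt_correct (V := C_R_CompleteNormedModule)). Qed.

Lemma CRInt_unique (g : R -> C) (a b : R) (l : C) : is_CRInt g a b l -> CRInt g a b = l.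
Proof. apply (is_RInt_unique (V := C_R_CompleteNormedModule)). Qed.

Lemma ex_CRInt_cont (g : R -> C) (a b : R) :
  (forall t, Rmin a b <= t <= Rmax a b -> CC g t) -> ex_CRInt g a b.
Proof. apply (ex_RInt_continuous (V := C_R_CompleteNormedModule)). Qed.

Lemma is_CRInt_plus (f g : R -> C) (a b : R) (l m : C) :
  is_CRInt f a b l -> is_CRInt g a b m -> is_CRInt (fun t => f t + g t)%C a b (l + m)%C.
Proof. apply (is_RInt_plus (V := C_R_NormedModule)). Qed.

Lemma is_CRInt_minus (f g : R -> C) (a b : R) (l m : C) :
  is_CRInt f a b l -> is_CRInt g a b m -> is_CRInt (fun t => f t - g t)%C a b (l - m)%C.
Proof. apply (is_RInt_minus (V := C_R_NormedModule)). Qed.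

(** The integral is that of a real normed module, so linearity over complex scalars has to be
    recovered from the real and imaginary parts. *)
Lemma is_CRInt_scal (f : R -> C) (c : C) (a b : R) (l : C) :
  is_CRInt f a b l -> is_CRInt (fun t => c * f t)%C a b (c * l)%C.
Proof.
  rewrite !is_CRInt_pair. intros [H1 H2]. split.
  - apply (is_RInt_minus (V := R_NormedModule) (fun t => Re c * Re (f t)) (fun t => Im c * Im (f t)));
    apply (is_RInt_scal (V := R_NormedModule)); assumption.
  - apply (is_RInt_plus (V := R_NormedModule) (fun t => Re c * Im (f t)) (fun t => Im c * Re (f t)));
    apply (is_RInt_scal (V := R_NormedModule)); assumption.
Qed.

Lemma ex_CRInt_scal (f : R -> C) (c : C) (a b : R) :
  ex_CRInt f a b -> ex_CRInt (fun t => c * f t)%C a b.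
Proof. intros [l Hl]. eexists. apply is_CRInt_scal, Hl. Qed.

Lemma CRInt_plus (f g : R -> C) (a b : R) :
  ex_CRInt f a b -> ex_CRInt g a b ->
  CRInt (fun t => f t + g t)%C a b = (CRInt f a b + CRInt g a b)%C.
Proof. intros; apply CRInt_unique, is_CRInt_plus; apply CRInt_correct; auto. Qed.

Lemma CRInt_minus (f g : R -> C) (a b : R) :
  ex_CRInt f a b -> ex_CRInt g a b ->
  CRInt (fun t => f t - g t)%C a b = (CRInt f a b - CRInt g a b)%C.
Proof. intros; apply CRInt_unique, is_CRInt_minus; apply CRInt_correct; auto. Qed.

Lemma CRInt_scal (f : R -> C) (c : C) (a b : R) :
  ex_CRInt f a b -> CRInt (fun t => c * f t)%C a b = (c * CRInt f a b)%C.
Proof. intros; apply CRInt_unique, is_CRInt_scal; apply CRInt_correct; auto. Qed.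

Lemma CRInt_ext (f g : R -> C) (a b : R) :
  (forall t, Rmin a b < t < Rmax a b -> f t = g t) -> CRInt f a b = CRInt g a b.
Proof. apply (RInt_ext (V := C_R_CompleteNormedModule)). Qed.

Lemma CRInt_const (c : C) (a b : R) : CRInt (fun _ => c) a b = (RtoC (b - a) * c)%C.
Proof.
  apply CRInt_unique. rewrite <- scal_R_Cmult. apply (is_RInt_const (V := C_R_NormedModule)).
Qed.

Lemma CRInt_Chasles (f : R -> C) (a b c : R) :
  ex_CRInt f a b -> ex_CRInt f b c -> (CRInt f a b + CRInt f b c)%C = CRInt f a c.
Proof. apply (RInt_Chasles (V := C_R_CompleteNormedModule)). Qed.

Lemma CRInt_swap (f : R -> C) (a b : R) :
  ex_CRInt f a b -> CRInt f b a = (- CRInt f a b)%C.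
Proof.
  intros H. apply CRInt_unique. apply (is_RInt_swap (V := C_R_NormedModule)), CRInt_correct, H.
Qed.

Lemma CRInt_bound (f : R -> C) (a b M : R) :
  a <= b -> (forall t, a <= t <= b -> Cmod (f t) <= M) -> ex_CRInt f a b ->
  Cmod (CRInt f a b) <= (b - a) * M.
Proof.
  intros Hab HM He.
  (* The norm of [C] as a real module is the Euclidean product norm, hence the modulus. *)
  assert (N : forall z : C, norm (V := C_R_NormedModule) z = Cmod z).
  { intros [x y]. unfold Cmod; simpl. unfold norm; simpl. unfold prod_norm, norm; simpl.
    unfold abs; simpl. f_equal. rewrite !Rmult_1_r. rewrite <- !Rabs_mult.
    rewrite !Rabs_pos_eq; try nra. }
  rewrite <- N.
  apply (norm_RInt_le_const (V := C_R_NormedModule) f a b); auto.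
  - intros t Ht. rewrite N. apply HM, Ht.
  - apply CRInt_correct, He.
Qed.

Lemma CRInt_RtoC (f : R -> R) (a b : R) :
  ex_RInt f a b -> CRInt (fun t => RtoC (f t)) a b = RtoC (RInt f a b).
Proof.
  intros H. apply CRInt_unique, is_CRInt_pair. split; simpl.
  - apply (RInt_correct f), H.
  - assert (K : forall l, l = (b - a) * 0 -> is_RInt (fun _ : R => 0) a b l).
    { intros l ->. exact (is_RInt_const (V := R_NormedModule) a b 0). }
    apply K. ring.
Qed.

Lemma CRInt_conj (f : R -> C) (a b : R) :
  ex_CRInt f a b -> CRInt (fun t => Cconj (f t)) a b = Cconj (CRInt f a b).
Proof.
  intros H. apply CRInt_unique. apply CRInt_correct in H. apply is_CRInt_pair in H.
  destruct H as [H1 H2]. apply is_CRInt_pair. split; simpl. exact H1.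
  apply (is_RInt_opp (V := R_NormedModule) _ _ _ _ H2).
Qed.

Lemma CRInt_shift (f : R -> C) (c a b : R) :
  ex_CRInt f (a + c) (b + c) -> CRInt (fun t => f (t + c)) a b = CRInt f (a + c) (b + c).
Proof.
  intros H.
  assert (E := RInt_comp_lin (V := C_R_CompleteNormedModule) f 1 c a b).
  rewrite !Rmult_1_l in E. unfold CRInt at 2. rewrite <- E by exact H.
  apply CRInt_ext. intros t _. rewrite Rmult_1_l.
  rewrite scal_R_Cmult. symmetry. apply Cmult_1_l.
Qed.

Lemma CRInt_periodic (f : R -> C) (p c : R) :
  (forall t, CC f t) -> (forall t, f (t + p) = f t) ->
  CRInt f c (c + p) = CRInt f 0 p.
Proof.
  intros Hc Hp.
  assert (I : forall a b, ex_CRInt f a b) by (intros; apply ex_CRInt_cont; auto).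
  rewrite <- (CRInt_Chasles f c 0 (c + p)) by auto.
  rewrite <- (CRInt_Chasles f 0 p (c + p)) by auto.
  assert (E : CRInt f p (c + p) = CRInt f 0 c).
  { rewrite <- (Rplus_0_l p) at 1. rewrite <- CRInt_shift by auto.
    apply CRInt_ext. auto. }
  rewrite E, (CRInt_swap f 0 c) by auto. ring.
Qed.

(** * Continuity and integration along circles *)

(** Continuity along the parametrised circle, not in the plane: it suffices for the integrals and
    also applies to functions such as the weight, about which nothing is known off the circle. *)
Definition circ_cont (s : R) (f : C -> C) : Prop :=
  forall t : R, CC (fun u : R => f (RtoC s * expi u)%C) t.

Lemma CC_circle (s t : R) : CC (fun u : R => (RtoC s * expi u)%C) t.
Proof. apply CC_mult. apply CC_const. apply CC_expi. Qed.

Lemma circ_cont_of (s : R) (f : C -> C) : 0 <= s ->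
  (forall z : C, Cmod z = s -> continuous (T := C_UniformSpace) (U := C_UniformSpace) f z) ->
  circ_cont s f.
Proof.
  intros Hs H t. apply (continuous_comp (U := R_UniformSpace) (V := C_UniformSpace)
    (fun u : R => (RtoC s * expi u)%C) f). apply CC_circle.
  apply H, Cmod_circle, Hs.
Qed.

Lemma circ_cont_hol (s : R) (U : C -> Prop) (f : C -> C) : 0 <= s ->
  hol U f -> (forall z, Cmod z = s -> U z) -> circ_cont s f.
Proof. intros Hs H K. apply circ_cont_of; auto. intros z Hz. apply (hol_CC U); auto. Qed.

Lemma circ_cont_mult (s : R) (f g : C -> C) :
  circ_cont s f -> circ_cont s g -> circ_cont s (fun z => f z * g z)%C.
Proof. intros H1 H2 t. apply CC_mult. apply H1. apply H2. Qed.

Lemma circ_cont_plus (s : R) (f g : C -> C) :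
  circ_cont s f -> circ_cont s g -> circ_cont s (fun z => f z + g z)%C.
Proof. intros H1 H2 t. apply CC_plus. apply H1. apply H2. Qed.

Lemma circ_cont_minus (s : R) (f g : C -> C) :
  circ_cont s f -> circ_cont s g -> circ_cont s (fun z => f z - g z)%C.
Proof. intros H1 H2 t. apply CC_minus. apply H1. apply H2. Qed.

Lemma circ_cont_inv (s : R) (f : C -> C) : 0 <= s ->
  circ_cont s f -> (forall z, Cmod z = s -> f z <> 0) -> circ_cont s (fun z => / f z)%C.
Proof. intros Hs H1 H2 t. apply CC_inv. apply H1. apply H2, Cmod_circle, Hs. Qed.

Lemma circ_cont_id (s : R) : circ_cont s (fun z => z).
Proof. intros t. apply CC_circle. Qed.

Lemma circ_cont_const (s : R) (c : C) : circ_cont s (fun _ => c).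
Proof. intros t. apply CC_const. Qed.

Lemma circ_cont_pow (s : R) (f : C -> C) (n : nat) :
  circ_cont s f -> circ_cont s (fun z => f z ^ n)%C.
Proof. intros H t. apply CC_pow, H. Qed.

Lemma circ_cont_ext (s : R) (f g : C -> C) : 0 <= s ->
  (forall z, Cmod z = s -> f z = g z) -> circ_cont s f -> circ_cont s g.
Proof.
  intros Hs E H t. apply (continuous_ext (T := R_UniformSpace) (U := C_UniformSpace)
    (fun u : R => f (RtoC s * expi u)%C)). intros u. apply E, Cmod_circle, Hs. apply H.
Qed.

Lemma circ_cont_kernel (s : R) (z : C) : 0 <= s -> Cmod z <> s ->
  circ_cont s (fun t => / (t - z))%C.
Proof.
  intros Hs Hz. apply circ_cont_inv; auto.
  apply circ_cont_minus. apply circ_cont_id. apply circ_cont_const.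
  intros t Ht E. apply Hz. rewrite <- Ht. f_equal.
  apply Ceq_minus in E. auto.
Qed.

Lemma ex_circle (s : R) (f : C -> C) (a b : R) : circ_cont s f ->
  ex_CRInt (fun t => f (RtoC s * expi t) * (Ci * (RtoC s * expi t)))%C a b.
Proof.
  intros H. apply ex_CRInt_cont. intros t _. apply CC_mult. apply H.
  apply CC_mult. apply CC_const. apply CC_circle.
Qed.

Lemma circle_int_ext (s : R) (f g : C -> C) : 0 <= s ->
  (forall z, Cmod z = s -> f z = g z) -> circle_int s f = circle_int s g.
Proof.
  intros Hs H. unfold circle_int. apply CRInt_ext. intros t _. rewrite H; auto. apply Cmod_circle, Hs.
Qed.

Lemma circle_int_plus (s : R) (f g : C -> C) : circ_cont s f -> circ_cont s g ->
  circle_int s (fun z => f z + g z)%C = (circle_int s f + circle_int s g)%C.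
Proof.
  intros Hf Hg. unfold circle_int. rewrite <- CRInt_plus by (apply ex_circle; auto).
  apply CRInt_ext. intros; ring.
Qed.

Lemma circle_int_minus (s : R) (f g : C -> C) : circ_cont s f -> circ_cont s g ->
  circle_int s (fun z => f z - g z)%C = (circle_int s f - circle_int s g)%C.
Proof.
  intros Hf Hg. unfold circle_int. rewrite <- CRInt_minus by (apply ex_circle; auto).
  apply CRInt_ext. intros; ring.
Qed.

Lemma circle_int_scal (s : R) (c : C) (f : C -> C) : circ_cont s f ->
  circle_int s (fun z => c * f z)%C = (c * circle_int s f)%C.
Proof.
  intros Hf. unfold circle_int. rewrite <- CRInt_scal by (apply ex_circle; auto).
  apply CRInt_ext. intros; ring.
Qed.

Lemma circle_int_bound (s M : R) (f : C -> C) : 0 <= s -> circ_cont s f ->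
  (forall z, Cmod z = s -> Cmod (f z) <= M) ->
  Cmod (circle_int s f) <= 2 * PI * (s * M).
Proof.
  intros Hs Hf HM. assert (P := PI_RGT_0). unfold circle_int.
  eapply Rle_trans. apply (CRInt_bound _ 0 (2 * PI) (s * M)). lra.
  - intros t _. rewrite !Cmod_mult, Cmod_Ci, Rmult_1_l.
    change (Cmod (f (RtoC s * expi t)%C) * (Cmod (RtoC s) * Cmod (expi t)) <= s * M).
    rewrite <- (Cmod_mult (RtoC s)), Cmod_circle by auto.
    rewrite Rmult_comm. apply Rmult_le_compat_l; auto. apply HM, Cmod_circle, Hs.
  - apply ex_circle, Hf.
  - right. ring.
Qed.

Lemma polar_unit (x y : R) : x * x + y * y = 1 ->
  exists t, 0 <= t <= 2 * PI /\ x = cos t /\ y = sin t.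
Proof.
  intros H. assert (P := PI_RGT_0).
  assert (Hx : -1 <= x <= 1) by nra.
  assert (B := acos_bound x).
  assert (Cx := cos_acos x Hx). assert (Sx := sin_acos x Hx).
  assert (E : 1 - x² = y * y) by (unfold Rsqr; lra). rewrite E in Sx.
  destruct (Rle_dec 0 y) as [Hy|Hy].
  - exists (acos x). repeat split; try lra.
    rewrite Sx, sqrt_square; auto.
  - exists (2 * PI - acos x). repeat split; try lra.
    + rewrite cos_minus, cos_2PI, sin_2PI. lra.
    + rewrite sin_minus, cos_2PI, sin_2PI, Sx.
      replace (y * y) with (- y * - y) by ring. rewrite sqrt_square; lra.
Qed.

Lemma polar (z : C) : exists t, 0 <= t <= 2 * PI /\ z = (RtoC (Cmod z) * expi t)%C.
Proof.
  destruct (Req_dec (Cmod z) 0) as [E|N].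
  - exists 0. assert (P := PI_RGT_0). split. lra. rewrite E. rewrite (Cmod_eq_0 z E). ring.
  - destruct (polar_unit (Re z / Cmod z) (Im z / Cmod z)) as [t [Ht [A B]]].
    + assert (H := Cmod2_alt z). field_simplify; auto. rewrite <- H. field; auto.
    + exists t. split; auto. rewrite expi_eq, <- A, <- B.
      destruct z as [x y]. apply injective_projections; simpl; field; auto.
Qed.

Lemma circ_cont_bounded (s : R) (f : C -> C) : circ_cont s f ->
  exists M, 0 <= M /\ forall z, Cmod z = s -> Cmod (f z) <= M.
Proof.
  intros Hf. assert (P := PI_RGT_0).
  destruct (continuity_ab_maj (fun t => Cmod (f (RtoC s * expi t)%C)) 0 (2 * PI)) as [m [Hm _]].
  - lra.
  - intros t _. apply continuity_pt_filterlim. apply (CC_Cmod (fun t => f (RtoC s * expi t)%C)), Hf.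
  - exists (Cmod (f (RtoC s * expi m)%C)). split. apply Cmod_ge_0.
    intros z Hz. destruct (polar z) as [t [Ht E]]. rewrite E, Hz. apply (Hm t Ht).
Qed.

Lemma circle_int_const_kernel (s : R) : 0 < s -> circle_int s (fun t => / t)%C = (RtoC (2 * PI) * Ci)%C.
Proof.
  intros Hs. unfold circle_int.
  rewrite (CRInt_ext _ (fun _ => Ci)).
  - rewrite CRInt_const. f_equal. f_equal. ring.
  - intros t _. field. split. apply expi_neq_0. intros E; apply RtoC_inj in E; lra.
Qed.

(** * The Goursat theorem *)

Notation Cct g z := (continuous (T := C_UniformSpace) (U := C_UniformSpace) g z).

Definition rect_int (g : C -> C) (a b c d : R) : C :=
  (CRInt (fun x => g (x, c)) a b + Ci * CRInt (fun y => g (b, y)) c d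
   - CRInt (fun x => g (x, d)) a b - Ci * CRInt (fun y => g (a, y)) c d)%C.

Definition rect_cont (g : C -> C) (a b c d : R) : Prop :=
  forall x y, a <= x <= b -> c <= y <= d -> Cct g (x, y).

Lemma CC_horiz (g : C -> C) (x y : R) : Cct g (x, y) -> CC (fun t : R => g (t, y)) x.
Proof.
  intros H. apply (continuous_comp (U := R_UniformSpace) (V := C_UniformSpace)
    (fun t : R => (t, y) : C) g); auto.
  apply CC_pair; simpl. apply continuous_id. apply continuous_const.
Qed.

Lemma CC_vert (g : C -> C) (x y : R) : Cct g (x, y) -> CC (fun t : R => g (x, t)) y.
Proof.
  intros H. apply (continuous_comp (U := R_UniformSpace) (V := C_UniformSpace)
    (fun t : R => (x, t) : C) g); auto.
  apply CC_pair; simpl. apply continuous_const. apply continuous_id.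
Qed.

Lemma ex_horiz (g : C -> C) (a b c d x1 x2 y : R) : rect_cont g a b c d ->
  a <= x1 <= b -> a <= x2 <= b -> c <= y <= d -> ex_CRInt (fun x => g (x, y)) x1 x2.
Proof.
  intros H H1 H2 Hy. apply ex_CRInt_cont. intros t Ht. apply CC_horiz, H; auto.
  revert Ht. unfold Rmin, Rmax. destruct (Rle_dec x1 x2); lra.
Qed.

Lemma ex_vert (g : C -> C) (a b c d y1 y2 x : R) : rect_cont g a b c d ->
  c <= y1 <= d -> c <= y2 <= d -> a <= x <= b -> ex_CRInt (fun y => g (x, y)) y1 y2.
Proof.
  intros H H1 H2 Hy. apply ex_CRInt_cont. intros t Ht. apply CC_vert, H; auto.
  revert Ht. unfold Rmin, Rmax. destruct (Rle_dec y1 y2); lra.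
Qed.

Lemma rect_split_x (g : C -> C) (a b c d m : R) : rect_cont g a b c d ->
  a <= m <= b -> c <= d ->
  rect_int g a b c d = (rect_int g a m c d + rect_int g m b c d)%C.
Proof.
  intros H Hm Hc. unfold rect_int.
  rewrite <- (CRInt_Chasles (fun x => g (x, c)) a m b) by (eapply ex_horiz; eauto; lra).
  rewrite <- (CRInt_Chasles (fun x => g (x, d)) a m b) by (eapply ex_horiz; eauto; lra).
  ring.
Qed.

Lemma rect_split_y (g : C -> C) (a b c d m : R) : rect_cont g a b c d ->
  c <= m <= d -> a <= b ->
  rect_int g a b c d = (rect_int g a b c m + rect_int g a b m d)%C.
Proof.
  intros H Hm Hc. unfold rect_int.
  rewrite <- (CRInt_Chasles (fun y => g (a, y)) c m d) by (eapply ex_vert; eauto; lra).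
  rewrite <- (CRInt_Chasles (fun y => g (b, y)) c m d) by (eapply ex_vert; eauto; lra).
  ring.
Qed.

Lemma rect_cont_sub (g : C -> C) (a b c d a' b' c' d' : R) : rect_cont g a b c d ->
  a <= a' -> b' <= b -> c <= c' -> d' <= d -> rect_cont g a' b' c' d'.
Proof. intros H ? ? ? ? x y Hx Hy. apply H; lra. Qed.

Lemma rect_int_bound (g : C -> C) (a b c d M : R) : rect_cont g a b c d ->
  a <= b -> c <= d ->
  (forall x y, a <= x <= b -> c <= y <= d -> Cmod (g (x, y)) <= M) ->
  Cmod (rect_int g a b c d) <= 2 * ((b - a) + (d - c)) * M.
Proof.
  intros H Hab Hcd HM. unfold rect_int.
  set (I1 := CRInt (fun x => g (x, c)) a b). set (I2 := CRInt (fun y => g (b, y)) c d).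
  set (I3 := CRInt (fun x => g (x, d)) a b). set (I4 := CRInt (fun y => g (a, y)) c d).
  assert (B1 : Cmod I1 <= (b - a) * M).
  { apply CRInt_bound; auto. intros; apply HM; lra. eapply ex_horiz; eauto; lra. }
  assert (B2 : Cmod I2 <= (d - c) * M).
  { apply CRInt_bound; auto. intros; apply HM; lra. eapply ex_vert; eauto; lra. }
  assert (B3 : Cmod I3 <= (b - a) * M).
  { apply CRInt_bound; auto. intros; apply HM; lra. eapply ex_horiz; eauto; lra. }
  assert (B4 : Cmod I4 <= (d - c) * M).
  { apply CRInt_bound; auto. intros; apply HM; lra. eapply ex_vert; eauto; lra. }
  assert (T1 := Cmod_triangle (I1 + Ci * I2 - I3) (- (Ci * I4))).
  assert (T2 := Cmod_triangle (I1 + Ci * I2) (- I3)).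
  assert (T3 := Cmod_triangle I1 (Ci * I2)).
  rewrite Cmod_opp in T1, T2. rewrite Cmod_mult, Cmod_Ci in T1, T3.
  unfold Cminus in *. lra.
Qed.

Lemma rect_int_minus (f g : C -> C) (a b c d : R) :
  a <= b -> c <= d -> rect_cont f a b c d -> rect_cont g a b c d ->
  rect_int (fun u => f u - g u)%C a b c d = (rect_int f a b c d - rect_int g a b c d)%C.
Proof.
  intros Hab Hcd Hf Hg. unfold rect_int.
  rewrite (CRInt_minus (fun x => f (x, c)) (fun x => g (x, c))) by (eapply ex_horiz; eauto; lra).
  rewrite (CRInt_minus (fun x => f (x, d)) (fun x => g (x, d))) by (eapply ex_horiz; eauto; lra).
  rewrite (CRInt_minus (fun y => f (a, y)) (fun y => g (a, y))) by (eapply ex_vert; eauto; lra).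
  rewrite (CRInt_minus (fun y => f (b, y)) (fun y => g (b, y))) by (eapply ex_vert; eauto; lra).
  ring.
Qed.

Lemma CRInt_affine (p q : C) (a b : R) :
  CRInt (fun t => p + RtoC t * q)%C a b
  = (RtoC (b - a) * p + RtoC ((b * b - a * a) / 2) * q)%C.
Proof.
  assert (I : is_RInt (fun t : R => t) a b ((b * b - a * a) / 2)).
  { assert (K := is_RInt_derive (V := R_CompleteNormedModule) (fun t : R => t * t / 2) (fun t => t) a b).
    replace ((b * b - a * a) / 2) with (minus (b * b / 2) (a * a / 2)).
    - apply K; intros x _.
      + auto_derive; auto. field.
      + apply continuous_id.
    - unfold minus, plus, opp; simpl. field. }
  assert (E : ex_CRInt (fun t => RtoC t) a b).
  { apply ex_CRInt_cont. intros. apply CC_RtoC, continuous_id. }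
  rewrite (CRInt_ext _ (fun t => p + q * RtoC t)%C) by (intros; ring).
  rewrite CRInt_plus, CRInt_const, CRInt_scal; auto.
  - rewrite CRInt_RtoC by (eexists; exact I). rewrite (is_RInt_unique _ _ _ _ I). ring.
  - apply ex_CRInt_cont. intros. apply CC_const.
  - apply ex_CRInt_scal, E.
Qed.

Lemma rect_int_affine (p q : C) (a b c d : R) :
  rect_int (fun z => p + z * q)%C a b c d = 0.
Proof.
  unfold rect_int.
  assert (H : forall y, CRInt (fun x => p + (x, y) * q)%C a b
     = CRInt (fun x => (p + Ci * RtoC y * q) + RtoC x * q)%C a b).
  { intros y. apply CRInt_ext. intros x _.
    replace ((x, y) : C) with (RtoC x + Ci * RtoC y)%C
      by (apply injective_projections; simpl; ring). ring. }
  assert (V : forall x, CRInt (fun y => p + (x, y) * q)%C c d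
     = CRInt (fun y => (p + RtoC x * q) + RtoC y * (Ci * q))%C c d).
  { intros x. apply CRInt_ext. intros y _.
    replace ((x, y) : C) with (RtoC x + Ci * RtoC y)%C
      by (apply injective_projections; simpl; ring). ring. }
  rewrite !H, !V, !CRInt_affine.
  rewrite !(RtoC_minus b a), !(RtoC_minus d c). ring.
Qed.

Lemma nested_point (u v : nat -> R) :
  (forall k, u k <= u (S k)) -> (forall k, v (S k) <= v k) -> (forall k, u k <= v k) ->
  exists x, forall k, u k <= x <= v k.
Proof.
  intros Hu Hv Huv.
  assert (Mu : forall j k, (j <= k)%nat -> u j <= u k).
  { intros j k H. induction H. lra. eapply Rle_trans; eauto. }
  assert (Mv : forall j k, (j <= k)%nat -> v k <= v j).
  { intros j k H. induction H. lra. eapply Rle_trans; eauto. }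
  assert (C : forall j k, u j <= v k).
  { intros j k. destruct (Nat.le_ge_cases j k) as [H|H].
    - eapply Rle_trans; [apply (Mu _ _ H) | apply Huv].
    - eapply Rle_trans; [apply Huv | apply (Mv _ _ H)]. }
  destruct (completeness (fun x => exists k, x = u k)) as [x [H1 H2]].
  - exists (v O). intros x [k ->]. apply C.
  - exists (u O). exists O. auto.
  - exists x. intros k. split.
    + apply H1. exists k; auto.
    + apply H2. intros y [j ->]. apply C.
Qed.

Lemma exists_pow2_small (A d : R) : 0 < d -> exists k, A / 2 ^ k < d.
Proof.
  intros Hd.
  destruct (Pow_x_infinity 2 ltac:(rewrite Rabs_pos_eq; lra) (A / d + 1)) as [N HN].
  exists N. specialize (HN N (Nat.le_refl N)).
  assert (P : 0 < 2 ^ N) by (apply pow_lt; lra).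
  rewrite Rabs_pos_eq in HN by lra.
  apply Rlt_div_l; auto. apply Rmult_ge_compat_l with (r := d) in HN; [|lra].
  replace (d * (A / d + 1)) with (A + d) in HN by (field; lra). lra.
Qed.

Section Goursat.

Variables (g : C -> C) (w h : R).
Hypotheses (Hw : 0 <= w) (Hh : 0 <= h).

Let M (k : nat) (p : R * R) : R :=
  Cmod (rect_int g (fst p) (fst p + w / 2 ^ k) (snd p) (snd p + h / 2 ^ k)).

Lemma half_pow (x : R) (k : nat) : x / 2 ^ k = x / 2 ^ S k + x / 2 ^ S k.
Proof. simpl. field. apply pow_nonzero. lra. Qed.

Lemma div_pow_pos (x : R) (k : nat) : 0 <= x -> 0 <= x / 2 ^ k.
Proof.
  intros Hx. apply Rmult_le_pos; auto. left. apply Rinv_0_lt_compat, pow_lt. lra.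
Qed.

(** The integral over the rectangle is the sum over its four quarters, so one of them carries at
    least a quarter of the modulus. *)
Lemma bisect (k : nat) (x y : R) :
  rect_cont g x (x + w / 2 ^ k) y (y + h / 2 ^ k) ->
  exists x' y', (x' = x \/ x' = x + w / 2 ^ S k) /\ (y' = y \/ y' = y + h / 2 ^ S k) /\
    M k (x, y) <= 4 * M (S k) (x', y').
Proof.
  intros Hc. unfold M; cbn [fst snd]. rewrite (half_pow w k), (half_pow h k) in *.
  assert (Pw := div_pow_pos w (S k) Hw). assert (Ph := div_pow_pos h (S k) Hh).
  set (w' := w / 2 ^ S k) in *. set (h' := h / 2 ^ S k) in *.
  rewrite <- (Rplus_assoc x), <- (Rplus_assoc y) in *.
  rewrite (rect_split_x g x _ _ _ (x + w')) by (auto; lra).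
  rewrite (rect_split_y g x _ _ _ (y + h')) by (try (eapply rect_cont_sub; eauto); lra).
  rewrite (rect_split_y g (x + w') _ _ _ (y + h')) by (try (eapply rect_cont_sub; eauto); lra).
  set (r1 := rect_int g x (x + w') y (y + h')).
  set (r2 := rect_int g x (x + w') (y + h') (y + h' + h')).
  set (r3 := rect_int g (x + w') (x + w' + w') y (y + h')).
  set (r4 := rect_int g (x + w') (x + w' + w') (y + h') (y + h' + h')).
  assert (T1 := Cmod_triangle (r1 + r2) (r3 + r4)).
  assert (T2 := Cmod_triangle r1 r2). assert (T3 := Cmod_triangle r3 r4).
  set (T := Cmod (r1 + r2 + (r3 + r4))) in *.
  destruct (Rle_dec T (4 * Cmod r1)). { exists x, y. auto. }
  destruct (Rle_dec T (4 * Cmod r2)). { exists x, (y + h'). auto. }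
  destruct (Rle_dec T (4 * Cmod r3)). { exists (x + w'), y. auto. }
  exists (x + w'), (y + h'). repeat split; auto. unfold r4 in *. lra.
Qed.

(** The selected rectangles shrink to a point [z]. There [g] is affine up to an error small compared
    with |u - z|, and affine functions integrate to 0. The integral over the k-th rectangle is thus
    a small multiple of 4^-k, while the selection keeps it at least 4^-k times the original one. *)
Lemma goursat_aux (a c : R) :
  (forall x y, a <= x <= a + w -> c <= y <= c + h -> exists l, Cder g (x, y) l) ->
  rect_int g a (a + w) c (c + h) = 0.
Proof.
  intros Hg.
  assert (Hc : rect_cont g a (a + w) c (c + h)).
  { intros x y Hx Hy. destruct (Hg x y Hx Hy) as [l Hl]. apply (Cder_CC _ _ _ Hl). }
  pose (ok := fun (k : nat) (p : R * R) =>
    a <= fst p /\ fst p + w / 2 ^ k <= a + w /\ c <= snd p /\ snd p + h / 2 ^ k <= c + h).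
  (* The condition [ok] stands inside the existential so that [choice] applies to all pairs; where
     it fails any witness does. *)
  assert (Step : forall kp : nat * (R * R), exists p' : R * R,
    ok (fst kp) (snd kp) -> ok (S (fst kp)) p' /\
    (fst (snd kp) <= fst p' /\ fst p' + w / 2 ^ S (fst kp) <= fst (snd kp) + w / 2 ^ fst kp) /\
    (snd (snd kp) <= snd p' /\ snd p' + h / 2 ^ S (fst kp) <= snd (snd kp) + h / 2 ^ fst kp) /\
    M (fst kp) (snd kp) <= 4 * M (S (fst kp)) p').
  { intros [k [x y]]; cbn [fst snd].
    destruct (excluded_middle_informative (ok k (x, y))) as [O|O];
      [|exists (x, y); intros O'; contradiction].
    destruct (bisect k x y) as [x' [y' [Ex [Ey HM]]]].
    { destruct O as [? [? [? ?]]]. eapply rect_cont_sub; eauto. }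
    exists (x', y'). intros _. unfold ok in *; cbn [fst snd] in *.
    rewrite (half_pow w k), (half_pow h k) in *.
    assert (Pw := div_pow_pos w (S k) Hw). assert (Ph := div_pow_pos h (S k) Hh).
    repeat split; try exact HM; destruct Ex, Ey; subst; lra. }
  destruct (choice _ Step) as [f Hf].
  pose (p := fix p (k : nat) : R * R := match k with O => (a, c) | S j => f (j, p j) end).
  assert (Hok : forall k, ok k (p k)).
  { induction k. { unfold ok; simpl. lra. } apply (Hf (k, p k) IHk). }
  assert (HM : forall k, M 0 (p O) <= 4 ^ k * M k (p k)).
  { induction k. simpl; lra. destruct (Hf (k, p k) (Hok k)) as [_ [_ [_ Q]]].
    eapply Rle_trans; [apply IHk|].
    replace (4 ^ S k * M (S k) (p (S k))) with (4 ^ k * (4 * M (S k) (p (S k)))) by (simpl; ring).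
    apply Rmult_le_compat_l. apply pow_le; lra. exact Q. }
  destruct (nested_point (fun k => fst (p k)) (fun k => fst (p k) + w / 2 ^ k)) as [x Hx].
  { intros k. apply (Hf (k, p k) (Hok k)). } { intros k. apply (Hf (k, p k) (Hok k)). }
  { intros k. assert (P := div_pow_pos w k Hw). lra. }
  destruct (nested_point (fun k => snd (p k)) (fun k => snd (p k) + h / 2 ^ k)) as [y Hy].
  { intros k. apply (Hf (k, p k) (Hok k)). } { intros k. apply (Hf (k, p k) (Hok k)). }
  { intros k. assert (P := div_pow_pos h k Hh). lra. }
  destruct (Hg x y) as [l Hl].
  { specialize (Hx O). simpl in Hx. lra. } { specialize (Hy O). simpl in Hy. lra. }
  apply Cmod_eq_0. apply Rle_antisym; [|apply Cmod_ge_0].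
  apply Rnot_lt_le. intros Pos.
  set (I := Cmod (rect_int g a (a + w) c (c + h))) in *.
  assert (EI : M 0 (p O) = I).
  { unfold M, I; simpl. f_equal. f_equal; field. }
  (* With the relative error [I / (2 * K)], perimeter times error gives I <= I (w + h)^2 / K, which
     contradicts K > (w + h)^2. The summand 1 keeps [K] positive for a degenerate rectangle. *)
  set (K := 2 * (w + h) * (w + h) + 1).
  assert (PK : 0 < K) by (unfold K; nra).
  apply (proj1 (Cder_eps _ _ _)) with (eps := I / (2 * K)) in Hl.
  2:{ apply Rdiv_lt_0_compat; lra. }
  destruct Hl as [d [Hd Hl]].
  destruct (exists_pow2_small (w + h) d Hd) as [k Hk].
  specialize (HM k). rewrite EI in HM.
  destruct (Hok k) as [O1 [O2 [O3 O4]]].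
  specialize (Hx k). specialize (Hy k). cbn beta in Hx, Hy.
  destruct (p k) as [xk yk]; unfold M in HM; cbn [fst snd] in *.
  assert (Pw := div_pow_pos w k Hw). assert (Ph := div_pow_pos h k Hh).
  assert (Ck : rect_cont g xk (xk + w / 2 ^ k) yk (yk + h / 2 ^ k))
    by (eapply rect_cont_sub; eauto).
  set (z := (x, y) : C) in *.
  set (A := fun u : C => (g z - z * l + u * l)%C).
  assert (CA : forall u, Cct A u).
  { intros u. apply CC_plus. apply CC_const. apply CC_mult. apply CC_id. apply CC_const. }
  assert (Cg : rect_cont (fun u => g u - A u)%C xk (xk + w / 2 ^ k) yk (yk + h / 2 ^ k)).
  { intros u v Hu Hv. apply CC_minus. apply Ck; auto. apply CA. }
  assert (E : rect_int g xk (xk + w / 2 ^ k) yk (yk + h / 2 ^ k) =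
    rect_int (fun u => g u - A u)%C xk (xk + w / 2 ^ k) yk (yk + h / 2 ^ k)).
  { assert (Z := rect_int_affine (g z - z * l) l xk (xk + w / 2 ^ k) yk (yk + h / 2 ^ k)).
    fold A in Z.
    assert (CA' : rect_cont A xk (xk + w / 2 ^ k) yk (yk + h / 2 ^ k)) by (intros ? ? _ _; apply CA).
    transitivity (rect_int g xk (xk + w / 2 ^ k) yk (yk + h / 2 ^ k) -
      rect_int A xk (xk + w / 2 ^ k) yk (yk + h / 2 ^ k))%C.
    { rewrite Z. ring. }
    symmetry. apply rect_int_minus; auto; lra. }
  rewrite E in HM.
  assert (B := rect_int_bound _ _ _ _ _ (I / (2 * K) * ((w + h) / 2 ^ k)) Cg ltac:(lra) ltac:(lra)).
  replace (xk + w / 2 ^ k - xk + (yk + h / 2 ^ k - yk)) with ((w + h) / 2 ^ k) in B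
    by (unfold Rdiv; ring).
  assert (B' : 4 ^ k * (2 * ((w + h) / 2 ^ k) * (I / (2 * K) * ((w + h) / 2 ^ k)))
     = I * ((w + h) * (w + h)) / K).
  { replace 4 with (2 * 2) by ring. rewrite Rpow_mult_distr. field. split. lra.
    apply pow_nonzero; lra. }
  assert (Q : I <= I * ((w + h) * (w + h)) / K).
  { rewrite <- B'. eapply Rle_trans; [apply HM|]. apply Rmult_le_compat_l. apply pow_le; lra.
    apply B. intros u v Hu Hv.
    assert (D : Cmod ((u, v) - z) <= (w + h) / 2 ^ k).
    { eapply Rle_trans; [apply Cmod_le_abs|]. unfold z; simpl.
      replace ((w + h) / 2 ^ k) with (w / 2 ^ k + h / 2 ^ k) by (unfold Rdiv; ring).
      apply Rplus_le_compat; apply Rabs_le; lra. }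
    unfold A.
    replace (g (u, v) - (g z - z * l + (u, v) * l))%C
      with (g (u, v) - g z - ((u, v) - z) * l)%C by ring.
    eapply Rle_trans; [apply Hl; lra|].
    apply Rmult_le_compat_l; auto. apply Rlt_le, Rdiv_lt_0_compat; lra. }
  assert (Q' : I * ((w + h) * (w + h)) / K < I).
  { apply Rlt_div_l; auto. apply Rmult_lt_compat_l; auto. unfold K. nra. }
  lra.
Qed.

End Goursat.

Lemma goursat (g : C -> C) (a b c d : R) : a <= b -> c <= d ->
  (forall x y, a <= x <= b -> c <= y <= d -> exists l, Cder g (x, y) l) ->
  rect_int g a b c d = 0.
Proof.
  intros Hab Hcd H.
  replace b with (a + (b - a)) by ring. replace d with (c + (d - c)) by ring.
  apply goursat_aux; try lra. intros x y Hx Hy. apply H; lra.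
Qed.

(** * Cauchy formulas on circles *)

Lemma C_eq_of_small (x y : C) (K : R) :
  (forall eps, 0 < eps -> Cmod (x - y) <= K * eps) -> x = y.
Proof.
  intros H. apply Ceq_minus, Cmod_eq_0, Rle_antisym; [|apply Cmod_ge_0].
  apply Rnot_lt_le. intros P.
  destruct (Rle_dec K 0) as [N|N].
  - specialize (H 1 Rlt_0_1). lra.
  - assert (E : 0 < Cmod (x - y) / (2 * K)) by (apply Rdiv_lt_0_compat; lra).
    specialize (H _ E). replace (K * (Cmod (x - y) / (2 * K))) with (Cmod (x - y) / 2) in H
      by (field; lra). lra.
Qed.

(** A square of half-side [e] around the exceptional point is cut out, and Goursat's theorem applies
    to the four remaining rectangles. On the square [g] is bounded by continuity and the perimeter
    is 8 e. The lemma is meant for difference quotients, which are merely known to be continuous at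
    their base point. *)
Lemma goursat_punctured (g : C -> C) (a b c d px py : R) :
  a < px < b -> c < py < d -> rect_cont g a b c d ->
  (forall x y, a <= x <= b -> c <= y <= d -> (x, y) <> (px, py) ->
     exists l, Cder g (x, y) l) ->
  rect_int g a b c d = 0.
Proof.
  intros Hx Hy Hc Hg.
  destruct (proj1 (CC_C_eps g (px, py)) (Hc px py ltac:(lra) ltac:(lra)) 1 Rlt_0_1) as [d0 [Hd0 H0]].
  set (M := Cmod (g (px, py)) + 1).
  apply (C_eq_of_small _ _ (8 * M)). intros eps He.
  set (m := Rmin (Rmin (px - a) (b - px)) (Rmin (py - c) (d - py))).
  assert (Pm : 0 < m) by (repeat apply Rmin_pos; lra).
  assert (m1 : m <= px - a) by (eapply Rle_trans; [apply Rmin_l|apply Rmin_l]).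
  assert (m2 : m <= b - px) by (eapply Rle_trans; [apply Rmin_l|apply Rmin_r]).
  assert (m3 : m <= py - c) by (eapply Rle_trans; [apply Rmin_r|apply Rmin_l]).
  assert (m4 : m <= d - py) by (eapply Rle_trans; [apply Rmin_r|apply Rmin_r]).
  set (e := Rmin (Rmin (m / 2) (d0 / 4)) eps).
  assert (Pe : 0 < e) by (repeat apply Rmin_pos; lra).
  assert (e1 : e <= m / 2) by (eapply Rle_trans; [apply Rmin_l|apply Rmin_l]).
  assert (e2 : e <= d0 / 4) by (eapply Rle_trans; [apply Rmin_l|apply Rmin_r]).
  assert (e3 : e <= eps) by apply Rmin_r.
  assert (S : forall a' b' c' d', a <= a' -> a' <= b' -> b' <= b -> c <= c' -> c' <= d' -> d' <= d ->
    rect_cont g a' b' c' d') by (intros; eapply rect_cont_sub; eauto).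
  assert (Z : forall a' b' c' d', a <= a' -> a' <= b' -> b' <= b -> c <= c' -> c' <= d' -> d' <= d ->
    (b' < px \/ px < a' \/ d' < py \/ py < c') -> rect_int g a' b' c' d' = 0).
  { intros a' b' c' d' ? ? ? ? ? ? N. apply goursat; auto. intros x y ? ?. apply Hg; try lra.
    intros E. injection E as -> ->. lra. }
  rewrite (rect_split_x g a b c d (px - e)) by (auto; lra).
  rewrite (rect_split_x g (px - e) b c d (px + e)) by (try apply S; lra).
  rewrite (rect_split_y g (px - e) (px + e) c d (py - e)) by (try apply S; lra).
  rewrite (rect_split_y g (px - e) (px + e) (py - e) d (py + e)) by (try apply S; lra).
  rewrite (Z a (px - e)) by lra. rewrite (Z (px + e) b) by lra.
  rewrite (Z _ _ c (py - e)) by lra. rewrite (Z _ _ (py + e) d) by lra.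
  rewrite !Cplus_0_l, !Cplus_0_r. unfold Cminus. rewrite Copp_0, Cplus_0_r.
  eapply Rle_trans. apply (rect_int_bound _ _ _ _ _ M); try lra. apply S; lra.
  - intros x y Hx' Hy'.
    assert (D : Cmod ((x, y) - (px, py)) < d0).
    { eapply Rle_lt_trans; [apply Cmod_le_abs|]. simpl.
      assert (Rabs (x + - px) <= e) by (apply Rabs_le; lra).
      assert (Rabs (y + - py) <= e) by (apply Rabs_le; lra). lra. }
    specialize (H0 _ D). assert (T := Cmod_triangle_inv (g (x, y)) (g (px, py))). unfold M. lra.
  - assert (0 <= M) by (unfold M; assert (K := Cmod_ge_0 (g (px, py))); lra).
    replace (2 * (px + e - (px - e) + (py + e - (py - e))) * M) with (8 * M * e) by ring.
    apply Rmult_le_compat_l; lra.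
Qed.

Lemma Cexp_pair (x y : R) : Cexp (x, y) = (RtoC (exp x) * expi y)%C.
Proof. rewrite expi_eq. unfold Cexp; simpl. apply injective_projections; simpl; ring. Qed.

Lemma expi_2PI (t : R) : expi (t + 2 * PI) = expi t.
Proof. rewrite !expi_eq. rewrite cos_plus, sin_plus, cos_2PI, sin_2PI. f_equal; ring. Qed.

Lemma expi_inj (t u : R) : Rabs (t - u) <= PI -> expi t = expi u -> t = u.
Proof.
  intros H E. assert (P := PI_RGT_0). rewrite !expi_eq in E. injection E as E1 E2.
  set (v := (t - u) / 2).
  assert (C : cos (t - u) = 1).
  { rewrite cos_minus, E1, E2. generalize (sin2_cos2 u). unfold Rsqr. lra. }
  assert (S : sin v = 0).
  { replace (t - u) with (2 * v) in C by (unfold v; field). rewrite cos_2a_sin in C. nra. }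
  apply Rabs_le_between in H.
  destruct (Rtotal_order v 0) as [L|[L|L]].
  - assert (Q := sin_gt_0 (- v) ltac:(lra) ltac:(unfold v in *; lra)). rewrite sin_neg in Q. lra.
  - unfold v in L. lra.
  - assert (Q := sin_gt_0 v ltac:(lra) ltac:(unfold v in *; lra)). lra.
Qed.

(** The free starting angle [c] allows the rectangle in logarithmic coordinates to be centred at the
    argument of an exceptional point. *)
Lemma circle_int_window (s c : R) (f : C -> C) : circ_cont s f ->
  circle_int s f = (Ci * CRInt (fun t => f (RtoC s * expi t) * (RtoC s * expi t)) c (c + 2 * PI))%C.
Proof.
  intros H. unfold circle_int.
  assert (K : forall t, CC (fun t : R => f (RtoC s * expi t) * (RtoC s * expi t))%C t).
  { intros t. apply CC_mult. apply H. apply CC_circle. }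
  rewrite (CRInt_periodic _ (2 * PI) c K).
  2:{ intros t. rewrite expi_2PI. reflexivity. }
  rewrite <- CRInt_scal by (apply ex_CRInt_cont; auto).
  apply CRInt_ext. intros; ring.
Qed.

(* In logarithmic coordinates the annulus becomes a rectangle, and the
   integrals over its two horizontal sides cancel by periodicity. *)
Lemma annulus_invariance (a b : R) (f : C -> C) (z0 : C) : 0 < a -> a <= b ->
  Cmod z0 <> a -> Cmod z0 <> b ->
  (forall z : C, a <= Cmod z <= b -> Cct f z) ->
  (forall z : C, a <= Cmod z <= b -> z <> z0 -> exists l, Cder f z l) ->
  circle_int a f = circle_int b f.
Proof.
  intros Ha Hab Na Nb Hc Hd. assert (P := PI_RGT_0).
  destruct (polar z0) as [th [_ Eth]].
  set (g := fun u => (f (Cexp u) * Cexp u)%C).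
  assert (Hmod : forall x y, ln a <= x <= ln b -> a <= Cmod (Cexp (x, y)) <= b).
  { intros x y [H1 H2]. rewrite Cmod_Cexp; simpl. rewrite <- (exp_ln a), <- (exp_ln b) by lra.
    assert (E : forall u v, u <= v -> exp u <= exp v).
    { intros u v [L|L]. left; apply exp_increasing, L. right; congruence. }
    split; apply E; assumption. }
  assert (Lab : ln a <= ln b).
  { destruct Hab as [L|L]. left; apply ln_increasing; auto. right; congruence. }
  assert (Gc : rect_cont g (ln a) (ln b) (th - PI) (th - PI + 2 * PI)).
  { intros x y Hx Hy. apply CC_mult; [|apply CC_Cexp, CC_id].
    apply (continuous_comp (U := C_UniformSpace) (V := C_UniformSpace) Cexp f).
    apply CC_Cexp, CC_id. apply Hc, Hmod, Hx. }
  assert (Gd : forall x y, ln a <= x <= ln b -> Cexp (x, y) <> z0 -> exists l, Cder g (x, y) l).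
  { intros x y Hx N. destruct (Hd _ (Hmod x y Hx) N) as [l Hl].
    eexists. apply (Cder_mult (fun u => f (Cexp u)) Cexp).
    apply (Cder_comp f Cexp). exact Hl. apply Cder_Cexp. apply Cder_Cexp. }
  assert (Z : rect_int g (ln a) (ln b) (th - PI) (th - PI + 2 * PI) = 0).
  { destruct (excluded_middle_informative (a < Cmod z0 < b)) as [I|O].
    (* The window has half-width PI around the argument [th] of [z0], so the logarithm of [z0] is an
       interior point of the rectangle and the only point of it that [Cexp] maps to [z0]. *)
    - apply (goursat_punctured _ _ _ _ _ (ln (Cmod z0)) th); auto; try lra.
      { split; apply ln_increasing; lra. }
      intros x y Hx Hy N. apply Gd; auto. intros E. apply N.
      assert (E1 : exp x = Cmod z0) by (rewrite <- E, Cmod_Cexp; reflexivity).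
      rewrite Cexp_pair, E1 in E. rewrite Eth in E at 2.
      f_equal. rewrite <- E1, ln_exp. reflexivity.
      apply expi_inj. apply Rabs_le; lra.
      assert (NZ : RtoC (Cmod z0) <> 0) by (intros Q; apply RtoC_inj in Q; lra).
      apply (f_equal (fun u => / RtoC (Cmod z0) * u)%C) in E.
      rewrite !Cmult_assoc, Cinv_l, !Cmult_1_l in E; auto.
    - apply goursat; try lra. intros x y Hx Hy. apply Gd; auto.
      intros E. apply O. specialize (Hmod x y Hx). rewrite E in Hmod. lra. }
  assert (V : forall s, a <= s <= b -> circle_int s f =
    (Ci * CRInt (fun y => g (ln s, y)) (th - PI) (th - PI + 2 * PI))%C).
  { intros s Hs. rewrite (circle_int_window s (th - PI)).
    - f_equal. apply CRInt_ext. intros t _. unfold g. rewrite Cexp_pair, exp_ln by lra. reflexivity.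
    - apply circ_cont_of. lra. intros z Hz. apply Hc. lra. }
  rewrite (V a), (V b) by lra.
  unfold rect_int in Z.
  replace (CRInt (fun x => g (x, th - PI + 2 * PI)) (ln a) (ln b))
    with (CRInt (fun x => g (x, th - PI)) (ln a) (ln b)) in Z.
  2:{ apply CRInt_ext. intros x _. unfold g. rewrite !Cexp_pair, expi_2PI. reflexivity. }
  apply Ceq_minus. rewrite <- (Copp_0), <- Z. ring.
Qed.

Lemma annulus_hol (a b : R) (f : C -> C) : 0 < a -> a <= b ->
  hol (fun z => a <= Cmod z <= b) f -> circle_int a f = circle_int b f.
Proof.
  (* The origin serves as a dummy exceptional point, outside the annulus. *)
  intros Ha Hab H. apply (annulus_invariance a b f 0); auto; try (rewrite Cmod_0; lra).
  intros z Hz. apply (hol_CC _ _ _ H Hz).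
Qed.

Lemma kernel_neq_0 (t z : C) : Cmod z <> Cmod t -> (t - z)%C <> 0.
Proof. intros H E. apply H. f_equal. symmetry. apply Ceq_minus, E. Qed.

Lemma hol_kernel (U : C -> Prop) (z : C) : (forall t, U t -> t <> z) ->
  hol U (fun t => / (t - z))%C.
Proof.
  intros H. apply hol_inv. apply hol_minus. apply hol_id. apply hol_const.
  intros t Ht E. apply (H t Ht). apply Ceq_minus, E.
Qed.

Lemma Cmod_kernel_le (t z : C) (d : R) : 0 < d -> d <= Rabs (Cmod t - Cmod z) ->
  Cmod (/ (t - z)) <= / d.
Proof.
  intros Hd H.
  assert (L : d <= Cmod (t - z)).
  { assert (T1 := Cmod_triangle_inv t z). assert (T2 := Cmod_triangle_inv z t).
    rewrite Cmod_minus_sym in T2. unfold Rabs in H. destruct Rcase_abs in H; lra. }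
  rewrite Cmod_inv. apply Rinv_le_contravar; auto.
  apply Cmod_gt_0. lra.
Qed.

(** The circle is moved out to a radius S, where / (t - z) differs from / t by O(1 / S^2). *)
Lemma kernel_inside (s : R) (z : C) : Cmod z < s ->
  circle_int s (fun t => / (t - z))%C = (RtoC (2 * PI) * Ci)%C.
Proof.
  intros Hz. assert (P := PI_RGT_0). assert (Pz := Cmod_ge_0 z).
  apply (C_eq_of_small _ _ (2 * PI * Cmod z)). intros eps He.
  (* On |t| = S this gives |t - z| >= S - |z| > 1 / eps. *)
  set (S := s + / eps). assert (Pe : 0 < / eps) by (apply Rinv_0_lt_compat; auto).
  assert (HS : s < S) by (unfold S; lra).
  rewrite (annulus_hol s S); try lra.
  2:{ apply hol_kernel. intros t Ht ->. lra. }
  rewrite <- (circle_int_const_kernel S) by lra.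
  assert (K0 : circ_cont S (fun t => / t)%C).
  { apply (circ_cont_ext _ (fun t => / (t - 0))%C). lra. intros t _. f_equal. ring.
    apply circ_cont_kernel. lra. rewrite Cmod_0. lra. }
  assert (Kz : circ_cont S (fun t => / (t - z))%C) by (apply circ_cont_kernel; lra).
  rewrite <- circle_int_minus by auto.
  eapply Rle_trans. apply (circle_int_bound S (Cmod z * eps / S)). lra.
  - apply circ_cont_minus; auto.
  - intros t Ht.
    assert (N1 : t <> 0) by (apply Cmod_gt_0; lra).
    assert (N2 : (t - z)%C <> 0) by (apply kernel_neq_0; lra).
    replace (/ (t - z) - / t)%C with (z * (/ (t - z) * / t))%C by (field; auto).
    rewrite !Cmod_mult. rewrite (Cmod_inv t), Ht by auto.
    unfold Rdiv. rewrite !Rmult_assoc. apply Rmult_le_compat_l; auto.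
    apply Rmult_le_compat_r. left; apply Rinv_0_lt_compat; lra.
    rewrite <- (Rinv_inv eps). apply Cmod_kernel_le; auto.
    rewrite Ht, Rabs_pos_eq; unfold S; lra.
  - right. field. lra.
Qed.

(** The circle shrinks to the origin, near which [f] is bounded by continuity. *)
Lemma cauchy_zero (s : R) (f : C -> C) : 0 < s ->
  hol (fun z => Cmod z <= s) f -> circle_int s f = 0.
Proof.
  intros Hs Hf. assert (P := PI_RGT_0).
  assert (C0 : Cct f (RtoC 0)) by (apply (hol_CC _ _ _ Hf); rewrite Cmod_0; lra).
  destruct (proj1 (CC_C_eps f 0) C0 1 Rlt_0_1) as [d [Hd H0]].
  set (M := Cmod (f 0) + 1).
  assert (PM : 0 < M) by (unfold M; assert (K := Cmod_ge_0 (f 0)); lra).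
  apply (C_eq_of_small _ _ (2 * PI * M)). intros eps He.
  set (e := Rmin (Rmin (s / 2) (d / 2)) eps).
  assert (Pe : 0 < e) by (repeat apply Rmin_pos; lra).
  assert (e1 : e <= s / 2) by (eapply Rle_trans; [apply Rmin_l|apply Rmin_l]).
  assert (e2 : e <= d / 2) by (eapply Rle_trans; [apply Rmin_l|apply Rmin_r]).
  assert (e3 : e <= eps) by apply Rmin_r.
  rewrite <- (annulus_hol e s); try lra.
  2:{ apply (hol_sub _ _ _ Hf). intros; lra. }
  unfold Cminus. rewrite Copp_0, Cplus_0_r.
  eapply Rle_trans. apply (circle_int_bound e M). lra.
  - apply (circ_cont_hol _ (fun z => Cmod z <= s)); auto. lra. intros; lra.
  - intros z Hz. specialize (H0 z). replace (z - 0)%C with z in H0 by ring.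
    assert (T := Cmod_triangle_inv (f z) (f 0)). specialize (H0 ltac:(lra)). unfold M. lra.
  - replace (2 * PI * (e * M)) with (2 * PI * M * e) by ring. apply Rmult_le_compat_l; auto.
    apply Rmult_le_pos; lra.
Qed.

Lemma kernel_outside (s : R) (z : C) : 0 < s < Cmod z ->
  circle_int s (fun t => / (t - z))%C = 0.
Proof.
  intros Hs. apply cauchy_zero. lra. apply hol_kernel. intros t Ht ->. lra.
Qed.

(** The parameter [l] fills the removable singularity at [z]. When it is the derivative, the
    function is continuous there, which is all that the version of Goursat's theorem with an
    exceptional point asks. *)
Definition diff_quotient (f : C -> C) (z l t : C) : C :=
  if excluded_middle_informative (t = z) then l else ((f t - f z) * / (t - z))%C.

Lemma diff_quotient_CC (f : C -> C) (z l : C) : Cder f z l -> Cct (diff_quotient f z l) z.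
Proof.
  intros H. apply CC_C_eps. intros eps He.
  apply (proj1 (Cder_eps _ _ _)) with (eps := eps / 2) in H; [|lra].
  destruct H as [d [Hd H]]. exists d. split; auto. intros y Hy. unfold diff_quotient.
  destruct (excluded_middle_informative (z = z)) as [_|N]; [|congruence].
  destruct (excluded_middle_informative (y = z)) as [_|N].
  - replace (l - l)%C with (RtoC 0) by ring. rewrite Cmod_0. auto.
  - assert (N' : (y - z)%C <> 0) by (intros E; apply N, Ceq_minus, E).
    replace ((f y - f z) * / (y - z) - l)%C with ((f y - f z - (y - z) * l) / (y - z))%C
      by (field; auto).
    rewrite Cmod_div by auto. apply Rle_lt_trans with (eps / 2); [|lra].
    apply Rle_div_l. apply Cmod_gt_0; auto. apply H, Hy.
Qed.

Lemma diff_quotient_Cder (f : C -> C) (z l t m : C) : t <> z -> Cder f t m ->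
  exists k, Cder (diff_quotient f z l) t k.
Proof.
  intros N H. assert (N' : (t - z)%C <> 0) by (intros E; apply N, Ceq_minus, E).
  eexists. apply (Cder_ext_loc (fun t => (f t - f z) * / (t - z))%C).
  - exists (Cmod (t - z)). split. apply Cmod_gt_0; auto. intros y Hy. unfold diff_quotient.
    destruct excluded_middle_informative as [E|_]; auto. subst y.
    rewrite Cmod_minus_sym in Hy. lra.
  - apply Cder_mult. apply Cder_minus. exact H. apply Cder_const.
    apply Cder_invf; auto. apply (Cder_minus (fun t => t)). apply Cder_id. apply Cder_const.
Qed.

Lemma diff_quotient_circle (f : C -> C) (z l : C) (s : R) : 0 <= s -> Cmod z <> s ->
  circ_cont s f ->
  circle_int s (diff_quotient f z l) =
  (circle_int s (fun t => f t * / (t - z)) - f z * circle_int s (fun t => / (t - z)))%C.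
Proof.
  intros Hs Hz Hf. assert (K := circ_cont_kernel s z Hs Hz).
  rewrite <- circle_int_scal, <- circle_int_minus; auto.
  - apply circle_int_ext; auto. intros t Ht. unfold diff_quotient.
    destruct excluded_middle_informative as [E|_]. subst t. contradiction. ring.
  - apply circ_cont_mult; auto.
  - apply circ_cont_mult; auto. apply circ_cont_const.
Qed.

Lemma diff_quotient_annulus (a b : R) (f : C -> C) (z l : C) : 0 < a -> a <= b ->
  Cmod z <> a -> Cmod z <> b -> hol (fun t => a <= Cmod t <= b) f -> Cder f z l ->
  circle_int a (diff_quotient f z l) = circle_int b (diff_quotient f z l).
Proof.
  intros Ha Hab Na Nb Hf Hl.
  assert (D : forall t, a <= Cmod t <= b -> t <> z -> exists k, Cder (diff_quotient f z l) t k).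
  { intros t Ht N. destruct (Hf t Ht) as [m Hm]. apply (diff_quotient_Cder f z l t m N Hm). }
  apply (annulus_invariance a b _ z); auto.
  intros t Ht. destruct (excluded_middle_informative (t = z)) as [->|N].
  - apply diff_quotient_CC, Hl.
  - destruct (D t Ht N) as [k Hk]. apply (Cder_CC _ _ _ Hk).
Qed.

(** The difference quotient at [z] has the same integral over both circles; the kernel contributes 2
    PI i on the outer circle and 0 on the inner one. *)
Lemma cauchy_annulus (a b : R) (f : C -> C) (z : C) : 0 < a < Cmod z -> Cmod z < b ->
  hol (fun t => a <= Cmod t <= b) f ->
  (circle_int b (fun t => f t * / (t - z)) - circle_int a (fun t => f t * / (t - z)))%C
  = (RtoC (2 * PI) * Ci * f z)%C.
Proof.
  intros Ha Hb Hf. destruct (Hf z) as [l Hl]. lra.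
  assert (E := diff_quotient_annulus a b f z l ltac:(lra) ltac:(lra) ltac:(lra) ltac:(lra) Hf Hl).
  assert (Cb : circ_cont b f) by (apply (circ_cont_hol b _ f ltac:(lra) Hf); intros; lra).
  assert (Ca : circ_cont a f) by (apply (circ_cont_hol a _ f ltac:(lra) Hf); intros; lra).
  rewrite (diff_quotient_circle f z l a), (diff_quotient_circle f z l b) in E by (auto; lra).
  rewrite (kernel_inside b), (kernel_outside a) in E by lra.
  apply Ceq_minus. apply Ceq_minus in E. rewrite <- Copp_0, <- E. ring.
Qed.

Lemma cauchy_disc (s : R) (f : C -> C) (z : C) : Cmod z < s ->
  hol (fun t => Cmod t <= s) f ->
  circle_int s (fun t => f t * / (t - z))%C = (RtoC (2 * PI) * Ci * f z)%C.
Proof.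
  intros Hz Hf. assert (Pz := Cmod_ge_0 z). assert (P := PI_RGT_0).
  destruct (Hf z) as [l Hl]. lra.
  assert (Q : forall t, Cmod t <= s -> Cct (diff_quotient f z l) t).
  { intros t Ht. destruct (excluded_middle_informative (t = z)) as [->|N].
    - apply diff_quotient_CC, Hl.
    - destruct (Hf t Ht) as [m Hm]. destruct (diff_quotient_Cder f z l t m N Hm) as [k Hk].
      apply (Cder_CC _ _ _ Hk). }
  assert (E : circle_int s (diff_quotient f z l) = 0).
  { assert (C0 := Q 0 ltac:(rewrite Cmod_0; lra)).
    destruct (proj1 (CC_C_eps _ 0) C0 1 Rlt_0_1) as [d [Hd H0]].
    set (M := Cmod (diff_quotient f z l 0) + 1).
    assert (PM : 0 < M) by (unfold M; assert (K := Cmod_ge_0 (diff_quotient f z l 0)); lra).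
    apply (C_eq_of_small _ _ (2 * PI * M)). intros eps He.
    (* The shrinking circles must not pass through [z]: they stay inside |t| < |z|, except for z =
       0, where every positive radius is allowed. *)
    set (w := if Req_EM_T (Cmod z) 0 then s / 2 else Cmod z / 2).
    assert (Hw : 0 < w < s /\ (w < Cmod z \/ Cmod z = 0)) by (unfold w; destruct Req_EM_T; lra).
    set (e := Rmin (Rmin w (d / 2)) eps).
    assert (Pe : 0 < e) by (repeat apply Rmin_pos; lra).
    assert (e1 : e <= w) by (eapply Rle_trans; [apply Rmin_l|apply Rmin_l]).
    assert (e2 : e <= d / 2) by (eapply Rle_trans; [apply Rmin_l|apply Rmin_r]).
    assert (e3 : e <= eps) by apply Rmin_r.
    rewrite <- (diff_quotient_annulus e s); try lra; auto.
    2:{ apply (hol_sub _ _ _ Hf). intros; lra. }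
    unfold Cminus. rewrite Copp_0, Cplus_0_r.
    eapply Rle_trans. apply (circle_int_bound e M). lra.
    - apply circ_cont_of. lra. intros t Ht. apply Q. lra.
    - intros t Ht. specialize (H0 t). replace (t - 0)%C with t in H0 by ring.
      assert (T := Cmod_triangle_inv (diff_quotient f z l t) (diff_quotient f z l 0)).
      specialize (H0 ltac:(lra)). unfold M. lra.
    - replace (2 * PI * (e * M)) with (2 * PI * M * e) by ring. apply Rmult_le_compat_l; auto.
      apply Rmult_le_pos; lra. }
  assert (Cs : circ_cont s f) by (apply (circ_cont_hol s _ f ltac:(lra) Hf); intros; lra).
  rewrite diff_quotient_circle in E by (auto; lra).
  rewrite kernel_inside in E by lra.
  apply Ceq_minus. rewrite <- E. ring.
Qed.

(** * Limits at infinity and Cauchy's formulas for the exterior of a circle *)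

Definition tends_at_infinity (f : C -> C) (L : C) : Prop :=
  forall eps, 0 < eps -> exists R0, forall t, R0 < Cmod t -> Cmod (f t - L) <= eps.

Lemma cauchy_at_infinity (f : C -> C) (L z : C) : tends_at_infinity f L ->
  forall eps, 0 < eps -> exists R0, forall S, R0 < S -> circ_cont S f ->
    Cmod (circle_int S (fun t => f t * / (t - z))%C - RtoC (2 * PI) * Ci * L) <= 4 * PI * eps.
Proof.
  intros H eps He. assert (P := PI_RGT_0). assert (Pz := Cmod_ge_0 z).
  destruct (H eps He) as [R1 H1].
  exists (Rmax R1 (2 * Cmod z)). intros S HS Hf.
  assert (S1 := Rle_lt_trans _ _ _ (Rmax_l _ _) HS).
  assert (S2 := Rle_lt_trans _ _ _ (Rmax_r _ _) HS).
  assert (K : circ_cont S (fun t => / (t - z))%C) by (apply circ_cont_kernel; lra).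
  rewrite <- (kernel_inside S z), (Cmult_comm _ L) by lra.
  rewrite <- circle_int_scal, <- circle_int_minus; auto.
  2:{ apply circ_cont_mult; auto. }
  2:{ apply circ_cont_mult; auto. apply circ_cont_const. }
  eapply Rle_trans. apply (circle_int_bound S (eps * / (S / 2))). lra.
  - apply circ_cont_minus; apply circ_cont_mult; auto. apply circ_cont_const.
  - intros t Ht. replace (f t * / (t - z) - L * / (t - z))%C with ((f t - L) * / (t - z))%C by ring.
    rewrite Cmod_mult. apply Rmult_le_compat; try apply Cmod_ge_0. apply H1; lra.
    apply Cmod_kernel_le. lra. rewrite Rabs_pos_eq; lra.
  - right. field. lra.
Qed.

Lemma cauchy_exterior_inside (s : R) (f : C -> C) (L z : C) : Cmod z < s ->
  hol (fun t => s <= Cmod t) f -> tends_at_infinity f L ->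
  circle_int s (fun t => f t * / (t - z))%C = (RtoC (2 * PI) * Ci * L)%C.
Proof.
  intros Hz Hf HL. assert (P := PI_RGT_0). assert (Pz := Cmod_ge_0 z).
  apply (C_eq_of_small _ _ (4 * PI)). intros eps He.
  destruct (cauchy_at_infinity f L z HL eps He) as [R0 H0].
  set (S := Rmax R0 s + 1).
  assert (S1 := Rmax_l R0 s). assert (S2 := Rmax_r R0 s).
  rewrite (annulus_hol s S); try (unfold S; lra).
  - apply H0. unfold S; lra. apply (circ_cont_hol S _ f ltac:(unfold S; lra) Hf).
    intros t ->. unfold S; lra.
  - apply hol_mult. apply (hol_sub _ _ _ Hf). intros; lra.
    apply hol_kernel. intros t Ht ->. lra.
Qed.

(** In Cauchy's formula for an annulus the outer circle goes to infinity, where its integral tends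
    to 2 PI i times the limit [L]. *)
Lemma cauchy_exterior_outside (s : R) (f : C -> C) (L z : C) : 0 < s < Cmod z ->
  hol (fun t => s <= Cmod t) f -> tends_at_infinity f L ->
  circle_int s (fun t => f t * / (t - z))%C = (RtoC (2 * PI) * Ci * (L - f z))%C.
Proof.
  intros Hz Hf HL. assert (P := PI_RGT_0).
  apply (C_eq_of_small _ _ (4 * PI)). intros eps He.
  destruct (cauchy_at_infinity f L z HL eps He) as [R0 H0].
  set (S := Rmax R0 (Cmod z) + 1).
  assert (S1 := Rmax_l R0 (Cmod z)). assert (S2 := Rmax_r R0 (Cmod z)).
  assert (A := cauchy_annulus s S f z Hz ltac:(unfold S; lra)).
  assert (Hf' : hol (fun t => s <= Cmod t <= S) f) by (apply (hol_sub _ _ _ Hf); intros; lra).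
  specialize (A Hf').
  replace (circle_int s (fun t => f t * / (t - z))%C - RtoC (2 * PI) * Ci * (L - f z))%C
    with (circle_int S (fun t => f t * / (t - z))%C - RtoC (2 * PI) * Ci * L)%C.
  - apply H0. unfold S; lra. apply (circ_cont_hol S _ f ltac:(unfold S; lra) Hf).
    intros t ->. unfold S; lra.
  - replace (RtoC (2 * PI) * Ci * (L - f z))%C with
      (RtoC (2 * PI) * Ci * L - RtoC (2 * PI) * Ci * f z)%C by ring.
    rewrite <- A. ring.
Qed.

(** Proves continuity along a circle by following the shape of the integrand. Inverses are not
    decomposed, since they need non-vanishing; they have to be available as hypotheses. *)
Ltac circ := repeat (match goal with
  | H : circ_cont ?s ?f |- circ_cont ?s ?f => exact H
  | H : circ_cont ?s ?f |- circ_cont ?s (fun t => ?f t) => exact H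
  | |- circ_cont ?s (fun t => Cmult (@?f t) (@?g t)) => apply (circ_cont_mult s f g)
  | |- circ_cont ?s (fun t => Cminus (@?f t) (@?g t)) => apply (circ_cont_minus s f g)
  | |- circ_cont ?s (fun t => Cplus (@?f t) (@?g t)) => apply (circ_cont_plus s f g)
  | |- circ_cont ?s (fun t => Cpow (@?f t) ?n) => apply (circ_cont_pow s f n)
  | |- circ_cont ?s (fun t => t) => apply (circ_cont_id s)
  | |- circ_cont ?s (fun t => ?c) => apply (circ_cont_const s c)
  end).

Ltac nonneg := repeat (match goal with |- 0 <= _ * _ => apply Rmult_le_pos end); lra.

(** Since 1 / (t - z) = (t / z) / (t - z) - 1 / z, each vanishing moment allows one factor t / z to
    be inserted. This yields both the decay at infinity that orthogonality provides and the identity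
    theorem below. *)
Lemma cauchy_moments (s : R) (f : C -> C) (z : C) (N : nat) : 0 <= s -> Cmod z <> s -> z <> 0 ->
  circ_cont s f -> (forall k, (k < N)%nat -> circle_int s (fun t => f t * t ^ k)%C = 0) ->
  circle_int s (fun t => f t * / (t - z))%C
  = (/ z ^ N * circle_int s (fun t => f t * t ^ N * / (t - z)))%C.
Proof.
  intros Hs Hz Nz Hf. assert (K := circ_cont_kernel s z Hs Hz).
  assert (Cp : forall k, circ_cont s (fun t => f t * t ^ k)%C).
  { intros k. apply circ_cont_mult; auto. apply circ_cont_pow, circ_cont_id. }
  induction N as [|N IH]; intros HN.
  - transitivity (circle_int s (fun t => f t * t ^ 0 * / (t - z))%C).
    + apply circle_int_ext; auto. intros t _. simpl. ring.
    + simpl. field.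
  - rewrite IH by (intros; apply HN; lia).
    rewrite (circle_int_ext s (fun t => f t * t ^ N * / (t - z))%C
      (fun t => / z * (f t * t ^ S N * / (t - z)) - / z * (f t * t ^ N))%C); auto.
    + rewrite circle_int_minus, !circle_int_scal, (HN N); auto.
      * simpl. field. split; auto. apply Cpow_nz; auto.
      * circ.
      * circ.
      * circ.
    + intros t Ht. simpl. field. split; auto. apply kernel_neq_0. lra.
Qed.

(** An identity theorem without power series. The moments of [d] on |t| = a vanish, because the
    circle can be moved to |t| = 2, where [d] is 0. Hence the Cauchy integral over |t| = a is O((a /
    |z|)^N) for every N, so it is 0, and Cauchy's formula between the radii a and 2 leaves d z =
    0. *)
Lemma hol_exterior_unique (s : R) (d : C -> C) : 0 <= s ->
  hol (fun t => s < Cmod t) d -> (forall t, 1 < Cmod t -> d t = 0) ->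
  forall z, s < Cmod z -> d z = 0.
Proof.
  intros Hs Hd H0 z Hz. destruct (Rlt_dec 1 (Cmod z)) as [L|L]. auto.
  assert (P := PI_RGT_0).
  set (a := (s + Cmod z) / 2). assert (Ha : s < a < Cmod z) by (unfold a; lra).
  assert (Hann : hol (fun t => a <= Cmod t <= 2) d) by (apply (hol_sub _ _ _ Hd); intros; lra).
  assert (A := cauchy_annulus a 2 d z ltac:(lra) ltac:(lra) Hann).
  assert (Z2 : forall g, circle_int 2 (fun t => d t * g t)%C = 0).
  { intros g. rewrite (circle_int_ext 2 _ (fun t => 0 * 0)%C); try lra.
    rewrite circle_int_scal by apply circ_cont_const. ring.
    intros t Ht. rewrite H0 by lra. ring. }
  rewrite (Z2 (fun t => / (t - z))%C) in A.
  assert (Mk : forall k, circle_int a (fun t => d t * t ^ k)%C = 0).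
  { intros k. rewrite (annulus_hol a 2); try lra. apply (Z2 (fun t => t ^ k)%C).
    apply hol_mult; auto. apply hol_pow, hol_id. }
  assert (Ca : circ_cont a d).
  { apply (circ_cont_hol a _ d ltac:(lra) Hd). intros; lra. }
  destruct (circ_cont_bounded a d Ca) as [M [PM HM]].
  assert (Nz : z <> 0) by (apply Cmod_gt_0; lra).
  assert (I0 : circle_int a (fun t => d t * / (t - z))%C = 0).
  { apply (C_eq_of_small _ _ (2 * PI * (a * (M * / (Cmod z - a))))). intros eps He.
    assert (Hq : Rabs (a / Cmod z) < 1).
    { rewrite Rabs_pos_eq. apply Rlt_div_l; lra. apply Rlt_le, Rdiv_lt_0_compat; lra. }
    destruct (pow_lt_1_zero _ Hq eps He) as [N HN]. specialize (HN N (Nat.le_refl N)).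
    rewrite (cauchy_moments a d z N); auto; try lra.
    unfold Cminus. rewrite Copp_0, Cplus_0_r, Cmod_mult.
    rewrite Cmod_inv, Cmod_pow by (apply Cpow_nz; auto).
    assert (B := circle_int_bound a (M * a ^ N * / (Cmod z - a))
      (fun t => d t * t ^ N * / (t - z))%C ltac:(lra)).
    assert (pz : 0 < Cmod z ^ N) by (apply pow_lt; lra).
    assert (pa : 0 < a ^ N) by (apply pow_lt; lra).
    eapply Rle_trans.
    - apply Rmult_le_compat_l. left; apply Rinv_0_lt_compat; auto.
      apply B.
      + apply circ_cont_mult. apply circ_cont_mult; auto. apply circ_cont_pow, circ_cont_id.
        apply circ_cont_kernel; lra.
      + intros t Ht. rewrite !Cmod_mult, Cmod_pow, Ht.
        apply Rmult_le_compat; try apply Cmod_ge_0.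
        * apply Rmult_le_pos. apply Cmod_ge_0. lra.
        * apply Rmult_le_compat_r. lra. apply HM, Ht.
        * apply Cmod_kernel_le. lra. rewrite Ht. rewrite Rabs_left1; lra.
    - replace (/ Cmod z ^ N * (2 * PI * (a * (M * a ^ N * / (Cmod z - a)))))
        with (2 * PI * (a * (M * / (Cmod z - a))) * (a / Cmod z) ^ N).
      + apply Rmult_le_compat_l.
        * assert (0 < / (Cmod z - a)) by (apply Rinv_0_lt_compat; lra).
          nonneg.
        * left. eapply Rle_lt_trans; [apply Rle_abs|apply HN].
      + unfold Rdiv. rewrite Rpow_mult_distr, pow_inv. ring. }
  rewrite I0 in A.
  assert (N2 : (RtoC (2 * PI) * Ci)%C <> 0).
  { apply Cmult_neq_0. intros E; apply RtoC_inj in E; lra. apply Ci_nz. }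
  rewrite <- (Cmult_1_l (d z)), <- (Cinv_l _ N2), <- Cmult_assoc, <- A. ring.
Qed.

(** * Integrals of Cauchy type *)

(** The first-order remainder is exactly (y - z)^2 times the integral of h with the kernel 1 / ((t -
    z)^2 (t - y)), so a bound on this kernel replaces any interchange of limit and integral. *)
Lemma cauchy_integral_hol (s : R) (h : C -> C) : 0 <= s -> circ_cont s h ->
  hol (fun z => Cmod z <> s) (fun z => circle_int s (fun t => h t * / (t - z))%C).
Proof.
  intros Hs Hh z Hz. assert (P := PI_RGT_0).
  exists (circle_int s (fun t => h t * (/ (t - z) * / (t - z)))%C).
  apply Cder_eps. intros eps He.
  destruct (circ_cont_bounded s h Hh) as [M [PM HM]].
  set (d := Rabs (s - Cmod z)). assert (Pd : 0 < d) by (apply Rabs_pos_lt; lra).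
  set (B := 2 * PI * (s * (M * (/ d * / d * / (d / 2))))).
  assert (PB : 0 <= B).
  { unfold B. assert (0 < / d) by (apply Rinv_0_lt_compat; auto).
    assert (0 < / (d / 2)) by (apply Rinv_0_lt_compat; lra).
    nonneg. }
  (* The bound [d / 2] keeps [y] at distance at least [d / 2] from the circle, which is where [B]
     comes from; [B + 1] avoids dividing by 0. *)
  exists (Rmin (d / 2) (eps / (B + 1))). split.
  { apply Rmin_pos. lra. apply Rdiv_lt_0_compat; lra. }
  intros y Hy.
  assert (y1 := Rlt_le_trans _ _ _ Hy (Rmin_l _ _)).
  assert (y2 := Rlt_le_trans _ _ _ Hy (Rmin_r _ _)).
  assert (Dy : d / 2 <= Rabs (s - Cmod y)).
  { assert (T1 := Cmod_triangle_inv y z). assert (T2 := Cmod_triangle_inv z y).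
    rewrite Cmod_minus_sym in T2. unfold d in *.
    unfold Rabs in *. repeat destruct Rcase_abs in *; lra. }
  assert (Hy' : Cmod y <> s).
  { intros E. rewrite E, Rminus_diag, Rabs_R0 in Dy. lra. }
  assert (Kz := circ_cont_kernel s z Hs Hz). assert (Ky := circ_cont_kernel s y Hs Hy').
  rewrite <- circle_int_scal, <- !circle_int_minus by circ.
  - rewrite (circle_int_ext s _ (fun t => (y - z) * (y - z) *
      (h t * (/ (t - z) * / (t - z) * / (t - y))))%C); auto.
    + rewrite circle_int_scal, !Cmod_mult.
      * rewrite (Rmult_comm eps), Rmult_assoc. apply Rmult_le_compat_l. apply Cmod_ge_0.
        assert (C1 : Cmod (circle_int s (fun t => h t * (/ (t - z) * / (t - z) * / (t - y)))%C) <= B).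
        { apply circle_int_bound; auto.
          - circ.
          - intros t Ht. rewrite !Cmod_mult.
            repeat (apply Rmult_le_compat; try apply Cmod_ge_0;
              try (repeat apply Rmult_le_pos; apply Cmod_ge_0)).
            + apply HM, Ht.
            + apply Cmod_kernel_le; auto. rewrite Ht. unfold d. lra.
            + apply Cmod_kernel_le; auto. rewrite Ht. unfold d. lra.
            + apply Cmod_kernel_le. lra. rewrite Ht. auto. }
        apply Rle_trans with (eps / (B + 1) * B).
        { apply Rmult_le_compat; try apply Cmod_ge_0; lra. }
        { unfold Rdiv. rewrite Rmult_assoc. rewrite <- (Rmult_1_r eps) at 2.
          apply Rmult_le_compat_l. lra.
          rewrite Rmult_comm. apply Rle_div_l; lra. }
      * circ.
    + intros t Ht. field. split; apply kernel_neq_0; lra.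
Qed.

Lemma cauchy_integral_bound (s M : R) (h : C -> C) (z : C) : 0 <= s -> circ_cont s h ->
  (forall t, Cmod t = s -> Cmod (h t) <= M) -> Cmod z <> s ->
  Cmod (circle_int s (fun t => h t * / (t - z))%C) <= 2 * PI * (s * (M * / Rabs (s - Cmod z))).
Proof.
  intros Hs Hh HM Hz. apply circle_int_bound; auto.
  - apply circ_cont_mult; auto. apply circ_cont_kernel; auto.
  - intros t Ht. rewrite Cmod_mult. apply Rmult_le_compat; try apply Cmod_ge_0; auto.
    apply Cmod_kernel_le. apply Rabs_pos_lt. lra. rewrite Ht. lra.
Qed.

Lemma cauchy_integral_infinity (s : R) (h : C -> C) : 0 <= s -> circ_cont s h ->
  tends_at_infinity (fun z => circle_int s (fun t => h t * / (t - z))%C) 0.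
Proof.
  intros Hs Hh eps He. assert (P := PI_RGT_0).
  destruct (circ_cont_bounded s h Hh) as [M [PM HM]].
  set (B := 2 * PI * (s * M)).
  assert (PB : 0 <= B) by (unfold B; nonneg).
  assert (Pq : 0 <= B / eps) by (apply Rmult_le_pos; auto; left; apply Rinv_0_lt_compat; auto).
  exists (s + B / eps). intros z Hz.
  unfold Cminus. rewrite Copp_0, Cplus_0_r.
  eapply Rle_trans. apply (cauchy_integral_bound s M); auto. lra.
  replace (2 * PI * (s * (M * / Rabs (s - Cmod z)))) with (B / Rabs (s - Cmod z)) by (unfold B; field; apply Rabs_no_R0; lra).
  rewrite Rabs_left by lra. apply Rle_div_l. lra.
  apply Rle_trans with (eps * (B / eps)). right; field; lra. apply Rmult_le_compat_l; lra.
Qed.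

(** * The Szego functions *)

Lemma tends_const (c : C) : tends_at_infinity (fun _ => c) c.
Proof.
  intros eps He. exists 0. intros t _. replace (c - c)%C with (RtoC 0) by ring.
  rewrite Cmod_0. lra.
Qed.

Lemma tends_eq (f : C -> C) (L M : C) : tends_at_infinity f L -> L = M -> tends_at_infinity f M.
Proof. intros H <-. exact H. Qed.

Lemma tends_comp (F f : C -> C) (L : C) : Cct F L -> tends_at_infinity f L ->
  tends_at_infinity (fun z => F (f z)) (F L).
Proof.
  intros HF Hf eps He. destruct (proj1 (CC_C_eps F L) HF eps He) as [d [Hd H]].
  destruct (Hf (d / 2) ltac:(lra)) as [R0 H0]. exists R0. intros t Ht. left. apply H.
  specialize (H0 t Ht). lra.
Qed.

Lemma tends_mult (f g : C -> C) (L M : C) : tends_at_infinity f L -> tends_at_infinity g M ->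
  tends_at_infinity (fun z => f z * g z)%C (L * M)%C.
Proof.
  intros Hf Hg eps He.
  set (K := Cmod L + Cmod M + 1).
  assert (PL := Cmod_ge_0 L). assert (PM := Cmod_ge_0 M).
  set (e := Rmin 1 (eps / K)).
  assert (PK : 0 < K) by (unfold K; lra).
  assert (Pe : 0 < e) by (apply Rmin_pos; [lra | apply Rdiv_lt_0_compat; lra]).
  assert (e1 : e <= 1) by apply Rmin_l. assert (e2 : e <= eps / K) by apply Rmin_r.
  destruct (Hf e Pe) as [R1 H1]. destruct (Hg e Pe) as [R2 H2].
  exists (Rmax R1 R2). intros t Ht.
  specialize (H1 t (Rle_lt_trans _ _ _ (Rmax_l _ _) Ht)).
  specialize (H2 t (Rle_lt_trans _ _ _ (Rmax_r _ _) Ht)).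
  replace (f t * g t - L * M)%C with ((f t - L) * (g t - M) + L * (g t - M) + (f t - L) * M)%C by ring.
  eapply Rle_trans; [apply Cmod_triangle|].
  assert (T := Cmod_triangle ((f t - L) * (g t - M)) (L * (g t - M))).
  rewrite !Cmod_mult in *.
  assert (B1 : Cmod (f t - L) * Cmod (g t - M) <= 1 * e)
    by (apply Rmult_le_compat; try apply Cmod_ge_0; lra).
  assert (B2 : Cmod L * Cmod (g t - M) <= Cmod L * e) by (apply Rmult_le_compat_l; lra).
  assert (B3 : Cmod (f t - L) * Cmod M <= e * Cmod M) by (apply Rmult_le_compat_r; lra).
  assert (B4 : K * e <= eps).
  { apply Rle_trans with (K * (eps / K)). apply Rmult_le_compat_l; lra. right; field; lra. }
  unfold K in B4. lra.
Qed.

Lemma tends_plus (f g : C -> C) (L M : C) : tends_at_infinity f L -> tends_at_infinity g M ->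
  tends_at_infinity (fun z => f z + g z)%C (L + M)%C.
Proof.
  intros Hf Hg eps He.
  destruct (Hf (eps / 2) ltac:(lra)) as [R1 H1]. destruct (Hg (eps / 2) ltac:(lra)) as [R2 H2].
  exists (Rmax R1 R2). intros t Ht.
  specialize (H1 t (Rle_lt_trans _ _ _ (Rmax_l _ _) Ht)).
  specialize (H2 t (Rle_lt_trans _ _ _ (Rmax_r _ _) Ht)).
  replace (f t + g t - (L + M))%C with ((f t - L) + (g t - M))%C by ring.
  eapply Rle_trans; [apply Cmod_triangle|]. lra.
Qed.

Lemma tends_inv (f : C -> C) (L : C) : L <> 0 -> tends_at_infinity f L ->
  tends_at_infinity (fun z => / f z)%C (/ L)%C.
Proof. intros HL. apply (tends_comp Cinv). apply CC_inv; auto. apply CC_id. Qed.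

Lemma tends_inv_id : tends_at_infinity (fun z => / z)%C 0.
Proof.
  intros eps He. assert (P : 0 < / eps) by (apply Rinv_0_lt_compat; auto).
  exists (/ eps). intros t Ht. unfold Cminus. rewrite Copp_0, Cplus_0_r.
  rewrite Cmod_inv by (apply Cmod_gt_0; lra). rewrite <- (Rinv_inv eps).
  apply Rinv_le_contravar; lra.
Qed.

Lemma tends_ext (R0 : R) (f g : C -> C) (L : C) :
  (forall z, R0 < Cmod z -> f z = g z) -> tends_at_infinity f L -> tends_at_infinity g L.
Proof.
  intros E H eps He. destruct (H eps He) as [R1 H1]. exists (Rmax R0 R1). intros t Ht.
  rewrite <- E. apply H1. eapply Rle_lt_trans; [apply Rmax_r | apply Ht].
  eapply Rle_lt_trans; [apply Rmax_l | apply Ht].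
Qed.

Definition log_weight (w : C -> R) (t : C) : C := RtoC (ln (w t)).

Lemma weight_extension (w : C -> R) : analytic_weight w ->
  exists W : C -> C, (forall z, Cmod z = 1 -> Cct W z) /\
    (forall z, Cmod z = 1 -> W z = RtoC (w z)).
Proof.
  intros [_ [U [W [_ [HU [HW [_ E]]]]]]]. exists W. split; auto.
  intros z Hz. apply (hol_CC U). apply hol_iff, HW. apply HU, Hz.
Qed.

Lemma circ_cont_weight (w : C -> R) : analytic_weight w -> circ_cont 1 (fun t => RtoC (w t)).
Proof.
  intros H. destruct (weight_extension w H) as [W [HW E]].
  apply (circ_cont_ext 1 W). lra. auto. apply circ_cont_of; auto. lra.
Qed.

(** As [w] is constrained on the circle alone, continuity is relative to the circle; it is inherited
    from ln (Re W), which is continuous at [t0] in the plane. *)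
Lemma log_weight_eps (w : C -> R) (t0 : C) : analytic_weight w -> Cmod t0 = 1 ->
  forall eps, 0 < eps -> exists d, 0 < d /\ forall t, Cmod t = 1 -> Cmod (t - t0) < d ->
    Rabs (ln (w t) - ln (w t0)) < eps.
Proof.
  intros H Ht0 eps He. destruct (weight_extension w H) as [W [HW E]]. destruct H as [Hp _].
  assert (CL : Cct (fun z => RtoC (ln (Re (W z)))) t0).
  { apply (CC_RtoC (T := C_UniformSpace)).
    apply (continuous_comp (U := C_UniformSpace) (V := R_UniformSpace) (fun z => Re (W z)) ln).
    apply CC_Re, HW, Ht0.
    apply continuity_pt_filterlim, derivable_continuous_pt. exists (/ Re (W t0)).
    apply derivable_pt_lim_ln. rewrite E; auto. simpl. auto. }
  destruct (proj1 (CC_C_eps _ _) CL eps He) as [d [Hd H]]. exists d. split; auto.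
  intros t Ht D. specialize (H t D). rewrite !E in H; auto. simpl in H.
  rewrite <- RtoC_minus, Cmod_R in H. exact H.
Qed.

Lemma circ_cont_log_weight (w : C -> R) : analytic_weight w -> circ_cont 1 (log_weight w).
Proof.
  intros H t.
  apply (continuous_comp (U := R_UniformSpace) (V := R_UniformSpace)
     (fun u : R => ln (w (RtoC 1 * expi u)%C)) RtoC).
  2:{ apply (CC_RtoC (fun x : R => x)), continuous_id. }
  intros P [e He]. unfold filtermap.
  destruct (log_weight_eps w (RtoC 1 * expi t)%C H (Cmod_circle 1 t ltac:(lra)) e (cond_pos e))
    as [d [Hd Hlw]].
  assert (A : locally t (fun u : R => Cmod (RtoC 1 * expi u - RtoC 1 * expi t) < d)).
  { destruct (CC_R_eps _ _ (CC_circle 1 t) d Hd) as [d' [Hd' H']].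
    exists (mkposreal d' Hd'). intros y Hy. apply H', Hy. }
  revert A. apply filter_imp. intros u Hu. apply He. apply Hlw; auto. apply Cmod_circle. lra.
Qed.

(* [(e + z) / (e - z) = -1 + 2 e / (e - z)], so the Szego integral is a constant
   plus a Cauchy integral. *)
Lemma herglotz_integral (h : C -> C) (z : C) : circ_cont 1 h -> Cmod z <> 1 ->
  CRInt (fun t => h (expi t) * ((expi t + z) / (expi t - z)))%C 0 (2 * PI)
  = (- CRInt (fun t => h (expi t)) 0 (2 * PI)
     + 2 / Ci * circle_int 1 (fun t => h t * / (t - z)))%C.
Proof.
  intros Hh Hz. assert (K := circ_cont_kernel 1 z ltac:(lra) Hz).
  assert (E1 : forall t, (RtoC 1 * expi t)%C = expi t) by (intros; apply Cmult_1_l).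
  assert (Ch : forall t, CC (fun u : R => h (expi u)) t).
  { intros t. apply (continuous_ext (T := R_UniformSpace) (U := C_UniformSpace)
      (fun u : R => h (RtoC 1 * expi u)%C)). intros u; rewrite E1; auto. apply Hh. }
  unfold circle_int. rewrite <- CRInt_scal.
  2:{ apply (ex_circle 1 (fun t => h t * / (t - z))%C). circ. }
  assert (Eo : ex_CRInt (fun t => - (1) * h (expi t))%C 0 (2 * PI)).
  { apply ex_CRInt_scal, ex_CRInt_cont. intros; apply Ch. }
  replace (- CRInt (fun t => h (expi t)) 0 (2 * PI))%C
    with (CRInt (fun t => - (1) * h (expi t))%C 0 (2 * PI)).
  2:{ rewrite CRInt_scal. ring. apply ex_CRInt_cont. intros; apply Ch. }
  rewrite <- CRInt_plus; auto.
  - apply CRInt_ext. intros t _. rewrite E1. field. split; [|apply Ci_nz].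
    apply kernel_neq_0. rewrite Cmod_expi. auto.
  - apply ex_CRInt_scal. apply (ex_circle 1 (fun t => h t * / (t - z))%C). circ.
Qed.

(** The constant part of [herglotz_integral] exponentiates to [tau w] and the rest is a Cauchy
    integral. Holomorphy off the circle and the limit [tau w] at infinity can be read off this
    form. *)
Lemma szego_eq (w : C -> R) (z : C) : analytic_weight w -> Cmod z <> 1 ->
  szego w z = (RtoC (tau w) * Cexp (/ (RtoC (2 * PI) * Ci) *
     circle_int 1 (fun t => log_weight w t * / (t - z))))%C.
Proof.
  intros Hw Hz. assert (P := PI_RGT_0).
  assert (Hl := circ_cont_log_weight w Hw).
  transitivity (Cexp (RtoC (/ (4 * PI)) * (- CRInt (fun t => RtoC (ln (w (expi t)))) 0 (2 * PI)
     + 2 / Ci * circle_int 1 (fun t => log_weight w t * / (t - z)))))%C.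
  { unfold szego. f_equal. f_equal. exact (herglotz_integral (log_weight w) z Hl Hz). }
  unfold tau. rewrite <- Cexp_RtoC, <- Cexp_plus. f_equal.
  rewrite CRInt_RtoC.
  - rewrite RtoC_opp, RtoC_mult.
    replace (RtoC (/ (4 * PI))) with (/ RtoC 2 * / RtoC (2 * PI))%C.
    + field. repeat split; try apply Ci_nz; intros E; apply RtoC_inj in E; lra.
    + rewrite <- !RtoC_inv, <- RtoC_mult by lra. f_equal. field. lra.
  - apply (ex_RInt_ext (fun t => Re (log_weight w (RtoC 1 * expi t)%C))).
    { intros t _. unfold log_weight. simpl. rewrite Cmult_1_l. reflexivity. }
    apply (ex_RInt_continuous (V := R_CompleteNormedModule)). intros t _.
    apply (CC_Re (fun t : R => log_weight w (RtoC 1 * expi t)%C)), Hl.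
Qed.

Lemma szego_neq_0 (w : C -> R) (z : C) : szego w z <> 0.
Proof. apply Cexp_neq_0. Qed.

Lemma tau_pos (w : C -> R) : 0 < tau w.
Proof. apply exp_pos. Qed.

Lemma hol_Cexp (U : C -> Prop) (f : C -> C) : hol U f -> hol U (fun z => Cexp (f z)).
Proof.
  intros H z Hz. destruct (H z Hz). eexists. apply (Cder_comp Cexp f). apply Cder_Cexp. eassumption.
Qed.

Lemma Cmod_open (z : C) (P : R -> Prop) : open (T := R_UniformSpace) P -> P (Cmod z) ->
  exists d, 0 < d /\ forall y, Cmod (y - z) < d -> P (Cmod y).
Proof.
  intros HP Hz. destruct (HP _ Hz) as [e He]. exists e. split. apply cond_pos.
  intros y Hy. apply He. apply Rabs_lt_between'.
  assert (T1 := Cmod_triangle_inv y z). assert (T2 := Cmod_triangle_inv z y).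
  rewrite Cmod_minus_sym in T2. lra.
Qed.

Lemma szego_hol (w : C -> R) : analytic_weight w -> hol (fun z => Cmod z <> 1) (szego w).
Proof.
  intros Hw.
  apply (hol_ext_open _ (fun z => RtoC (tau w) * Cexp (/ (RtoC (2 * PI) * Ci) *
     circle_int 1 (fun t => log_weight w t * / (t - z))))%C).
  - intros z Hz. destruct (Cmod_open z (fun x => x <> 1)) as [d [Hd H]]; auto.
    + apply open_neq.
    + exists d. split; auto. intros y Hy. symmetry. apply szego_eq; auto.
  - apply hol_mult. apply hol_const. apply hol_Cexp. apply hol_mult. apply hol_const.
    apply cauchy_integral_hol. lra. apply circ_cont_log_weight, Hw.
Qed.

Lemma szego_infinity (w : C -> R) : analytic_weight w ->
  tends_at_infinity (szego w) (RtoC (tau w)).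
Proof.
  intros Hw.
  apply (tends_ext 1 (fun z => RtoC (tau w) * Cexp (/ (RtoC (2 * PI) * Ci) *
     circle_int 1 (fun t => log_weight w t * / (t - z))))%C).
  { intros z Hz. symmetry. apply szego_eq; auto. lra. }
  apply (tends_eq _ (RtoC (tau w) * Cexp (/ (RtoC (2 * PI) * Ci) * 0))%C).
  2:{ rewrite Cmult_0_r, Cexp_0. ring. }
  apply tends_mult. apply tends_const.
  apply (tends_comp Cexp). apply CC_Cexp, CC_id.
  apply tends_mult. apply tends_const.
  apply cauchy_integral_infinity. lra. apply circ_cont_log_weight, Hw.
Qed.

Lemma Cmod_reflect (z : C) : z <> 0 -> Cmod (/ Cconj z) = / Cmod z.
Proof.
  intros H. rewrite Cmod_inv, Cmod_conj; auto. intros E. apply H.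
  rewrite <- (Cconj_conj z), E. unfold Cconj; simpl. rewrite Ropp_0. reflexivity.
Qed.

Lemma Cconj_neq_0 (z : C) : z <> 0 -> Cconj z <> 0.
Proof. intros H. apply Cmod_gt_0. rewrite Cmod_conj. apply Cmod_gt_0, H. Qed.

(** For |e| = 1 the reflection z -> 1 / conj z turns the kernel (e + z) / (e - z) into minus its
    conjugate, and ln w is real. *)
Lemma szego_reflect (w : C -> R) (z : C) : analytic_weight w -> z <> 0 -> Cmod z <> 1 ->
  szego w (/ Cconj z) = (/ Cconj (szego w z))%C.
Proof.
  intros Hw Nz Hz. unfold szego.
  rewrite <- Cexp_conj, <- Cexp_opp. f_equal.
  assert (Ch : forall t, CC (fun u : R => log_weight w (expi u)) t).
  { intros t. apply (continuous_ext (T := R_UniformSpace) (U := C_UniformSpace)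
      (fun u : R => log_weight w (RtoC 1 * expi u)%C)).
    intros u; rewrite Cmult_1_l; auto. apply circ_cont_log_weight, Hw. }
  rewrite Cmult_conj.
  replace (Cconj (RtoC (/ (4 * PI)))) with (RtoC (/ (4 * PI)))
    by (unfold Cconj, RtoC; simpl; f_equal; ring).
  rewrite <- CRInt_conj.
  - transitivity (RtoC (/ (4 * PI)) * ((- (1)) * CRInt (fun t => Cconj (RtoC (ln (w (expi t))) *
      ((expi t + z) / (expi t - z)))) 0 (2 * PI)))%C; [|ring].
    f_equal. rewrite <- CRInt_scal.
    + apply CRInt_ext. intros t _.
      assert (N1 : (expi t - z)%C <> 0) by (apply kernel_neq_0; rewrite Cmod_expi; auto).
      assert (N2 : (expi t - / Cconj z)%C <> 0).
      { apply kernel_neq_0. rewrite Cmod_expi, Cmod_reflect; auto.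
        intros E. apply Hz. rewrite <- (Rinv_inv (Cmod z)), E. field. }
      rewrite Cmult_conj, Cdiv_conj, Cplus_conj, Cminus_conj, Cconj_expi by auto.
      replace (Cconj (RtoC (ln (w (expi t))))) with (RtoC (ln (w (expi t))))
        by (unfold Cconj, RtoC; simpl; f_equal; ring).
      assert (N3 := expi_neq_0 t). assert (N4 := Cconj_neq_0 z Nz).
      assert (N5 : (expi t * Cconj z - 1)%C <> 0).
      { intros E. apply N2. transitivity ((expi t * Cconj z - 1) / Cconj z)%C. field; auto.
        rewrite E. field; auto. }
      field. repeat split; auto.
      intros E; apply N5. rewrite <- (Copp_0), <- E. ring.
    + apply ex_CRInt_cont. intros t _. apply CC_conj, CC_mult. apply Ch.
      apply CC_div. apply CC_plus. apply CC_expi. apply CC_const.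
      apply CC_minus. apply CC_expi. apply CC_const.
      apply kernel_neq_0. rewrite Cmod_expi; auto.
  - apply ex_CRInt_cont. intros t _. apply CC_mult. apply Ch.
      apply CC_div. apply CC_plus. apply CC_expi. apply CC_const.
      apply CC_minus. apply CC_expi. apply CC_const.
      apply kernel_neq_0. rewrite Cmod_expi; auto.
Qed.

Lemma Cmod_sqr (z : C) : Cmod z * Cmod z = Re z * Re z + Im z * Im z.
Proof. assert (H := Cmod2_alt z). simpl in H. rewrite !Rmult_1_r in H. exact H. Qed.

Lemma Re_div (a b : C) : Re (a / b) = (Re a * Re b + Im a * Im b) / (Cmod b * Cmod b).
Proof.
  rewrite Cmod_sqr. destruct a as [a1 a2], b as [b1 b2]. simpl.
  rewrite !Rmult_1_r. unfold Rdiv. ring.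
Qed.

(** This is the Poisson kernel. It will be used for |z| > 1, where it is negative. *)
Lemma Re_herglotz_kernel (e z : C) : Cmod e = 1 ->
  Re ((e + z) / (e - z)) = (1 - Cmod z * Cmod z) / (Cmod (e - z) * Cmod (e - z)).
Proof.
  intros He. rewrite Re_div. f_equal.
  assert (E := Cmod_sqr e). rewrite He in E. rewrite (Cmod_sqr z).
  destruct e as [e1 e2], z as [z1 z2]. simpl in *. lra.
Qed.

(** With c = Re (e conj t0) <= 1, the difference of the two sides is (r - 1) (r + 1 - 2 c). *)
Lemma Cmod_radial_le (e t0 : C) (r : R) : Cmod e = 1 -> Cmod t0 = 1 -> 1 <= r ->
  Cmod (e - t0) * Cmod (e - t0) <= Cmod (e - RtoC r * t0) * Cmod (e - RtoC r * t0).
Proof.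
  intros He Ht Hr. assert (E1 := Cmod_sqr e). assert (E2 := Cmod_sqr t0).
  rewrite He in E1. rewrite Ht in E2. rewrite (Cmod_sqr (e - t0)), (Cmod_sqr (e - RtoC r * t0)).
  destruct e as [e1 e2], t0 as [x y]. simpl in *.
  assert (Cs : e1 * x + e2 * y <= 1).
  { assert (Q1 := Rle_0_sqr (e1 - x)). assert (Q2 := Rle_0_sqr (e2 - y)). unfold Rsqr in *. lra. }
  assert (N : 0 <= (r - 1) * (r + 1 - 2 * (e1 * x + e2 * y))) by (apply Rmult_le_pos; lra).
  assert (E3 : r * r * (x * x + y * y) = r * r) by (rewrite <- E2; ring).
  lra.
Qed.

(* Radial limit of the Poisson integral.  The bound
   [|g t - g t0| <= eps / 2 + K |t - t0|^2] holds on the whole circle, and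
   [|t - t0| <= |t - r t0|] cancels the denominator of the Poisson kernel, so the
   integral need not be split into a near and a far part. *)
Lemma szego_exponent_limit (w : C -> R) (t0 : C) : analytic_weight w -> Cmod t0 = 1 ->
  forall eps, 0 < eps -> exists d, 0 < d /\ forall r, 1 < r < 1 + d ->
    Rabs (Re (CRInt (fun t => RtoC (ln (w (expi t))) *
      ((expi t + RtoC r * t0) / (expi t - RtoC r * t0))) 0 (2 * PI))%C / (2 * PI)
      + ln (w t0)) <= eps.
Proof.
  intros Hw Ht0 eps He. assert (P := PI_RGT_0).
  destruct (log_weight_eps w t0 Hw Ht0 (eps / 2) ltac:(lra)) as [d0 [Hd0 Hlw]].
  destruct (circ_cont_bounded 1 _ (circ_cont_log_weight w Hw)) as [M [PM HM]].
  assert (HM' : forall t, Cmod t = 1 -> Rabs (ln (w t)) <= M).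
  { intros t Ht. rewrite <- Cmod_R. apply (HM t Ht). }
  (* Chosen so that K d0^2 = 2 M, the trivial bound for points at distance at least [d0] from
     [t0]. *)
  set (K := 2 * M / (d0 * d0)).
  assert (PK : 0 <= K).
  { unfold K. apply Rmult_le_pos. lra. left. apply Rinv_0_lt_compat. nra. }
  assert (Hq : forall t, Cmod t = 1 ->
    Rabs (ln (w t) - ln (w t0)) <= eps / 2 + K * (Cmod (t - t0) * Cmod (t - t0))).
  { intros t Ht. assert (Pt := Cmod_ge_0 (t - t0)).
    assert (0 <= K * (Cmod (t - t0) * Cmod (t - t0))) by (apply Rmult_le_pos; nra).
    destruct (Rlt_dec (Cmod (t - t0)) d0) as [L|L].
    - specialize (Hlw t Ht L). lra.
    - assert (T := Rabs_triang (ln (w t)) (- ln (w t0))). rewrite Rabs_Ropp in T.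
      assert (H1 := HM' t Ht). assert (H2 := HM' t0 Ht0).
      assert (K * (d0 * d0) <= K * (Cmod (t - t0) * Cmod (t - t0)))
        by (apply Rmult_le_compat_l; nra).
      replace (K * (d0 * d0)) with (2 * M) in * by (unfold K; field; lra).
      unfold Rminus. lra. }
  (* For r < 2 one has r^2 - 1 <= 3 (r - 1), so the second bound makes K (r^2 - 1) at most eps /
     2. *)
  exists (Rmin 1 (eps / (6 * (K + 1)))). split.
  { apply Rmin_pos. lra. apply Rdiv_lt_0_compat; lra. }
  intros r [Hr1 Hr2].
  assert (r1 : r < 2) by (generalize (Rmin_l 1 (eps / (6 * (K + 1)))); lra).
  assert (r2 : r - 1 < eps / (6 * (K + 1))) by (generalize (Rmin_r 1 (eps / (6 * (K + 1)))); lra).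
  set (z := (RtoC r * t0)%C).
  assert (Mz : Cmod z = r) by (unfold z; rewrite Cmod_mult, Ht0, Cmod_R, Rabs_pos_eq; lra).
  set (k := fun t => ((expi t + z) / (expi t - z))%C).
  assert (Ck : forall t, CC k t).
  { intros t. apply CC_div. apply CC_plus. apply CC_expi. apply CC_const.
    apply CC_minus. apply CC_expi. apply CC_const.
    apply kernel_neq_0. rewrite Cmod_expi. lra. }
  assert (Clw : forall t : R, CC (fun u : R => RtoC (ln (w (expi u)))) t).
  { intros t. apply (continuous_ext (T := R_UniformSpace) (U := C_UniformSpace)
      (fun u : R => log_weight w (RtoC 1 * expi u)%C)).
    intros u; rewrite Cmult_1_l; auto. apply circ_cont_log_weight, Hw. }
  (* Outside the disc the Herglotz kernel has mean -1 over the circle, so the exponent tends to - ln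
     w. *)
  assert (I1 : CRInt (fun t => 1 * k t)%C 0 (2 * PI) = RtoC (- (2 * PI))).
  { assert (E := herglotz_integral (fun _ => RtoC 1) z (circ_cont_const 1 1) ltac:(lra)).
    cbn beta in E. fold k in E. unfold k. rewrite E, CRInt_const.
    rewrite (circle_int_ext 1 _ (fun t => / (t - z))%C); [|lra|intros; ring].
    rewrite kernel_outside by lra. rewrite RtoC_opp. rewrite Rminus_0_r. ring. }
  assert (E1 : ex_CRInt (fun t => 1 * k t)%C 0 (2 * PI)).
  { apply ex_CRInt_cont. intros. apply CC_mult. apply CC_const. apply Ck. }
  assert (E2 : ex_CRInt (fun t => RtoC (ln (w (expi t))) * k t)%C 0 (2 * PI)).
  { apply ex_CRInt_cont. intros. apply CC_mult. apply Clw. apply Ck. }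
  set (X := CRInt (fun t => RtoC (ln (w (expi t))) * k t)%C 0 (2 * PI)).
  change (Rabs (Re X / (2 * PI) + ln (w t0)) <= eps).
  assert (IX : is_CRInt (fun t => RtoC (ln (w (expi t))) * k t - RtoC (ln (w t0)) * (1 * k t))%C
     0 (2 * PI) (X - RtoC (ln (w t0)) * RtoC (- (2 * PI)))%C).
  { apply is_CRInt_minus. apply CRInt_correct, E2. apply is_CRInt_scal.
    rewrite <- I1. apply CRInt_correct, E1. }
  apply is_CRInt_pair in IX. destruct IX as [IX _].
  assert (IP : is_RInt (fun t => (eps / 2) * (- Re (1 * k t)) + K * (r * r - 1)) 0 (2 * PI)
     (eps / 2 * (- - (2 * PI)) + (2 * PI - 0) * (K * (r * r - 1)))).
  { apply (is_RInt_plus (V := R_NormedModule)).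
    - apply (is_RInt_scal (V := R_NormedModule)). apply (is_RInt_opp (V := R_NormedModule)).
      assert (Q := CRInt_correct _ _ _ E1). rewrite I1 in Q. apply is_CRInt_pair in Q. apply Q.
    - apply (is_RInt_const (V := R_NormedModule)). }
  assert (B := fun H => norm_RInt_le (V := R_NormedModule) _ _ 0 (2 * PI) _ _ ltac:(lra) H IX IP).
  assert (B' : Rabs (Re (X - RtoC (ln (w t0)) * RtoC (- (2 * PI)))) <=
    eps / 2 * (- - (2 * PI)) + (2 * PI - 0) * (K * (r * r - 1))).
  { apply B. intros t _.
    replace (RtoC (ln (w (expi t))) * k t - RtoC (ln (w t0)) * (1 * k t))%C
      with (RtoC (ln (w (expi t)) - ln (w t0)) * k t)%C by (rewrite RtoC_minus; ring).
    rewrite Cmult_1_l, re_scal_l.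
    assert (Ek : Re (k t) = - ((r * r - 1) / (Cmod (expi t - z) * Cmod (expi t - z)))).
    { unfold k. rewrite Re_herglotz_kernel, Mz by apply Cmod_expi. unfold Rdiv. ring. }
    rewrite Ek, Ropp_involutive.
    assert (D := Cmod_radial_le (expi t) t0 r (Cmod_expi t) Ht0 ltac:(lra)). fold z in D.
    assert (Pz : 0 < Cmod (expi t - z)).
    { apply Cmod_gt_0, kernel_neq_0. rewrite Cmod_expi. lra. }
    set (Dz := Cmod (expi t - z) * Cmod (expi t - z)) in *.
    assert (PD : 0 < Dz) by (unfold Dz; nra).
    assert (Pr : 0 <= (r * r - 1) / Dz).
    { apply Rmult_le_pos. nra. left; apply Rinv_0_lt_compat; auto. }
    change (Rabs ((ln (w (expi t)) - ln (w t0)) * - ((r * r - 1) / Dz)) <=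
       eps / 2 * ((r * r - 1) / Dz) + K * (r * r - 1)).
    rewrite Rabs_mult, Rabs_Ropp, (Rabs_pos_eq ((r * r - 1) / Dz)) by auto.
    specialize (Hq (expi t) (Cmod_expi t)).
    eapply Rle_trans. apply Rmult_le_compat_r; [exact Pr | exact Hq].
    rewrite Rmult_plus_distr_r. apply Rplus_le_compat_l.
    rewrite Rmult_assoc. apply Rmult_le_compat_l; auto.
    apply Rle_trans with (Dz * ((r * r - 1) / Dz)).
    apply Rmult_le_compat_r; auto. right; field; lra. }
  rewrite <- RtoC_mult in B'.
  replace (Re (X - RtoC (ln (w t0) * - (2 * PI)))) with (Re X + 2 * PI * ln (w t0)) in B'
    by (simpl; ring).
  replace (Re X / (2 * PI) + ln (w t0)) with ((Re X + 2 * PI * ln (w t0)) / (2 * PI)) by (field; lra).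
  unfold Rdiv. rewrite Rabs_mult, (Rabs_pos_eq (/ (2 * PI))).
  2:{ left; apply Rinv_0_lt_compat; lra. }
  apply Rle_div_l. lra. eapply Rle_trans; [exact B'|].
  assert (K * (r * r - 1) <= eps / 2).
  { apply Rle_trans with ((K + 1) * (3 * (r - 1))).
    - apply Rmult_le_compat; nra.
    - apply Rle_trans with ((K + 1) * (3 * (eps / (6 * (K + 1))))).
      apply Rmult_le_compat_l; lra. right; field; lra. }
  nra.
Qed.

Lemma szego_Cmod_sqr (w : C -> R) (z : C) :
  Cmod (szego w z) ^ 2 = exp (Re (CRInt (fun t => RtoC (ln (w (expi t))) *
      ((expi t + z) / (expi t - z))) 0 (2 * PI))%C / (2 * PI)).
Proof.
  assert (P := PI_RGT_0). unfold szego. rewrite Cmod_Cexp, re_scal_l.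
  simpl. rewrite Rmult_1_r, <- exp_plus. f_equal. field. lra.
Qed.

(** Along the exterior ray through [t0], |f|^2 is the exponential of a Poisson integral with limit -
    ln (w t0), and [f] is continuous at [t0]. Only the modulus is found; this suffices because 1/Di
    is the reflection of De. *)
Lemma De_extension_boundary (w : C -> R) (s : R) (f : C -> C) (t0 : C) : analytic_weight w ->
  s < 1 -> De_extension w s f -> Cmod t0 = 1 -> Cmod (f t0) ^ 2 = exp (- ln (w t0)).
Proof.
  intros Hw Hs [Hf Ef] Ht0. apply hol_iff in Hf.
  assert (Cf : Cct f t0) by (apply (hol_CC _ _ _ Hf); lra).
  assert (Cf2 : Cct (fun z => RtoC (Cmod (f z) ^ 2)) t0).
  { apply (CC_RtoC (T := C_UniformSpace)).
    apply (continuous_ext (T := C_UniformSpace) (U := R_UniformSpace)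
      (fun z => Cmod (f z) * Cmod (f z))). { intros. simpl. rewrite Rmult_1_r. reflexivity. }
    apply (continuous_mult (K := R_AbsRing)); apply CC_Cmod, Cf. }
  apply RtoC_inj. apply (C_eq_of_small _ _ 2). intros eps He.
  destruct (proj1 (CC_C_eps _ _) Cf2 eps He) as [d1 [Hd1 H1]].
  assert (Ce : continuity_pt exp (- ln (w t0))) by (apply derivable_continuous_pt, derivable_pt_exp).
  destruct (Ce eps He) as [d2 [Hd2 H2]].
  destruct (szego_exponent_limit w t0 Hw Ht0 (d2 / 2) ltac:(lra)) as [d3 [Hd3 H3]].
  set (r := 1 + Rmin d1 d3 / 2).
  assert (Pm : 0 < Rmin d1 d3) by (apply Rmin_pos; auto).
  assert (m1 := Rmin_l d1 d3). assert (m2 := Rmin_r d1 d3).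
  specialize (H3 r ltac:(unfold r; lra)). specialize (H1 (RtoC r * t0)%C).
  assert (Mr : Cmod (RtoC r * t0) = r).
  { rewrite Cmod_mult, Ht0, Cmod_R, Rabs_pos_eq; unfold r; lra. }
  assert (D1 : Cmod (RtoC r * t0 - t0) < d1).
  { replace (RtoC r * t0 - t0)%C with (RtoC (r - 1) * t0)%C by (rewrite RtoC_minus; ring).
    rewrite Cmod_mult, Ht0, Cmod_R, Rabs_pos_eq; unfold r; lra. }
  specialize (H1 D1).
  rewrite Ef in H1 by (rewrite Mr; unfold r; lra).
  rewrite szego_Cmod_sqr in H1.
  match type of H3 with Rabs (?u + _) <= _ => set (x := u) in * end.
  assert (H4 : Rabs (exp x - exp (- ln (w t0))) < eps).
  { destruct (Req_dec x (- ln (w t0))) as [->|N].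
    - rewrite Rminus_diag, Rabs_R0. auto.
    - apply (H2 x). split. split. exact I. auto.
      simpl. unfold Rdist. replace (x - - ln (w t0)) with (x + ln (w t0)) by ring. lra. }
  rewrite <- RtoC_minus, Cmod_R in H1. rewrite <- RtoC_minus, Cmod_R.
  rewrite Rabs_minus_sym in H1.
  replace (Cmod (f t0) ^ 2 - exp (- ln (w t0))) with
    ((Cmod (f t0) ^ 2 - exp x) + (exp x - exp (- ln (w t0)))) by ring.
  eapply Rle_trans; [apply Rabs_triang|]. lra.
Qed.

Lemma De_extension_unique (w : C -> R) (s1 s2 : R) (f1 f2 : C -> C) (z : C) :
  0 < s1 -> 0 < s2 -> De_extension w s1 f1 -> De_extension w s2 f2 ->
  s1 < Cmod z -> s2 < Cmod z -> f1 z = f2 z.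
Proof.
  intros P1 P2 [H1 E1] [H2 E2] Z1 Z2. apply hol_iff in H1. apply hol_iff in H2.
  apply Ceq_minus. apply (hol_exterior_unique (Rmax s1 s2) (fun t => f1 t - f2 t)%C).
  - eapply Rle_trans; [|apply Rmax_l]. lra.
  - assert (M1 := Rmax_l s1 s2). assert (M2 := Rmax_r s1 s2).
    apply hol_minus; (eapply hol_sub; [eassumption|]); intros; simpl; lra.
  - intros t Ht. rewrite E1, E2 by auto. ring.
  - apply Rmax_lub_lt; auto.
Qed.

Lemma De_eq (w : C -> R) (s : R) (f : C -> C) (z : C) : 0 < s < 1 -> De_extension w s f ->
  s < Cmod z -> De w z = f z.
Proof.
  intros Hs Hf Hz. unfold De.
  apply (iota_unique (K := C_AbsRing) (V := C_CompleteNormedModule)).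
  - intros v [s' [f' [Hs' [Hz' [Hf' <-]]]]].
    apply (De_extension_unique w s' s); auto; lra.
  - exists s, f. auto.
Qed.

(** * Schwarz reflection in the unit circle *)

Lemma Cder_conj (f : C -> C) (z l : C) : Cder f (Cconj z) l ->
  Cder (fun y => Cconj (f (Cconj y))) z (Cconj l).
Proof.
  intros H. apply Cder_eps. intros eps He.
  destruct (proj1 (Cder_eps _ _ _) H eps He) as [d [Hd K]]. exists d. split; auto.
  intros y Hy. specialize (K (Cconj y)). rewrite <- Cminus_conj, Cmod_conj in K.
  specialize (K Hy). rewrite <- !Cminus_conj.
  rewrite <- (Cconj_conj (y - z)), <- Cmult_conj, <- Cminus_conj, !Cmod_conj.
  exact K.
Qed.

(** At 0 the formula gives no meaningful value, hence the separate treatment of that point for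
    [inv_Di]. *)
Definition reflect (f : C -> C) (z : C) : C := Cconj (f (/ Cconj z)%C).

Lemma reflect_reflect (f : C -> C) (z : C) : z <> 0 -> reflect (reflect f) z = f z.
Proof.
  intros Nz. unfold reflect. rewrite Cconj_conj. f_equal.
  assert (N := Cconj_neq_0 z Nz). rewrite Cinv_conj, Cconj_conj by auto. field. auto.
Qed.

Lemma hol_reflect (U V : C -> Prop) (f : C -> C) : hol V f ->
  (forall z, U z -> z <> 0 /\ V (/ Cconj z)%C) -> hol U (reflect f).
Proof.
  intros H K z Hz. destruct (K z Hz) as [Nz Vz]. destruct (H _ Vz) as [l Hl].
  eexists.
  apply (Cder_ext_loc (fun y => Cconj (f (Cconj (/ y))))%C).
  - exists (Cmod z). split. apply Cmod_gt_0, Nz. intros y Hy. unfold reflect.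
    rewrite Cinv_conj; auto. intros ->. unfold Cminus in Hy. rewrite Cplus_0_l, Cmod_opp in Hy. lra.
  - apply (Cder_comp (fun y => Cconj (f (Cconj y))) Cinv).
    + apply Cder_conj. rewrite Cinv_conj by auto. exact Hl.
    + apply Cder_inv, Nz.
Qed.

Lemma reflect_inv_Di_extension (w : C -> R) (s : R) (f : C -> C) : analytic_weight w ->
  1 < s -> inv_Di_extension w s f -> De_extension w (/ s) (reflect f).
Proof.
  intros Hw Hs [Hf Ef]. apply hol_iff in Hf.
  assert (Ps : 0 < / s) by (apply Rinv_0_lt_compat; lra). split.
  - apply hol_iff. apply (hol_reflect _ _ _ Hf). intros z Hz.
    assert (Nz : z <> 0) by (apply Cmod_gt_0; lra). split; auto.
    rewrite Cmod_reflect by auto. rewrite <- (Rinv_inv s). apply Rinv_lt_contravar; auto. nra.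
  - intros z Hz. assert (Nz : z <> 0) by (apply Cmod_gt_0; lra).
    assert (Z1 : Cmod z <> 1) by (intros E; lra).
    unfold reflect. rewrite Ef, szego_reflect; auto.
    + rewrite Cinv_conj, Cinv_conj, Cconj_conj.
      * field. apply szego_neq_0.
      * apply Cconj_neq_0, szego_neq_0.
      * rewrite <- Cinv_conj by apply szego_neq_0. apply Cconj_neq_0.
        intros E. apply C1_nz. rewrite <- (Cinv_r (szego w z)) by apply szego_neq_0. rewrite E. ring.
    + rewrite Cmod_reflect by auto. rewrite <- Rinv_1. apply Rinv_lt_contravar; lra.
Qed.

(** Reflection yields a holomorphic function in 0 < |z| < 1/s. It coincides with 1 / [szego] for 0 <
    |z| < 1, so the value 1 / [szego] at 0 removes the singularity. *)
Lemma inv_Di_extension_reflect (w : C -> R) (s : R) (f : C -> C) : analytic_weight w ->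
  0 < s < 1 -> De_extension w s f ->
  inv_Di_extension w (/ s) (fun z : C => if excluded_middle_informative (z = 0)
     then (/ szego w 0)%C else reflect f z).
Proof.
  intros Hw Hs [Hf Ef]. apply hol_iff in Hf.
  assert (Q : forall z : C, z <> 0 -> Cmod z < 1 -> reflect f z = (/ szego w z)%C).
  { intros z Nz Hz. assert (Z1 : Cmod z <> 1) by (intros E; lra).
    unfold reflect. rewrite Ef, szego_reflect; auto.
    - rewrite <- Cinv_conj, Cconj_conj; auto. apply szego_neq_0.
    - rewrite Cmod_reflect by auto. rewrite <- Rinv_1. apply Rinv_lt_contravar; try lra.
      apply Cmod_gt_0 in Nz. lra. }
  assert (E : forall z, Cmod z < 1 -> (if excluded_middle_informative (z = 0)
     then (/ szego w 0)%C else reflect f z) = (/ szego w z)%C).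
  { intros z Hz. destruct excluded_middle_informative as [->|N]; auto. }
  split; auto. apply hol_iff. intros z Hz.
  destruct (excluded_middle_informative (z = 0)) as [->|N].
  - assert (H : hol (fun z => Cmod z <> 1) (fun z => / szego w z)%C).
    { apply hol_inv. apply szego_hol, Hw. intros; apply szego_neq_0. }
    destruct (H 0) as [l Hl]. rewrite Cmod_0; lra. exists l.
    apply (Cder_ext_loc (fun z => / szego w z)%C); auto.
    exists 1. split. lra. intros y Hy. rewrite E; auto.
    replace (y - 0)%C with y in Hy by ring. auto.
  - assert (H : hol (fun z => z <> 0 /\ Cmod z < / s) (reflect f)).
    { apply (hol_reflect _ _ _ Hf). intros y [Ny Hy]. split; auto.
      rewrite Cmod_reflect by auto. rewrite <- (Rinv_inv s). apply Cmod_gt_0 in Ny.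
      apply Rinv_lt_contravar; auto. apply Rmult_lt_0_compat; auto. apply Rinv_0_lt_compat; lra. }
    destruct (H z (conj N Hz)) as [l Hl]. exists l.
    apply (Cder_ext_loc (reflect f)); auto.
    exists (Cmod z). split. apply Cmod_gt_0, N. intros y Hy.
    destruct excluded_middle_informative as [->|_]; auto.
    unfold Cminus in Hy. rewrite Cplus_0_l, Cmod_opp in Hy. lra.
Qed.

(** Away from 0, two candidate values are compared after reflection, where uniqueness of exterior
    extensions applies; no identity theorem for discs is required. *)
Lemma inv_Di_eq (w : C -> R) (s : R) (f : C -> C) (z : C) : analytic_weight w ->
  0 < s < 1 -> De_extension w s f -> Cmod z < / s ->
  inv_Di w z = if excluded_middle_informative (z = 0) then (/ szego w 0)%C else reflect f z.
Proof.
  intros Hw Hs Hf Hz. unfold inv_Di.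
  apply (iota_unique (K := C_AbsRing) (V := C_CompleteNormedModule)).
  - intros v [s' [f' [Hs' [Hz' [Hf' <-]]]]].
    destruct excluded_middle_informative as [->|N].
    + apply Hf'. rewrite Cmod_0. lra.
    + rewrite <- (reflect_reflect f') by auto. unfold reflect at 1 3. f_equal.
      assert (Pz : 0 < Cmod z) by (apply Cmod_gt_0, N).
      apply (De_extension_unique w (/ s') s); auto.
      * apply Rinv_0_lt_compat; lra.
      * lra.
      * apply reflect_inv_Di_extension; auto.
      * rewrite Cmod_reflect by auto. apply Rinv_lt_contravar; auto. nra.
      * rewrite Cmod_reflect by auto. rewrite <- (Rinv_inv s).
        apply Rinv_lt_contravar; auto. apply Rmult_lt_0_compat; auto. apply Rinv_0_lt_compat; lra.
  - exists (/ s), (fun z : C => if excluded_middle_informative (z = 0)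
     then (/ szego w 0)%C else reflect f z).
    split. { rewrite <- Rinv_1. apply Rinv_lt_contravar; lra. }
    split. exact Hz. split. apply inv_Di_extension_reflect; auto. reflexivity.
Qed.

Lemma rho_lt_extension (w : C -> R) (r : R) : Rbar_lt (rho w) (Finite r) ->
  exists s f, 0 < s < 1 /\ s < r /\ De_extension w s f.
Proof.
  intros H. apply NNPP. intros N.
  destruct (Glb_Rbar_correct (fun s => 0 < s < 1 /\ exists f : C -> C, De_extension w s f)) as [_ G].
  fold (rho w) in G. apply (Rbar_lt_not_le _ _ H). apply G.
  intros s [Hs [f Hf]]. simpl. apply Rnot_lt_le. intros L. apply N. exists s, f. auto.
Qed.

(** * The jump problem *)

(** Every angle has a box in polar coordinates on which [f] does not vanish, and compactness of
    [0, 2 PI] gives a common radial width. Only the inner side is treated: [De] is an exponential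
    outside, and [inv_Di] is handled by reflection. *)
Lemma nonzero_near_unit_circle (f : C -> C) :
  (forall z, Cmod z = 1 -> Cct f z) -> (forall z, Cmod z = 1 -> f z <> 0) ->
  exists a, 0 < a < 1 /\ forall z, a < Cmod z <= 1 -> f z <> 0.
Proof.
  intros Hc Hn.
  assert (D : forall th : R, exists d : posreal, forall u rr, Rabs (u - th) < d ->
     Rabs (rr - 1) < d -> f (RtoC rr * expi u)%C <> 0).
  { intros th. assert (M1 := Cmod_expi th).
    assert (P0 : 0 < Cmod (f (expi th))) by (apply Cmod_gt_0, Hn, M1).
    destruct (proj1 (CC_C_eps _ _) (Hc _ M1) _ P0) as [d1 [Hd1 H1]].
    destruct (CC_R_eps _ _ (CC_expi th) (d1 / 2) ltac:(lra)) as [d2 [Hd2 H2]].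
    assert (Pm : 0 < Rmin d2 (d1 / 2)) by (apply Rmin_pos; lra).
    exists (mkposreal _ Pm). simpl. intros u rr Hu Hr E.
    assert (m1 := Rmin_l d2 (d1 / 2)). assert (m2 := Rmin_r d2 (d1 / 2)).
    specialize (H2 u ltac:(lra)). specialize (H1 (RtoC rr * expi u)%C).
    assert (L : Cmod (RtoC rr * expi u - expi th) < d1).
    2:{ specialize (H1 L). rewrite E in H1. unfold Cminus in H1.
        rewrite Cplus_0_l, Cmod_opp in H1. lra. }
    replace (RtoC rr * expi u - expi th)%C with (RtoC (rr - 1) * expi u + (expi u - expi th))%C
      by (rewrite RtoC_minus; ring).
    eapply Rle_lt_trans; [apply Cmod_triangle|].
    rewrite Cmod_mult, Cmod_expi, Cmod_R. lra. }
  destruct (choice _ D) as [delta Hdelta].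
  destruct (compactness_value_1d 0 (2 * PI) delta) as [d Hd].
  assert (Pd := cond_pos d).
  exists (Rmax (1 / 2) (1 - d)). split.
  { split. eapply Rlt_le_trans; [|apply Rmax_l]. lra. apply Rmax_lub_lt; lra. }
  intros z [Hz1 Hz2] E. destruct (polar z) as [u [Hu Eu]].
  apply (Hd u Hu). intros [th [Hth [H1 H2]]].
  apply (Hdelta th u (Cmod z)); auto.
  - assert (m := Rmax_r (1 / 2) (1 - d)). apply Rabs_lt_between'. lra.
  - rewrite <- Eu. exact E.
Qed.

(** By [cauchy_moments] the factor z^n is absorbed into the integrand, and a Cauchy integral
    vanishes at infinity. This is where orthogonality becomes a condition at infinity. *)
Lemma moments_decay (b : R) (G : C -> C) (n : nat) : 0 < b -> circ_cont b G ->
  (forall k, (k < n)%nat -> circle_int b (fun t => G t * t ^ k)%C = 0) ->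
  tends_at_infinity (fun z => z ^ n * circle_int b (fun t => G t * / (t - z)))%C 0.
Proof.
  intros Hb HG H.
  apply (tends_ext b (fun z => circle_int b (fun t => G t * t ^ n * / (t - z))%C)).
  - intros z Hz. assert (Nz : z <> 0) by (apply Cmod_gt_0; lra).
    rewrite (cauchy_moments b G z n); auto; try lra.
    field. apply Cpow_nz, Nz.
  - apply (cauchy_integral_infinity b (fun t => G t * t ^ n)%C). lra. circ.
Qed.

(* [Cp - Cm = Phi / (z ^ n * Ds * Iv)] is the additive Laurent splitting of the
   density [Phi * w / z ^ n]; [E = Cp * Iv] and [I = z ^ n * Ds * Cm] solve the
   scalar jump problem on the unit circle, and this jump lets each of them be
   continued across it. *)
Lemma jump_solution (s a : R) (n : nat) (Ds Iv Phi : C -> C) (wt : C -> C) :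
  0 < s -> s <= a -> a < 1 ->
  hol (fun z => s < Cmod z) Ds -> hol (fun z => Cmod z < / s) Iv ->
  (forall z, a < Cmod z -> Ds z <> 0) -> (forall z, Cmod z < / a -> Iv z <> 0) ->
  (forall t, Cmod t = 1 -> (Ds t * Iv t * wt t)%C = 1) ->
  hol (fun _ => True) Phi ->
  (forall k, (k < n)%nat -> circle_int 1 (fun t => Phi t * wt t * / t ^ n * t ^ k)%C = 0) ->
  (exists L, tends_at_infinity Ds L) ->
  exists E I : C -> C,
    hol (fun z => Cmod z < / s) E /\ hol (fun z => s < Cmod z) I /\
    tends_at_infinity I 0 /\
    forall z, s < Cmod z < / s -> Phi z = (z ^ n * Ds z * E z - I z * Iv z)%C.
Proof.
  intros Ps Hsa Ha HD HI ND NI Hw HP Hm [L HL].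
  assert (P := PI_RGT_0).
  (* The circles of radii b and 1/b lie on either side of the unit circle, inside the annulus a <
     |t| < 1/a where the density [G] is holomorphic. *)
  set (b := (a + 1) / 2). assert (Hb : a < b < 1) by (unfold b; lra).
  assert (Ib : 1 < / b < / a).
  { rewrite <- Rinv_1 at 1. split; apply Rinv_lt_contravar; nra. }
  assert (Is : / a <= / s) by (apply Rinv_le_contravar; lra).
  set (G := fun t => (Phi t * / t ^ n * / (Ds t * Iv t))%C).
  set (A := fun t : C => a < Cmod t < / a).
  assert (N0 : forall z, a < Cmod z -> z <> 0) by (intros z Hz; apply Cmod_gt_0; lra).
  assert (HDa : hol A Ds) by (apply (hol_sub _ _ _ HD); unfold A; intros; lra).
  assert (HIa : hol A Iv) by (apply (hol_sub _ _ _ HI); unfold A; intros; lra).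
  assert (HPU : forall U, hol U Phi) by (intros U; apply (hol_sub _ _ _ HP); auto).
  assert (HG : hol A G).
  { apply hol_mult. apply hol_mult. apply HPU. apply hol_inv. apply hol_pow, hol_id.
    intros z Hz. apply Cpow_nz, N0, Hz. apply hol_inv. apply hol_mult; auto.
    intros z [Hz1 Hz2]. apply Cmult_neq_0; auto. }
  set (K := (/ (RtoC (2 * PI) * Ci))%C).
  assert (NK : (RtoC (2 * PI) * Ci)%C <> 0).
  { apply Cmult_neq_0. intros E; apply RtoC_inj in E; lra. apply Ci_nz. }
  assert (CGb : circ_cont b G) by (apply (circ_cont_hol b A); auto; unfold A; intros; lra).
  assert (CGb' : circ_cont (/ b) G) by (apply (circ_cont_hol (/ b) A); auto; unfold A; intros; lra).
  set (Cp := fun z => (K * circle_int (/ b) (fun t => G t * / (t - z)))%C).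
  set (Cm := fun z => (K * circle_int b (fun t => G t * / (t - z)))%C).
  assert (HCp : hol (fun z => Cmod z < / b) Cp).
  { apply hol_mult. apply hol_const. eapply hol_sub. apply cauchy_integral_hol; auto; lra.
    simpl. intros; lra. }
  assert (HCm : hol (fun z => b < Cmod z) Cm).
  { apply hol_mult. apply hol_const. eapply hol_sub. apply cauchy_integral_hol; auto; lra.
    simpl. intros; lra. }
  assert (J : forall z, b < Cmod z < / b -> (Cp z - Cm z)%C = G z).
  { intros z Hz. unfold Cp, Cm.
    assert (Q := cauchy_annulus b (/ b) G z ltac:(lra) ltac:(lra)
      (hol_sub _ _ _ HG (fun t Ht => conj (Rlt_le_trans _ _ _ (proj1 Hb) (proj1 Ht))
          (Rle_lt_trans _ _ _ (proj2 Ht) (proj2 Ib))))).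
    transitivity (K * (RtoC (2 * PI) * Ci * G z))%C. rewrite <- Q. ring.
    unfold K. rewrite Cmult_assoc, Cinv_l by exact NK. ring. }
  (* The moments are given on the unit circle, where 1 / (Ds Iv) is the weight; holomorphy of [G]
     moves them to radius b. *)
  assert (Hk : forall k, (k < n)%nat -> circle_int b (fun t => G t * t ^ k)%C = 0).
  { intros k Hk. rewrite (annulus_hol b 1); try lra.
    - rewrite <- (Hm k Hk). apply circle_int_ext. lra. intros t Ht.
      unfold G. f_equal.
      assert (E : (/ (Ds t * Iv t))%C = wt t).
      { rewrite <- (Cmult_1_r (/ (Ds t * Iv t))), <- (Hw t Ht). field.
        split. apply NI; lra. apply ND; lra. }
      rewrite E. ring.
    - apply hol_mult; [|apply hol_pow, hol_id].
      apply (hol_sub _ _ _ HG). unfold A. intros; lra. }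
  (* The two branches of each function agree on b < |z| < 1/b by the jump [J], so the cut at |z| = 1
     is arbitrary. The branch with [Phi] continues the function beyond that annulus: for [E]
     outwards, dividing by [Ds], and for [I] inwards, dividing by [Iv]. Each divisor is free of
     zeros on the side concerned, while the other factor may vanish there. *)
  set (E := fun z => if Rlt_dec (Cmod z) 1 then (Cp z * Iv z)%C
     else (Cm z * Iv z + Phi z * / z ^ n * / Ds z)%C).
  set (I := fun z => if Rlt_dec 1 (Cmod z) then (z ^ n * Ds z * Cm z)%C
     else (z ^ n * Ds z * Cp z - Phi z * / Iv z)%C).
  assert (E1 : forall z, Cmod z < / b -> E z = (Cp z * Iv z)%C).
  { intros z Hz. unfold E. destruct Rlt_dec as [_|N]; auto.
    replace (Cp z) with (Cm z + G z)%C by (rewrite <- J by lra; ring).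
    unfold G. field; repeat split; first [apply NI; lra | apply ND; lra | apply Cpow_nz, N0; lra]. }
  assert (E2 : forall z, b < Cmod z -> Cmod z < / s ->
    E z = (Cm z * Iv z + Phi z * / z ^ n * / Ds z)%C).
  { intros z Hz _. unfold E. destruct Rlt_dec as [N|_]; auto.
    replace (Cp z) with (Cm z + G z)%C by (rewrite <- J by lra; ring).
    unfold G. field; repeat split; first [apply NI; lra | apply ND; lra | apply Cpow_nz, N0; lra]. }
  assert (I1 : forall z, b < Cmod z -> I z = (z ^ n * Ds z * Cm z)%C).
  { intros z Hz. unfold I. destruct Rlt_dec as [_|N]; auto.
    replace (Cp z) with (Cm z + G z)%C by (rewrite <- J by lra; ring).
    unfold G. field; repeat split; first [apply NI; lra | apply ND; lra | apply Cpow_nz, N0; lra]. }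
  assert (I2 : forall z, s < Cmod z < / b -> I z = (z ^ n * Ds z * Cp z - Phi z * / Iv z)%C).
  { intros z Hz. unfold I. destruct Rlt_dec as [N|_]; auto.
    replace (Cp z) with (Cm z + G z)%C by (rewrite <- J by lra; ring).
    unfold G. field; repeat split; first [apply NI; lra | apply ND; lra | apply Cpow_nz, N0; lra]. }
  exists E, I. repeat split.
  - intros z Hz. destruct (Rlt_dec (Cmod z) 1) as [L1|L1].
    + destruct (Cmod_open z (fun x => x < / b) (open_lt (/ b)) ltac:(lra)) as [d [Hd Hd']].
      refine (hol_ext_open (fun y => y = z) (fun z => Cp z * Iv z)%C E _ _ z eq_refl).
      * intros y ->. exists d. split; auto. intros y Hy. symmetry. apply E1, Hd', Hy.
      * intros y ->. apply (hol_mult (fun z => Cmod z < / b)); auto; [|lra].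
        apply (hol_sub _ _ _ HI); intros; lra.
    + destruct (Cmod_open z (fun x => b < x) (open_gt b) ltac:(lra)) as [d [Hd Hd']].
      destruct (Cmod_open z (fun x => x < / s) (open_lt (/ s)) ltac:(lra)) as [d2 [Hd2 Hd2']].
      refine (hol_ext_open (fun y => y = z) (fun z => Cm z * Iv z + Phi z * / z ^ n * / Ds z)%C
         E _ _ z eq_refl).
      * intros y ->. exists (Rmin d d2). split. apply Rmin_pos; auto. intros y Hy. symmetry.
        apply E2. apply Hd'. eapply Rlt_le_trans; [exact Hy|apply Rmin_l].
        apply Hd2'. eapply Rlt_le_trans; [exact Hy|apply Rmin_r].
      * intros y ->. refine (hol_plus (fun z => b < Cmod z < / s) _ _ _ _ z _).
        -- apply hol_mult. apply (hol_sub _ _ _ HCm); intros; lra.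
           apply (hol_sub _ _ _ HI); intros; lra.
        -- apply hol_mult. apply hol_mult. apply HPU. apply hol_inv. apply hol_pow, hol_id.
           intros; apply Cpow_nz, N0; lra.
           apply hol_inv. apply (hol_sub _ _ _ HD); intros; lra. intros; apply ND; lra.
        -- lra.
  - intros z Hz. destruct (Rlt_dec 1 (Cmod z)) as [L1|L1].
    + destruct (Cmod_open z (fun x => b < x) (open_gt b) ltac:(lra)) as [d [Hd Hd']].
      refine (hol_ext_open (fun y => y = z) (fun z => z ^ n * Ds z * Cm z)%C I _ _ z eq_refl).
      * intros y ->. exists d. split; auto. intros y Hy. symmetry. apply I1, Hd', Hy.
      * intros y ->. refine (hol_mult (fun z => b < Cmod z) _ _ _ HCm z _); [|lra].
        apply hol_mult. apply hol_pow, hol_id. apply (hol_sub _ _ _ HD); intros; lra.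
    + destruct (Cmod_open z (fun x => s < x) (open_gt s) ltac:(lra)) as [d [Hd Hd']].
      destruct (Cmod_open z (fun x => x < / b) (open_lt (/ b)) ltac:(lra)) as [d2 [Hd2 Hd2']].
      refine (hol_ext_open (fun y => y = z) (fun z => z ^ n * Ds z * Cp z - Phi z * / Iv z)%C
         I _ _ z eq_refl).
      * intros y ->. exists (Rmin d d2). split. apply Rmin_pos; auto. intros y Hy. symmetry.
        apply I2. split. apply Hd'. eapply Rlt_le_trans; [exact Hy|apply Rmin_l].
        apply Hd2'. eapply Rlt_le_trans; [exact Hy|apply Rmin_r].
      * intros y ->. refine (hol_minus (fun z => s < Cmod z < / b) _ _ _ _ z _).
        -- apply hol_mult. apply hol_mult. apply hol_pow, hol_id.
           apply (hol_sub _ _ _ HD); intros; lra. apply (hol_sub _ _ _ HCp); intros; lra.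
        -- apply hol_mult. apply HPU. apply hol_inv. apply (hol_sub _ _ _ HI); intros; lra.
           intros; apply NI; lra.
        -- lra.
  - apply (tends_ext b (fun z => Ds z * (K * (z ^ n * circle_int b (fun t => G t * / (t - z)))))%C).
    + intros z Hz. rewrite I1 by auto. unfold Cm. ring.
    + apply (tends_eq _ (L * (K * 0))%C); [|ring].
      apply tends_mult; auto. apply tends_mult. apply tends_const. apply moments_decay; auto. lra.
  - intros z Hz. destruct (Rlt_dec 1 (Cmod z)) as [L1|L1].
    + rewrite E2, I1 by lra. field; repeat split; first [apply NI; lra | apply ND; lra | apply Cpow_nz, N0; lra].
    + rewrite E1, I2 by lra. field. apply NI; lra.
Qed.

(** * The integral equations and their iteration *)

Lemma two_PI_Ci_neq_0 : (RtoC (2 * PI) * Ci)%C <> 0.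
Proof.
  assert (P := PI_RGT_0).
  apply Cmult_neq_0. intros E; apply RtoC_inj in E; lra. apply Ci_nz.
Qed.

(** On |t| = r the density of the first integral is a constant multiple of I + Phi / Iv. The first
    summand is holomorphic outside and vanishes at infinity, the second is holomorphic inside, so
    one integral produces both branches of [It]. On |t| = 1/r the density is a multiple of tau E
    minus the exterior branch of [Et]. *)
Lemma integral_equations (s r : R) (n : nat) (Ds Iv Phi E I : C -> C) (tau : R) :
  0 < s -> s < r -> r < 1 -> 0 < tau ->
  hol (fun z => s < Cmod z) Ds -> hol (fun z => Cmod z < / s) Iv ->
  (forall z, 1 < Cmod z -> Ds z <> 0) -> (forall z, Cmod z < 1 -> Iv z <> 0) ->
  hol (fun _ => True) Phi ->
  tends_at_infinity (fun z => Phi z * / z ^ n)%C 1 -> tends_at_infinity Ds (RtoC tau) ->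
  hol (fun z => Cmod z < / s) E -> hol (fun z => s < Cmod z) I -> tends_at_infinity I 0 ->
  (forall z, s < Cmod z < / s -> Phi z = (z ^ n * Ds z * E z - I z * Iv z)%C) ->
  let Et := fun z => if Rlt_dec (Cmod z) (/ r) then (RtoC tau * E z)%C
     else (RtoC tau * (Phi z * / z ^ n) * / Ds z)%C in
  let It := fun z => if Rlt_dec r (Cmod z) then (/ RtoC tau * I z)%C
     else (- (/ RtoC tau * (Phi z * / Iv z)))%C in
  (forall z, Cmod z <> r -> It z = circle_int r (fun t => Et t *
     (- / (RtoC (2 * PI) * Ci * RtoC (tau ^ 2)) * (Ds t * / Iv t * t ^ n)) * / (t - z))%C) /\
  (forall z, Cmod z <> / r -> Et z = (1 + circle_int (/ r) (fun t => It t *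
     (RtoC (tau ^ 2) / (RtoC (2 * PI) * Ci) * (Iv t * / Ds t * / t ^ n)) * / (t - z)))%C).
Proof.
  intros Ps Hsr Hr Pt HD HI ND NI HP LP LD HE HIm LI HF Et It.
  assert (Hr1 : 1 < / r) by (rewrite <- Rinv_1 at 1; apply Rinv_lt_contravar; lra).
  assert (Hrs : / r < / s) by (apply Rinv_lt_contravar; nra).
  assert (NK := two_PI_Ci_neq_0). set (K := (RtoC (2 * PI) * Ci)%C) in *.
  assert (Nt : RtoC tau <> 0) by (intros Q; apply RtoC_inj in Q; lra).
  rewrite RtoC_pow.
  assert (HPU : forall U, hol U Phi) by (intros U; apply (hol_sub _ _ _ HP); auto).
  assert (HPI : hol (fun z => Cmod z <= r) (fun t => Phi t * / Iv t)%C).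
  { apply hol_mult. apply HPU. apply hol_inv. apply (hol_sub _ _ _ HI); intros; lra.
    intros; apply NI; lra. }
  assert (HIr : hol (fun z => r <= Cmod z) I) by (apply (hol_sub _ _ _ HIm); intros; lra).
  assert (HEr : hol (fun z => Cmod z <= / r) E) by (apply (hol_sub _ _ _ HE); intros; lra).
  (* This is the exterior branch of [Et]; its limit 1 at infinity is the source of the inhomogeneous
     term 1. *)
  set (g := fun t => (RtoC tau * (Phi t * / t ^ n) * / Ds t)%C).
  assert (Hg : hol (fun z => / r <= Cmod z) g).
  { apply hol_mult. apply hol_mult. apply hol_const. apply hol_mult. apply HPU.
    apply hol_inv. apply hol_pow, hol_id. intros z Hz. apply Cpow_nz, Cmod_gt_0. lra.
    apply hol_inv. apply (hol_sub _ _ _ HD); intros; lra. intros; apply ND; lra. }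
  assert (Lg : tends_at_infinity g 1).
  { apply (tends_eq _ (RtoC tau * 1 * / RtoC tau)%C); [|field; auto].
    apply tends_mult. apply tends_mult. apply tends_const. exact LP. apply tends_inv; auto. }
  split; intros z Hz.
  - assert (Kz := circ_cont_kernel r z ltac:(lra) Hz).
    assert (C1 : circ_cont r I) by (apply (circ_cont_hol r _ I ltac:(lra) HIr); intros; lra).
    assert (C2 : circ_cont r (fun t => Phi t * / Iv t)%C)
      by (apply (circ_cont_hol r _ _ ltac:(lra) HPI); intros; lra).
    transitivity (- / (K * RtoC tau) * (circle_int r (fun t => I t * / (t - z)) +
       circle_int r (fun t => (Phi t * / Iv t) * / (t - z))))%C.
    + unfold It. destruct Rlt_dec as [L|L].
      * rewrite (cauchy_exterior_outside r I 0 z) by (auto; lra).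
        rewrite (cauchy_zero r (fun t => (Phi t * / Iv t) * / (t - z))%C); try lra.
        fold K. field. auto.
        apply hol_mult; auto. apply hol_kernel. intros t Ht ->. lra.
      * rewrite (cauchy_exterior_inside r I 0 z) by (auto; lra).
        rewrite (cauchy_disc r (fun t => Phi t * / Iv t)%C z) by (auto; lra).
        fold K. field. repeat split; auto. apply NI. lra.
    + rewrite <- circle_int_plus, <- circle_int_scal by circ.
      apply circle_int_ext. lra. intros t Ht. unfold Et.
      destruct Rlt_dec as [_|L]; [|lra].
      assert (N1 : Iv t <> 0) by (apply NI; lra).
      assert (N2 : (t - z)%C <> 0) by (apply kernel_neq_0; lra).
      rewrite HF by lra. field. auto.
  - assert (Kz := circ_cont_kernel (/ r) z ltac:(lra) Hz).
    assert (C1 : circ_cont (/ r) E) by (apply (circ_cont_hol (/ r) _ E ltac:(lra) HEr); intros; lra).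
    assert (C2 : circ_cont (/ r) g) by (apply (circ_cont_hol (/ r) _ g ltac:(lra) Hg); intros; lra).
    transitivity (1 + / K * (RtoC tau * circle_int (/ r) (fun t => E t * / (t - z)) -
       circle_int (/ r) (fun t => g t * / (t - z))))%C.
    + unfold Et. destruct Rlt_dec as [L|L].
      * rewrite (cauchy_disc (/ r) E z) by (auto; lra).
        rewrite (cauchy_exterior_inside (/ r) g 1 z) by (auto; lra).
        fold K. field. auto.
      * rewrite (cauchy_exterior_outside (/ r) g 1 z) by (auto; lra).
        rewrite (cauchy_zero (/ r) (fun t => E t * / (t - z))%C); try lra.
        fold K. fold (g z). field. auto.
        apply hol_mult; auto. apply hol_kernel. intros t Ht ->. lra.
    + f_equal. rewrite <- circle_int_scal, <- circle_int_minus, <- circle_int_scal by circ.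
      apply circle_int_ext. lra. intros t Ht. unfold It.
      destruct Rlt_dec as [_|L]; [|lra]. unfold g.
      assert (N1 : Ds t <> 0) by (apply ND; lra).
      assert (N2 : (t - z)%C <> 0) by (apply kernel_neq_0; lra).
      assert (N3 : (t ^ n)%C <> 0) by (apply Cpow_nz, Cmod_gt_0; lra).
      rewrite HF by lra. field. auto.
Qed.

Lemma is_series_geometric (a : nat -> C) (l : C) (B q : R) : 0 <= q < 1 ->
  (forall k, Cmod (l - sum_n (G := C_AbelianMonoid) a k) <= B * q ^ k) ->
  CSeries a = l.
Proof.
  intros Hq H. unfold CSeries, is_series.
  apply (iota_filterlim_locally (K := C_AbsRing) (V := C_CompleteNormedModule)).
  intros P HP. apply (locally_Cmod l P) in HP. destruct HP as [d [Hd HP]].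
  assert (PB : 0 <= B).
  { specialize (H O). assert (Q := Cmod_ge_0 (l - sum_n (G := C_AbelianMonoid) a 0)). simpl in H. lra. }
  assert (Hq' : Rabs q < 1) by (rewrite Rabs_pos_eq; lra).
  destruct (pow_lt_1_zero q Hq' (d / (B + 1))) as [N HN].
  { apply Rdiv_lt_0_compat; lra. }
  exists N. intros k Hk. apply HP. rewrite Cmod_minus_sym.
  eapply Rle_lt_trans; [apply H|].
  specialize (HN k Hk). rewrite Rabs_pos_eq in HN by (apply pow_le; lra).
  apply Rle_lt_trans with ((B + 1) * q ^ k).
  - apply Rmult_le_compat_r. apply pow_le; lra. lra.
  - apply Rlt_le_trans with ((B + 1) * (d / (B + 1))).
    apply Rmult_lt_compat_l; lra. right; field; lra.
Qed.

(** * Neumann series of the coupled integral equations *)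

Section Iteration.

Variables (r r' : R) (kA kB : C -> C) (ka kb : R).
Hypotheses (Pr : 0 < r) (HrR : r < r').
Hypotheses (CA : circ_cont r kA) (CB : circ_cont r' kB).
Hypotheses (BA : forall t, Cmod t = r -> Cmod (kA t) <= ka).
Hypotheses (BB : forall t, Cmod t = r' -> Cmod (kB t) <= kb).

Let A (f : C -> C) (z : C) : C := circle_int r (fun t => f t * kA t * / (t - z))%C.
Let B (f : C -> C) (z : C) : C := circle_int r' (fun t => f t * kB t * / (t - z))%C.
Let qa : R := 2 * PI * (r * ka) / (r' - r).
Let qb : R := 2 * PI * (r' * kb) / (r' - r).

Variables (eE eI : nat -> C -> C) (Et It : C -> C).
Hypothesis e0 : forall z, eE O z = 1.
(** The recursion is assumed only for iterates continuous on the circle of integration, where the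
    exterior boundary value is the value of the function. [iterates_cont] supplies this continuity
    along the recursion. *)
Hypothesis eA : forall k, (forall t, Cmod t = r -> Cct (eE k) t) ->
  forall z, Cmod z <> r -> eI k z = A (eE k) z.
Hypothesis eB : forall k, (forall t, Cmod t = r' -> Cct (eI k) t) ->
  forall z, Cmod z <> r' -> eE (S k) z = B (eI k) z.
Hypothesis (CE : circ_cont r Et) (CI : circ_cont r' It).
Hypothesis EA : forall z, Cmod z <> r -> It z = A Et z.
Hypothesis EB : forall z, Cmod z <> r' -> Et z = (1 + B It z)%C.
Hypothesis Hq : 0 <= qa * qb < 1.

Lemma Cct_cauchy (s : R) (h f : C -> C) : 0 <= s -> circ_cont s h ->
  (forall z, Cmod z <> s -> f z = circle_int s (fun t => h t * / (t - z))%C) ->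
  forall z, Cmod z <> s -> Cct f z.
Proof.
  intros Hs Hh Hf z Hz. apply (hol_CC (fun z => Cmod z <> s)); auto.
  apply (hol_ext_open _ (fun z => circle_int s (fun t => h t * / (t - z))%C)).
  - intros y Hy. destruct (Cmod_open y (fun x => x <> s) (open_neq s) Hy) as [d [Hd H]].
    exists d. split; auto. intros u Hu. symmetry. auto.
  - apply cauchy_integral_hol; auto.
Qed.

(** A Cauchy integral is continuous off its own circle, hence on the other circle, over which the
    next operator integrates. *)
Lemma iterates_cont (k : nat) : (forall t, Cmod t <> r' -> Cct (eE k) t) /\
  (forall t, Cmod t <> r -> Cct (eI k) t).
Proof.
  assert (Step : forall k, (forall t, Cmod t <> r' -> Cct (eE k) t) ->
    (forall t, Cmod t <> r -> Cct (eI k) t)).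
  { intros j H. assert (H' : forall t, Cmod t = r -> Cct (eE j) t) by (intros; apply H; lra).
    apply (Cct_cauchy r (fun t => eE j t * kA t)%C). lra.
    apply circ_cont_mult; auto. apply circ_cont_of; auto. lra.
    apply eA; auto. }
  induction k as [|k [_ IH]].
  - assert (H : forall t, Cmod t <> r' -> Cct (eE 0) t).
    { intros t _. apply (continuous_ext (T := C_UniformSpace) (U := C_UniformSpace) (fun _ => RtoC 1)).
      intros; symmetry; apply e0. apply CC_const. }
    auto.
  - assert (H : forall t, Cmod t <> r' -> Cct (eE (S k)) t).
    { assert (H' : forall t, Cmod t = r' -> Cct (eI k) t) by (intros; apply IH; lra).
      apply (Cct_cauchy r' (fun t => eI k t * kB t)%C). lra.
      apply circ_cont_mult; auto. apply circ_cont_of; auto. lra.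
      apply eB; auto. }
    auto.
Qed.

(** The index counts the terms removed, so [remE (S k)] belongs to the partial sum up to [k]. The
    recursive form lets the operators be applied one term at a time. *)
Fixpoint remE (k : nat) (z : C) : C :=
  match k with O => Et z | S j => (remE j z - eE j z)%C end.

Fixpoint remI (k : nat) (z : C) : C :=
  match k with O => It z | S j => (remI j z - eI j z)%C end.

Lemma remE_sum (k : nat) (z : C) :
  remE (S k) z = (Et z - sum_n (G := C_AbelianMonoid) (fun j => eE j z) k)%C.
Proof.
  induction k. rewrite sum_O. reflexivity. rewrite sum_Sn. cbn [remE] in *.
  rewrite IHk. unfold plus; simpl. ring.
Qed.

Lemma remI_sum (k : nat) (z : C) :
  remI (S k) z = (It z - sum_n (G := C_AbelianMonoid) (fun j => eI j z) k)%C.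
Proof.
  induction k. rewrite sum_O. reflexivity. rewrite sum_Sn. cbn [remI] in *.
  rewrite IHk. unfold plus; simpl. ring.
Qed.

Lemma circ_cont_eE (k : nat) : circ_cont r (eE k).
Proof. apply circ_cont_of. lra. intros z Hz. apply (proj1 (iterates_cont k)). lra. Qed.

Lemma circ_cont_eI (k : nat) : circ_cont r' (eI k).
Proof. apply circ_cont_of. lra. intros z Hz. apply (proj2 (iterates_cont k)). lra. Qed.

Lemma circ_cont_remE (k : nat) : circ_cont r (remE k).
Proof. induction k; simpl; auto. apply circ_cont_minus; auto. apply circ_cont_eE. Qed.

Lemma circ_cont_remI (k : nat) : circ_cont r' (remI k).
Proof. induction k; simpl; auto. apply circ_cont_minus; auto. apply circ_cont_eI. Qed.

Lemma remI_eq (k : nat) (z : C) : Cmod z <> r -> remI k z = A (remE k) z.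
Proof.
  intros Hz. assert (K := circ_cont_kernel r z ltac:(lra) Hz).
  induction k as [|k IH]; simpl. auto.
  rewrite IH, eA by (auto; intros; apply (proj1 (iterates_cont k)); lra). unfold A.
  assert (C1 := circ_cont_remE k). assert (C2 := circ_cont_eE k).
  rewrite <- circle_int_minus by circ. apply circle_int_ext. lra. intros; ring.
Qed.

(** The inhomogeneous term 1 is the zeroth iterate and cancels on its removal. The remainders
    therefore satisfy a homogeneous recursion, with a shift of the index. *)
Lemma remE_eq (k : nat) (z : C) : Cmod z <> r' -> remE (S k) z = B (remI k) z.
Proof.
  intros Hz. assert (K := circ_cont_kernel r' z ltac:(lra) Hz).
  induction k as [|k IH].
  - simpl. rewrite EB, e0 by auto. simpl. unfold B. ring.
  - change (remE (S k) z - eE (S k) z = B (remI (S k)) z)%C.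
    rewrite IH, eB by (auto; intros; apply (proj2 (iterates_cont k)); lra). unfold B.
    assert (C1 := circ_cont_remI k). assert (C2 := circ_cont_eI k).
    rewrite <- circle_int_minus by circ. apply circle_int_ext. lra. intros; simpl; ring.
Qed.

Lemma remI_bound (k : nat) (z : C) (M : R) : Cmod z <> r ->
  (forall t, Cmod t = r -> Cmod (remE k t) <= M) ->
  Cmod (remI k z) <= 2 * PI * (r * (M * ka * / Rabs (r - Cmod z))).
Proof.
  intros Hz HM. rewrite remI_eq by auto.
  apply (cauchy_integral_bound r (M * ka) (fun t => remE k t * kA t)%C); auto. lra.
  apply circ_cont_mult; auto. apply circ_cont_remE.
  intros t Ht. rewrite Cmod_mult. apply Rmult_le_compat; try apply Cmod_ge_0; auto.
Qed.

Lemma remE_bound (k : nat) (z : C) (M : R) : Cmod z <> r' ->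
  (forall t, Cmod t = r' -> Cmod (remI k t) <= M) ->
  Cmod (remE (S k) z) <= 2 * PI * (r' * (M * kb * / Rabs (r' - Cmod z))).
Proof.
  intros Hz HM. rewrite remE_eq by auto.
  apply (cauchy_integral_bound r' (M * kb) (fun t => remI k t * kB t)%C); auto. lra.
  apply circ_cont_mult; auto. apply circ_cont_remI.
  intros t Ht. rewrite Cmod_mult. apply Rmult_le_compat; try apply Cmod_ge_0; auto.
Qed.

(** The circles are at distance r' - r. Thus [A] carries a bound on |t| = r to |t| = r' with the
    factor [qa], and [B] carries it back with the factor [qb]. *)
Lemma rem_geometric : exists M, forall k,
  (forall t, Cmod t = r -> Cmod (remE k t) <= M * (qa * qb) ^ k) /\
  (forall t, Cmod t = r' -> Cmod (remI k t) <= M * (qa * qb) ^ k * qa).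
Proof.
  destruct (circ_cont_bounded r Et CE) as [M [PM HM]]. exists M.
  assert (St : forall k, (forall t, Cmod t = r -> Cmod (remE k t) <= M * (qa * qb) ^ k) ->
    (forall t, Cmod t = r' -> Cmod (remI k t) <= M * (qa * qb) ^ k * qa)).
  { intros k H t Ht. eapply Rle_trans. apply remI_bound; [lra | exact H].
    rewrite Ht, Rabs_left by lra. unfold qa at 3. right. field. lra. }
  induction k as [|k [IH1 IH2]].
  - assert (H : forall t, Cmod t = r -> Cmod (remE 0 t) <= M * (qa * qb) ^ 0).
    { intros t Ht. simpl. rewrite Rmult_1_r. auto. } auto.
  - assert (H : forall t, Cmod t = r -> Cmod (remE (S k) t) <= M * (qa * qb) ^ S k).
    { intros t Ht. eapply Rle_trans. apply remE_bound; [lra | exact IH2].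
      rewrite Ht, Rabs_pos_eq by lra. simpl. unfold qb at 2. right. field. lra. }
    auto.
Qed.

(** One further application of [B] passes from the circle to an arbitrary [z] off it. The distance
    of [z] to the circle affects only the constant, not the ratio. *)
Lemma series_E (z : C) : Cmod z <> r' -> CSeries (fun k => eE k z) = Et z.
Proof.
  intros Hz. destruct rem_geometric as [M HM].
  apply (is_series_geometric _ _ (2 * PI * (r' * (M * qa * kb * / Rabs (r' - Cmod z)))) (qa * qb)); auto.
  intros k. rewrite <- remE_sum.
  eapply Rle_trans. apply remE_bound; [auto | apply HM]. right. ring.
Qed.

Lemma series_I (z : C) : Cmod z <> r -> CSeries (fun k => eI k z) = It z.
Proof.
  intros Hz. destruct rem_geometric as [M HM].
  apply (is_series_geometric _ _ (2 * PI * (r * (M * (qa * qb) * ka * / Rabs (r - Cmod z)))) (qa * qb)); auto.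
  intros k. rewrite <- remI_sum.
  eapply Rle_trans. apply remI_bound; [auto | apply HM]. right. simpl. ring.
Qed.

End Iteration.

(** * Orthogonal polynomials *)

Lemma sum_n_C_S (u : nat -> C) (n : nat) :
  sum_n (G := C_AbelianMonoid) u (S n) = (sum_n (G := C_AbelianMonoid) u n + u (S n))%C.
Proof. apply (sum_Sn (G := C_AbelianMonoid)). Qed.

Lemma hol_polynomial (U : C -> Prop) (a : nat -> C) (n : nat) :
  hol U (fun z => sum_n (G := C_AbelianMonoid) (fun k => a k * z ^ k)%C n).
Proof.
  induction n.
  - apply (hol_ext_open _ (fun z => a O * z ^ 0)%C).
    + intros z _. exists 1. split. lra. intros y _. rewrite sum_O. reflexivity.
    + apply hol_mult. apply hol_const. apply hol_pow, hol_id.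
  - apply (hol_ext_open _ (fun z => sum_n (G := C_AbelianMonoid) (fun k => a k * z ^ k)%C n
       + a (S n) * z ^ S n)%C).
    + intros z _. exists 1. split. lra. intros y _. rewrite sum_n_C_S. reflexivity.
    + apply hol_plus; auto. apply hol_mult. apply hol_const. apply hol_pow, hol_id.
Qed.

Lemma polynomial_at_infinity (a : nat -> C) (n : nat) :
  tends_at_infinity
    (fun z => sum_n (G := C_AbelianMonoid) (fun k => a k * z ^ k) n * / z ^ n)%C (a n).
Proof.
  induction n.
  - apply (tends_ext 0 (fun _ => a O)). intros z _. rewrite sum_O. simpl. field.
    apply tends_const.
  - apply (tends_ext 0 (fun z => sum_n (G := C_AbelianMonoid) (fun k => a k * z ^ k) n * / z ^ n
      * / z + a (S n))%C).
    + intros z Hz. assert (Nz : z <> 0) by (apply Cmod_gt_0; auto).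
      rewrite sum_n_C_S. simpl. field. split; auto. apply Cpow_nz, Nz.
    + apply (tends_eq _ (a n * 0 + a (S n))%C); [|ring].
      apply tends_plus. apply tends_mult. exact IHn. apply tends_inv_id. apply tends_const.
Qed.

Lemma CC_hol_expi (f : C -> C) (t : R) : hol (fun _ => True) f -> CC (fun u : R => f (expi u)) t.
Proof.
  intros H. apply (continuous_comp (U := R_UniformSpace) (V := C_UniformSpace) expi f).
  apply CC_expi. apply (hol_CC _ _ _ H). exact I.
Qed.

Lemma CRInt_conj_polynomial (g : R -> C) (a : nat -> C) (m : nat) : (forall t, CC g t) ->
  (forall k, (k < m)%nat -> CRInt (fun t => g t * Cconj (expi t ^ k))%C 0 (2 * PI) = 0) ->
  CRInt (fun t => g t * Cconj (sum_n (G := C_AbelianMonoid) (fun k => a k * expi t ^ k) m))%C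
    0 (2 * PI)
  = (Cconj (a m) * CRInt (fun t => g t * Cconj (expi t ^ m)) 0 (2 * PI))%C.
Proof.
  intros Hg. assert (Ex : forall k, ex_CRInt (fun t => g t * Cconj (expi t ^ k))%C 0 (2 * PI)).
  { intros k. apply ex_CRInt_cont. intros t _. apply CC_mult. apply Hg.
    apply CC_conj, CC_pow, CC_expi. }
  induction m as [|m IH]; intros H.
  - rewrite <- CRInt_scal by apply Ex. apply CRInt_ext. intros t _.
    rewrite sum_O, Cmult_conj. ring.
  - transitivity (CRInt (fun t =>
        g t * Cconj (sum_n (G := C_AbelianMonoid) (fun k => a k * expi t ^ k) m)
        + Cconj (a (S m)) * (g t * Cconj (expi t ^ S m)))%C 0 (2 * PI)).
    + apply CRInt_ext. intros t _. rewrite sum_n_C_S, Cplus_conj, Cmult_conj. ring.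
    + rewrite CRInt_plus.
      * rewrite IH, H by (auto; intros; apply H; lia). rewrite CRInt_scal by apply Ex. ring.
      * apply ex_CRInt_cont. intros t _. apply CC_mult. apply Hg. apply CC_conj.
        apply (CC_hol_expi (fun z => sum_n (G := C_AbelianMonoid) (fun k => a k * z ^ k)%C m)).
        apply hol_polynomial.
      * apply ex_CRInt_scal, Ex.
Qed.

Lemma orthonormal_polynomial_hol (w : C -> R) (phi : nat -> C -> C) (kappa : nat -> R) (n : nat)
    (U : C -> Prop) : orthonormal_polynomials w phi kappa -> hol U (phi n).
Proof.
  intros [_ [H _]]. destruct (H n) as [a [_ Ha]].
  apply (hol_ext_open _ (fun z => sum_n (G := C_AbelianMonoid) (fun k => a k * z ^ k)%C n)).
  - intros z _. exists 1. split. lra. intros y _. symmetry. apply Ha.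
  - apply hol_polynomial.
Qed.

Lemma CC_weight_expi (w : C -> R) (t : R) : analytic_weight w ->
  CC (fun u : R => RtoC (w (expi u))) t.
Proof.
  intros Hw. apply (continuous_ext (T := R_UniformSpace) (U := C_UniformSpace)
      (fun u : R => RtoC (w (RtoC 1 * expi u)%C))).
  intros u; rewrite Cmult_1_l; auto. apply circ_cont_weight, Hw.
Qed.

(** Strong induction on [m]: against the conjugate of [phi m] the lower monomials contribute 0, so
    orthogonality leaves the integral for t^m times the nonzero leading coefficient. *)
Lemma orthogonal_monomials (w : C -> R) (phi : nat -> C -> C) (kappa : nat -> R) (n m : nat) :
  analytic_weight w -> orthonormal_polynomials w phi kappa -> (m < n)%nat ->
  CRInt (fun t => phi n (expi t) * RtoC (w (expi t)) * Cconj (expi t ^ m))%C 0 (2 * PI) = 0.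
Proof.
  intros Hw Ho. induction m as [m IH] using lt_wf_ind. intros Hm.
  assert (Cg : forall t, CC (fun t : R => phi n (expi t) * RtoC (w (expi t)))%C t).
  { intros t. apply CC_mult. apply CC_hol_expi. eapply orthonormal_polynomial_hol, Ho.
    apply CC_weight_expi, Hw. }
  destruct Ho as [Hk [Hp Hi]]. destruct (Hp m) as [a [Ea Ha]].
  assert (Q := CRInt_conj_polynomial _ a m Cg (fun k Hkm => IH k Hkm ltac:(lia))).
  rewrite (CRInt_ext _ (fun t => phi n (expi t) * Cconj (phi m (expi t)) * RtoC (w (expi t)))%C) in Q.
  2:{ intros t _. rewrite Ha. ring. }
  rewrite Hi in Q. replace (Nat.eqb n m) with false in Q by (symmetry; apply Nat.eqb_neq; lia).
  assert (N : Cconj (a m) <> 0).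
  { apply Cconj_neq_0. rewrite Ea. intros E; apply RtoC_inj in E. specialize (Hk m). lra. }
  set (X := CRInt (fun t => phi n (expi t) * RtoC (w (expi t)) * Cconj (expi t ^ m))%C 0 (2 * PI)) in *.
  rewrite <- (Cmult_1_l X), <- (Cinv_l _ N), <- Cmult_assoc, <- Q. ring.
Qed.

(** On the unit circle dt = i t dtheta, and t^k t / t^n is the conjugate of t^(n-1-k); the factor t
    from dt accounts for the shift by one. *)
Lemma orthonormal_moments (w : C -> R) (phi : nat -> C -> C) (kappa : nat -> R) (n k : nat) :
  analytic_weight w -> orthonormal_polynomials w phi kappa -> (k < n)%nat ->
  circle_int 1 (fun t => phi n t / RtoC (kappa n) * RtoC (w t) * / t ^ n * t ^ k)%C = 0.
Proof.
  intros Hw Ho Hk.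
  assert (Z := orthogonal_monomials w phi kappa n (n - 1 - k) Hw Ho ltac:(lia)).
  unfold circle_int.
  rewrite (CRInt_ext _ (fun t => Ci / RtoC (kappa n) *
     (phi n (expi t) * RtoC (w (expi t)) * Cconj (expi t ^ (n - 1 - k))))%C).
  - rewrite CRInt_scal, Z. ring. apply ex_CRInt_cont. intros t _. apply CC_mult. apply CC_mult.
    apply CC_hol_expi. eapply orthonormal_polynomial_hol, Ho. apply CC_weight_expi, Hw.
    apply CC_conj, CC_pow, CC_expi.
  - intros t _. rewrite Cmult_1_l. assert (N := expi_neq_0 t).
    assert (Nk : RtoC (kappa n) <> 0).
    { intros E; apply RtoC_inj in E. destruct Ho as [Hp _]. specialize (Hp n). lra. }
    rewrite Cpow_conj, Cconj_expi, Cpow_inv by auto.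
    replace (expi t ^ n)%C with (expi t ^ (n - 1 - k) * expi t ^ k * expi t)%C.
    + field. repeat split; auto using Cpow_nz.
    + rewrite <- Cpow_add_r, Cmult_comm, <- Cpow_S. f_equal. lia.
Qed.

(** * Boundary values and the continued Szego functions *)

(** The points (1 + delta) t with delta > 0 lie outside the circle and accumulate at [t], so the
    one-sided filter is proper and its limit unique. *)
Lemma exterior_value_eq (f : C -> C) (t : C) : t <> 0 -> Cct f t -> exterior_value f t = f t.
Proof.
  intros Nt Hf. unfold exterior_value.
  assert (PF : ProperFilter' (within (fun z : C => Cmod t < Cmod z)
    (locally (T := C_UniformSpace) t))).
  { constructor.
    + intros H. apply (locally_Cmod t) in H. destruct H as [d [Hd H]].
      assert (Pt : 0 < Cmod t) by (apply Cmod_gt_0, Nt).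
      assert (Pe : 0 < d / (2 * Cmod t)) by (apply Rdiv_lt_0_compat; lra).
      apply (H (RtoC (1 + d / (2 * Cmod t)) * t)%C).
      * replace (RtoC (1 + d / (2 * Cmod t)) * t - t)%C with (RtoC (d / (2 * Cmod t)) * t)%C
          by (rewrite RtoC_plus; ring).
        rewrite Cmod_mult, Cmod_R, Rabs_pos_eq by lra.
        replace (d / (2 * Cmod t) * Cmod t) with (d / 2) by (field; lra). lra.
      * rewrite Cmod_mult, Cmod_R, Rabs_pos_eq by lra. nra.
    + apply within_filter, locally_filter. }
  apply (iota_filterlim_locally (K := C_AbsRing) (V := C_CompleteNormedModule)).
  intros P HP. apply (filter_imp (F := locally (T := C_UniformSpace) t) (fun y => P (f y))); auto.
  apply (Hf P HP).
Qed.

Lemma De_hol (w : C -> R) (s : R) (f : C -> C) : 0 < s < 1 -> De_extension w s f ->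
  hol (fun z => s < Cmod z) (De w).
Proof.
  intros Hs Hf. apply (hol_ext_open _ f).
  - intros z Hz. destruct (Cmod_open z (fun x => s < x) (open_gt s) Hz) as [d [Hd H]].
    exists d. split; auto. intros y Hy. symmetry. apply (De_eq w s); auto.
  - apply hol_iff, Hf.
Qed.

Lemma inv_Di_hol (w : C -> R) (s : R) (f : C -> C) : analytic_weight w ->
  0 < s < 1 -> De_extension w s f -> hol (fun z => Cmod z < / s) (inv_Di w).
Proof.
  intros Hw Hs Hf. destruct (inv_Di_extension_reflect w s f Hw Hs Hf) as [H _].
  apply hol_iff in H. revert H. apply hol_ext_open.
  intros z Hz. destruct (Cmod_open z (fun x => x < / s) (open_lt (/ s)) Hz) as [d [Hd H]].
  exists d. split; auto. intros y Hy. symmetry. apply (inv_Di_eq w s); auto.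
Qed.

Lemma inv_Di_szego (w : C -> R) (s : R) (f : C -> C) (z : C) : analytic_weight w ->
  0 < s < 1 -> De_extension w s f -> Cmod z < 1 -> inv_Di w z = (/ szego w z)%C.
Proof.
  intros Hw Hs Hf Hz. rewrite (inv_Di_eq w s f); auto.
  - apply (inv_Di_extension_reflect w s f Hw Hs Hf), Hz.
  - assert (1 < / s) by (rewrite <- Rinv_1 at 1; apply Rinv_lt_contravar; lra). lra.
Qed.

Lemma inv_Di_conj_De (w : C -> R) (s : R) (f : C -> C) (z : C) : analytic_weight w ->
  0 < s < 1 -> De_extension w s f -> z <> 0 -> Cmod z < / s ->
  inv_Di w z = Cconj (De w (/ Cconj z)).
Proof.
  intros Hw Hs Hf Nz Hz. rewrite (inv_Di_eq w s f); auto.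
  destruct excluded_middle_informative as [E|_]; [contradiction|].
  unfold reflect. rewrite (De_eq w s f); auto.
  rewrite Cmod_reflect by auto. rewrite <- (Rinv_inv s). apply Cmod_gt_0 in Nz.
  apply Rinv_lt_contravar; auto. apply Rmult_lt_0_compat; auto. apply Rinv_0_lt_compat; lra.
Qed.

Lemma reflect_unit (t : C) : Cmod t = 1 -> (/ Cconj t)%C = t.
Proof.
  intros Ht. assert (E := Cmod2_conj t). rewrite Ht in E.
  assert (N : Cconj t <> 0) by (apply Cmod_gt_0; rewrite Cmod_conj; lra).
  replace (RtoC (1 ^ 2)) with (RtoC 1) in E by (f_equal; ring).
  rewrite <- (Cmult_1_l (/ Cconj t)), E. field. exact N.
Qed.

(** Reflection fixes the points of the unit circle, so [inv_Di] is the conjugate of [De] there and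
    the product is |De|^2 = 1 / w. *)
Lemma De_inv_Di_weight (w : C -> R) (s : R) (f : C -> C) (t : C) : analytic_weight w ->
  0 < s < 1 -> De_extension w s f -> Cmod t = 1 -> (De w t * inv_Di w t * RtoC (w t))%C = 1.
Proof.
  intros Hw Hs Hf Ht.
  assert (1 < / s) by (rewrite <- Rinv_1 at 1; apply Rinv_lt_contravar; lra).
  assert (Nt : t <> 0) by (apply Cmod_gt_0; lra).
  rewrite (inv_Di_conj_De w s f) by (auto; lra). rewrite reflect_unit by auto.
  rewrite <- Cmod2_conj, (De_eq w s f) by (auto; lra).
  rewrite (De_extension_boundary w s f t) by (auto; lra).
  destruct Hw as [Hp _]. rewrite exp_Ropp, exp_ln by auto.
  rewrite <- RtoC_mult. f_equal. field. apply Rgt_not_eq, Hp, Ht.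
Qed.

(** * The iterates and the representation of the monic orthogonal polynomials *)

Lemma iterate_odd (w : C -> R) (r : R) (n k : nat) :
  iterate w r n (2 * k + 1) = Mi w r n (iterate w r n (2 * k)).
Proof.
  rewrite Nat.add_1_r. change (iterate w r n (S (2 * k))) with
    (if Nat.even (2 * k) then Mi w r n (iterate w r n (2 * k)) else Me w r n (iterate w r n (2 * k))).
  rewrite Nat.even_mul. reflexivity.
Qed.

Lemma iterate_even (w : C -> R) (r : R) (n k : nat) :
  iterate w r n (2 * S k) = Me w r n (iterate w r n (2 * k + 1)).
Proof.
  replace (2 * S k)%nat with (S (2 * k + 1)) by lia.
  change (iterate w r n (S (2 * k + 1))) with
    (if Nat.even (2 * k + 1) then Mi w r n (iterate w r n (2 * k + 1))
     else Me w r n (iterate w r n (2 * k + 1))).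
  rewrite Nat.even_add, Nat.even_mul. reflexivity.
Qed.

Theorem theorem1 :
  forall (w : C -> R), analytic_weight w ->
  forall (phi : nat -> C -> C) (kappa : nat -> R),
    orthonormal_polynomials w phi kappa ->
  forall (r : R), Rbar_lt (rho w) (Finite r) -> r < 1 ->
  forall (Lambda : R),
    is_max_on_circle (fun z : C => Cmod (calF w z)) r Lambda ->
  forall (n : nat), Lambda * r ^ n < / r - r ->
  forall (z : C),
    (/ r < Cmod z ->
       (phi n z / RtoC (kappa n))%C
       = (/ RtoC (tau w) * z ^ n * De w z * calE w r n z)%C) /\
    (r < Cmod z < / r ->
       (phi n z / RtoC (kappa n))%C
       = (/ RtoC (tau w) * z ^ n * De w z * calE w r n z
          - RtoC (tau w) * calI w r n z * inv_Di w z)%C) /\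
    (Cmod z < r ->
       (phi n z / RtoC (kappa n))%C
       = (- (RtoC (tau w) * calI w r n z * inv_Di w z))%C).
Proof.
  intros w Hw phi kappa Ho r Hrho Hr1 Lambda [HLam [z0 [Hz0 Ez0]]] n Hn.
  destruct (rho_lt_extension w r Hrho) as [s [f [Hs [Hsr Hf]]]].
  assert (P := PI_RGT_0).
  assert (Hr : 0 < r) by lra.
  assert (Ir : 1 < / r) by (rewrite <- Rinv_1 at 1; apply Rinv_lt_contravar; lra).
  assert (Irs : / r < / s) by (apply Rinv_lt_contravar; auto; apply Rmult_lt_0_compat; lra).
  assert (Pt := tau_pos w).
  assert (Nt : RtoC (tau w) <> 0) by (intros E; apply RtoC_inj in E; lra).
  assert (HD := De_hol w s f Hs Hf). assert (HI := inv_Di_hol w s f Hw Hs Hf).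
  assert (DS : forall z, 1 < Cmod z -> De w z = szego w z).
  { intros z Hz. rewrite (De_eq w s f) by (auto; lra). apply Hf, Hz. }
  assert (IS := fun z => inv_Di_szego w s f z Hw Hs Hf).
  assert (ND : forall z, 1 < Cmod z -> De w z <> 0).
  { intros z Hz. rewrite DS by auto. apply szego_neq_0. }
  assert (NI : forall z, Cmod z < 1 -> inv_Di w z <> 0).
  { intros z Hz. rewrite IS by auto. intros E. apply C1_nz.
    rewrite <- (Cinv_r (szego w z)), E by apply szego_neq_0. ring. }
  assert (WD := fun t => De_inv_Di_weight w s f t Hw Hs Hf).
  (* On the unit circle [De] cannot vanish, by the product identity [WD]; this gives a zero-free
     annulus for the Laurent splitting. *)
  destruct (nonzero_near_unit_circle (De w)) as [a0 [Ha0 Na0]].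
  { intros z Hz. apply (hol_CC _ _ _ HD). lra. }
  { intros z Hz E. apply C1_nz. rewrite <- (WD z Hz), E. ring. }
  (* The maximum keeps the zero-free annulus inside the domain of the extension. *)
  set (a := Rmax a0 s). assert (a1 := Rmax_l a0 s). assert (a2 := Rmax_r a0 s). fold a in a1, a2.
  assert (a3 : a < 1) by (apply Rmax_lub_lt; lra).
  assert (NDa : forall z, a < Cmod z -> De w z <> 0).
  { intros z Hz. destruct (Rle_dec (Cmod z) 1). apply Na0; lra. apply ND; lra. }
  assert (NIa : forall z, Cmod z < / a -> inv_Di w z <> 0).
  { intros z Hz. destruct (Rlt_dec (Cmod z) 1) as [L|L]. apply NI; lra.
    assert (Nz : z <> 0) by (apply Cmod_gt_0; lra).
    assert (/ a <= / s) by (apply Rinv_le_contravar; lra).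
    rewrite (inv_Di_conj_De w s f) by (auto; lra). apply Cconj_neq_0, NDa.
    rewrite Cmod_reflect by auto. rewrite <- (Rinv_inv a).
    apply Rinv_lt_contravar; auto. apply Rmult_lt_0_compat. lra. apply Rinv_0_lt_compat; lra. }
  set (Phi := fun z => (phi n z / RtoC (kappa n))%C).
  assert (Pk : 0 < kappa n) by apply Ho.
  assert (Nk : RtoC (kappa n) <> 0) by (intros E; apply RtoC_inj in E; lra).
  assert (HP : hol (fun _ => True) Phi).
  { apply (hol_mult _ (phi n) (fun _ => / RtoC (kappa n))%C).
    eapply orthonormal_polynomial_hol, Ho. apply hol_const. }
  assert (LD : tends_at_infinity (De w) (RtoC (tau w))).
  { apply (tends_ext 1 (szego w)). intros; symmetry; auto. apply szego_infinity, Hw. }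
  assert (LP : tends_at_infinity (fun z => Phi z * / z ^ n)%C 1).
  { destruct Ho as [_ [Hp _]]. destruct (Hp n) as [c [Ec Hc]].
    apply (tends_ext 0 (fun z => / RtoC (kappa n) *
      (sum_n (G := C_AbelianMonoid) (fun k => c k * z ^ k) n * / z ^ n))%C).
    { intros z Hz. unfold Phi. rewrite Hc. unfold Cdiv. ring. }
    apply (tends_eq _ (/ RtoC (kappa n) * c n)%C).
    apply tends_mult. apply tends_const. apply polynomial_at_infinity.
    rewrite Ec. field. exact Nk. }
  destruct (jump_solution s a n (De w) (inv_Di w) Phi (fun t => RtoC (w t))) as [E [I [HE [HIm [LI HF]]]]];
    auto; try lra.
  { intros k Hk. apply (orthonormal_moments w phi kappa); auto. }
  { eexists; exact LD. }
  destruct (integral_equations s r n (De w) (inv_Di w) Phi E I (tau w)) as [M1 M2]; auto; try lra.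
  set (Et := fun z => if Rlt_dec (Cmod z) (/ r) then (RtoC (tau w) * E z)%C
     else (RtoC (tau w) * (Phi z * / z ^ n) * / De w z)%C) in *.
  set (It := fun z => if Rlt_dec r (Cmod z) then (/ RtoC (tau w) * I z)%C
     else (- (/ RtoC (tau w) * (Phi z * / inv_Di w z)))%C) in *.
  set (kA := fun t => (- / (RtoC (2 * PI) * Ci * RtoC (tau w ^ 2)) *
     (De w t * / inv_Di w t * t ^ n))%C).
  set (kB := fun t => (RtoC (tau w ^ 2) / (RtoC (2 * PI) * Ci) *
     (inv_Di w t * / De w t * / t ^ n))%C).
  assert (CDr : circ_cont r (De w)) by (apply (circ_cont_hol r _ _ ltac:(lra) HD); intros; lra).
  assert (CIr : circ_cont r (fun t => / inv_Di w t)%C).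
  { apply circ_cont_inv. lra. apply (circ_cont_hol r _ _ ltac:(lra) HI); intros; lra.
    intros; apply NI; lra. }
  assert (CDR : circ_cont (/ r) (fun t => / De w t)%C).
  { apply circ_cont_inv. lra. apply (circ_cont_hol (/ r) _ _ ltac:(lra) HD); intros; lra.
    intros; apply ND; lra. }
  assert (CIR : circ_cont (/ r) (inv_Di w)) by (apply (circ_cont_hol (/ r) _ _ ltac:(lra) HI); intros; lra).
  assert (CpR : circ_cont (/ r) (fun t => / t ^ n)%C).
  { apply circ_cont_inv. lra. apply circ_cont_pow, circ_cont_id.
    intros; apply Cpow_nz, Cmod_gt_0. lra. }
  assert (CA : circ_cont r kA) by (unfold kA; circ).
  assert (CB : circ_cont (/ r) kB) by (unfold kB; circ).
  assert (FA : forall t, Cmod t = r -> calF w t = (De w t * / inv_Di w t)%C).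
  { intros t Ht. unfold calF, Di. rewrite IS by lra. field. apply szego_neq_0. }
  set (x := Lambda * r ^ n) in *.
  (* The maximum is attained, so Lambda is itself a modulus and hence nonnegative. *)
  assert (Px : 0 <= x).
  { unfold x. apply Rmult_le_pos. rewrite <- Ez0. apply Cmod_ge_0. apply pow_le; lra. }
  assert (Pt2 : 0 < tau w ^ 2) by (apply pow_lt, Pt).
  assert (MK : Cmod (RtoC (2 * PI) * Ci) = 2 * PI).
  { rewrite Cmod_mult, Cmod_R, Cmod_Ci, Rabs_pos_eq; lra. }
  assert (NT2 : RtoC (tau w ^ 2) <> 0) by (intros Q; apply RtoC_inj in Q; lra).
  assert (BA : forall t, Cmod t = r -> Cmod (kA t) <= / (2 * PI * tau w ^ 2) * x).
  { intros t Ht. unfold kA. rewrite <- FA by auto.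
    rewrite !Cmod_mult, Cmod_opp, Cmod_inv by (apply Cmult_neq_0; auto using two_PI_Ci_neq_0).
    rewrite Cmod_mult, MK, Cmod_R, Rabs_pos_eq, Cmod_pow, Ht by lra.
    apply Rmult_le_compat_l. left. apply Rinv_0_lt_compat, Rmult_lt_0_compat; lra.
    unfold x. apply Rmult_le_compat_r. apply pow_le; lra. apply HLam, Ht. }
  assert (BB : forall t, Cmod t = / r -> Cmod (kB t) <= tau w ^ 2 / (2 * PI) * x).
  { intros t Ht. unfold kB.
    assert (N0 : t <> 0) by (apply Cmod_gt_0; lra).
    assert (Mt : Cmod (/ Cconj t) = r) by (rewrite Cmod_reflect, Ht, Rinv_inv; auto).
    rewrite Cmod_mult, Cmod_div, MK, Cmod_R, Rabs_pos_eq by (auto using two_PI_Ci_neq_0; lra).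
    apply Rmult_le_compat_l.
    { apply Rmult_le_pos. lra. left; apply Rinv_0_lt_compat; lra. }
    rewrite Cmod_mult, Cmod_inv, Cmod_pow, Ht, pow_inv, Rinv_inv by (apply Cpow_nz; auto).
    unfold x. apply Rmult_le_compat_r. apply pow_le; lra.
    (* On |t| = 1/r the value of [inv_calF] is the conjugate of [calF] at the reflected point 1 /
       conj t, of modulus r, so Lambda bounds it as well. *)
    apply Rle_trans with (Cmod (calF w (/ Cconj t))); [|apply HLam, Mt].
    right. unfold calF, Di.
    rewrite <- (Cmod_conj (szego w (/ Cconj t) * _)), Cmult_conj.
    rewrite <- (inv_Di_conj_De w s f) by (auto; lra).
    rewrite szego_reflect, <- DS by (auto; lra).
    rewrite Cinv_conj, Cconj_conj by (apply Cconj_neq_0, ND; lra).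
    f_equal. ring. }
  assert (NU : forall t, Cmod t = r -> t <> 0) by (intros; apply Cmod_gt_0; lra).
  assert (NUR : forall t, Cmod t = / r -> t <> 0) by (intros; apply Cmod_gt_0; lra).
  assert (eA : forall k, (forall t, Cmod t = r -> Cct (iterate w r n (2 * k)) t) ->
    forall z, Cmod z <> r -> iterate w r n (2 * k + 1) z =
      circle_int r (fun t => iterate w r n (2 * k) t * kA t * / (t - z))%C).
  { intros k Hc z Hz. rewrite iterate_odd. unfold Mi.
    assert (Ce : circ_cont r (iterate w r n (2 * k))) by (apply circ_cont_of; auto; lra).
    assert (Kz := circ_cont_kernel r z ltac:(lra) Hz).
    set (e := iterate w r n (2 * k)) in *.
    rewrite (circle_int_ext r _ (fun t => e t * (De w t * / inv_Di w t * t ^ n) * / (t - z))%C); [|lra|].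
    - rewrite <- circle_int_scal by circ. apply circle_int_ext. lra. intros; unfold kA; ring.
    - intros t Ht. rewrite exterior_value_eq, FA by auto. unfold Cdiv. ring. }
  assert (eB : forall k, (forall t, Cmod t = / r -> Cct (iterate w r n (2 * k + 1)) t) ->
    forall z, Cmod z <> / r -> iterate w r n (2 * S k) z =
      circle_int (/ r) (fun t => iterate w r n (2 * k + 1) t * kB t * / (t - z))%C).
  { intros k Hc z Hz. rewrite iterate_even. unfold Me.
    assert (Ce : circ_cont (/ r) (iterate w r n (2 * k + 1))) by (apply circ_cont_of; auto; lra).
    assert (Kz := circ_cont_kernel (/ r) z ltac:(lra) Hz).
    set (e := iterate w r n (2 * k + 1)) in *.
    rewrite (circle_int_ext (/ r) _ (fun t => e t * (inv_Di w t * / De w t * / t ^ n) * / (t - z))%C); [|lra|].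
    - rewrite <- circle_int_scal by circ. apply circle_int_ext. lra. intros; unfold kB; ring.
    - intros t Ht. rewrite exterior_value_eq by auto. unfold inv_calF.
      assert (N1 : De w t <> 0) by (apply ND; lra).
      assert (N2 : (t - z)%C <> 0) by (apply kernel_neq_0; lra).
      assert (N3 : (t ^ n)%C <> 0) by (apply Cpow_nz; auto).
      field. auto. }
  assert (CE : circ_cont r Et).
  { apply (circ_cont_ext r (fun t => RtoC (tau w) * E t)%C). lra.
    - intros t Ht. unfold Et. destruct Rlt_dec; [auto|lra].
    - assert (C0 : circ_cont r E) by (apply (circ_cont_hol r _ _ ltac:(lra) HE); intros; lra). circ. }
  assert (CI : circ_cont (/ r) It).
  { apply (circ_cont_ext (/ r) (fun t => / RtoC (tau w) * I t)%C). lra.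
    - intros t Ht. unfold It. destruct Rlt_dec; [auto|lra].
    - assert (C0 : circ_cont (/ r) I) by (apply (circ_cont_hol (/ r) _ _ ltac:(lra) HIm); intros; lra). circ. }
  (* The factors [tau w ^ 2] and [r] enter the two operator bounds reciprocally and cancel, leaving
     (x / (1/r - r))^2, which is below 1 by the assumption on n. *)
  assert (Hq : 0 <= 2 * PI * (r * (/ (2 * PI * tau w ^ 2) * x)) / (/ r - r) *
     (2 * PI * (/ r * (tau w ^ 2 / (2 * PI) * x)) / (/ r - r)) < 1).
  { replace (2 * PI * (r * (/ (2 * PI * tau w ^ 2) * x)) / (/ r - r) *
     (2 * PI * (/ r * (tau w ^ 2 / (2 * PI) * x)) / (/ r - r))) with
       ((x / (/ r - r)) * (x / (/ r - r))).
    - assert (0 <= x / (/ r - r)) by (apply Rmult_le_pos; auto; left; apply Rinv_0_lt_compat; lra).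
      assert (x / (/ r - r) < 1) by (apply Rlt_div_l; lra). nra.
    - set (y := / r - r). assert (y <> 0) by (unfold y; lra). field. repeat split; auto; lra. }
  assert (SE := fun z Hz => series_E r (/ r) kA kB _ _ Hr ltac:(lra) CA CB BA BB
    (fun k => iterate w r n (2 * k)) (fun k => iterate w r n (2 * k + 1)) Et It
    (fun z => eq_refl) eA eB CE CI M1 M2 Hq z Hz).
  assert (SI := fun z Hz => series_I r (/ r) kA kB _ _ Hr ltac:(lra) CA CB BA BB
    (fun k => iterate w r n (2 * k)) (fun k => iterate w r n (2 * k + 1)) Et It
    (fun z => eq_refl) eA eB CE CI M1 M2 Hq z Hz).
  intros z. change (phi n z / RtoC (kappa n))%C with (Phi z). unfold calE, calI.
  split; [|split]; intros Hz.
  - rewrite SE by lra. unfold Et. destruct Rlt_dec; [lra|].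
    field. repeat split; auto. apply ND; lra. apply Cpow_nz, Cmod_gt_0; lra.
  - rewrite SE, SI by lra. unfold Et, It. destruct Rlt_dec; [|lra]. destruct Rlt_dec; [|lra].
    rewrite HF by lra. field. auto.
  - rewrite SI by lra. unfold It. destruct Rlt_dec; [lra|].
    field. split; auto. apply NI; lra.
Qed.
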